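(* Let $(\Lambda,d)$ be a finitely aligned $k$-graph. There exists a Cuntz-Krieger $\Lambda$-family $\{t_\lambda:\lambda\in\Lambda\}$ such that $t_v\neq0$ for every $v\in\Lambda^0$, and such that there exists a strongly continuous action $\theta:\mathbb{T}^k\to\operatorname{Aut}(C^*(\{t_\lambda:\lambda\in\Lambda\}))$ satisfying $\theta_z(t_\lambda)=z^{d(\lambda)}t_\lambda$ for all $\lambda\in\Lambda$ (and $z\in\mathbb{T}^k$). Furthermore, any two such families generate canonically isomorphic $C^*$-algebras; that is, if $\{t_\lambda\}$ and $\{t'_\lambda\}$ are two such families, there is an isomorphism $C^*(\{t_\lambda:\lambda\in\Lambda\})\to C^*(\{t'_\lambda:\lambda\in\Lambda\})$ carrying $t_\lambda$ to $t'_\lambda$ for every $\lambda\in\Lambda$.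
   Context: Conventions: $0\in\mathbb{N}$; $\mathbb{N}^k$ is a semigroup with generators $e_1,\dots,e_k$, coordinatewise partial order $\le$, and $m\vee n$ denotes the coordinatewise maximum. For $z\in\mathbb{T}^k$ and $m\in\mathbb{N}^k$, $z^m=z_1^{m_1}\cdots z_k^{m_k}$. A $k$-graph $(\Lambda,d)$ is a countable small category $\Lambda$ with a functor $d:\Lambda\to\mathbb{N}^k$ satisfying the factorisation property: if $d(\lambda)=m+n$ there are unique $\mu,\sigma\in\Lambda$ with $d(\mu)=m$, $d(\sigma)=n$, $\lambda=\mu\sigma$. Morphisms are called paths, objects vertices; $s$ and $r$ are the domain and codomain maps, so $\lambda\mu$ is defined when $s(\lambda)=r(\mu)$. $\Lambda^n:=\{\lambda:d(\lambda)=n\}$, and objects are identified with $\Lambda^0$. For $v\in\Lambda^0$, $v\Lambda:=\{\lambda\in\Lambda:r(\lambda)=v\}$. For $\lambda,\mu\in\Lambda$, $\Lambda^{\min}(\lambda,\mu):=\{(\alpha,\beta):\lambda\alpha=\mu\beta,\ d(\lambda\alpha)=d(\lambda)\vee d(\mu)\}$. $\Lambda$ is finitely aligned if every $\Lambda^{\min}(\lambda,\mu)$ is finite (possibly empty). A set $E\subset v\Lambda$ is exhaustive if for every $\mu\in v\Lambda$ there is $\lambda\in E$ with $\Lambda^{\min}(\lambda,\mu)\ne\emptyset$. A Cuntz-Krieger $\Lambda$-family is a collection $\{t_\lambda:\lambda\in\Lambda\}$ of partial isometries in a $C^*$-algebra such that (i) $\{t_v:v\in\Lambda^0\}$ are mutually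 orthogonal projections; (ii) $t_\lambda t_\mu=t_{\lambda\mu}$ whenever $s(\lambda)=r(\mu)$; (iii) $t_\lambda^*t_\mu=\sum_{(\alpha,\beta)\in\Lambda^{\min}(\lambda,\mu)}t_\alpha t_\beta^*$ for all $\lambda,\mu\in\Lambda$; (iv) $\prod_{\lambda\in E}(t_v-t_\lambda t_\lambda^* )=0$ for all $v\in\Lambda^0$ and all finite exhaustive $E\subset v\Lambda$. *)

(* Defs.v *)
(* MathComp-Analysis *)
From HB Require Import structures.
From mathcomp Require Import all_boot all_order all_algebra finmap.
From mathcomp Require Import complex.
From mathcomp Require Import all_classical all_reals all_analysis.

Set Implicit Arguments.
Unset Strict Implicit.
Unset Printing Implicit Defensive.

Import Order.TTheory GRing.Theory Num.Theory.
Import numFieldNormedType.Exports.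

Local Open Scope classical_set_scope.
Local Open Scope ring_scope.
Local Open Scope complex_scope.

Reserved Notation "x ** y" (at level 40, left associativity).

(* C*-algebras need not be unital, so the product is not a MathComp ring
   multiplication.  The norm takes its values in R[i], as for every normed
   module over R[i]; they are real since 0 <= z forces 'Im z = 0. *)
HB.mixin Record CompleteNormedModule_isCStarAlgebra (R : realType) A
    of CompleteNormedModule R[i] A := {
  cmul : A -> A -> A;
  star : A -> A;
  cmulA : associative cmul;
  cmulDl : left_distributive cmul +%R;
  cmulDr : right_distributive cmul +%R;
  cmulZl : forall (c : R[i]) (x y : A), cmul (c *: x) y = c *: cmul x y;
  cmulZr : forall (c : R[i]) (x y : A), cmul x (c *: y) = c *: cmul x y;
  starK : involutive star;
  starD : {morph star : x y / x + y};
  starZ : forall (c : R[i]) (x : A), star (c *: x) = c^*%C *: star x;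
  starM : forall x y : A, star (cmul x y) = cmul (star y) (star x);
  norm_cmul : forall x y : A, `|cmul x y| <= `|x| * `|y|;
  norm_cstar : forall x : A, `|cmul (star x) x| = `|x| ^+ 2
}.

#[short(type="cstarAlgType")]
HB.structure Definition CStarAlgebra (R : realType) :=
  { A of CompleteNormedModule R[i] A
       & CompleteNormedModule_isCStarAlgebra R A }.

Notation "x ** y" := (cmul x y) : ring_scope.

Section CStarSubalgebras.
Context {R : realType}.

Record cstar_subalgebra (A : cstarAlgType R) (S : set A) : Prop := {
  cstar_subalgebra0 : S 0;
  cstar_subalgebraD : forall x y, S x -> S y -> S (x + y);
  cstar_subalgebraZ : forall (c : R[i]) x, S x -> S (c *: x);
  cstar_subalgebraM : forall x y, S x -> S y -> S (x ** y);
  cstar_subalgebra_star : forall x, S x -> S (star x);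
  cstar_subalgebra_closed : closed S
}.

Definition cstar_gen (A : cstarAlgType R) (G : set A) : set A :=
  smallest (@cstar_subalgebra A) G.

(* f restricts to a *-isomorphism from S onto T; the values of f outside S
   are irrelevant. *)
Record star_iso (A B : cstarAlgType R) (S : set A) (T : set B) (f : A -> B)
    : Prop := {
  star_iso_bij : set_bij S T f;
  star_isoD : forall x y, S x -> S y -> f (x + y) = f x + f y;
  star_isoZ : forall (c : R[i]) x, S x -> f (c *: x) = c *: f x;
  star_isoM : forall x y, S x -> S y -> f (x ** y) = f x ** f y;
  star_iso_star : forall x, S x -> f (star x) = star (f x)
}.

End CStarSubalgebras.

Section Torus.
Variables (R : realType) (k : nat).

(* The regular module R[i]^o carries the topology of the complex plane. *)
Definition torus : set 'rV[R[i]^o]_k := [set z | forall i, `|z 0 i| = 1].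

Definition torus_one : 'rV[R[i]^o]_k := \row_i 1.

Definition torus_mul (z w : 'rV[R[i]^o]_k) : 'rV[R[i]^o]_k :=
  \row_i (z 0 i * w 0 i).

Definition torus_exp (z : 'rV[R[i]^o]_k) (m : {ffun 'I_k -> nat}) : R[i] :=
  \prod_i z 0 i ^+ m i.

(* theta : T^k -> Aut S is a group homomorphism such that z |-> theta z a is
   continuous for every a in S. *)
Record torus_action (A : cstarAlgType R) (S : set A)
    (theta : 'rV[R[i]^o]_k -> A -> A) : Prop := {
  torus_action_aut : forall z, torus z -> star_iso S S (theta z);
  torus_action1 : forall a, S a -> theta torus_one a = a;
  torus_actionM : forall z w a, torus z -> torus w -> S a ->
    theta (torus_mul z w) a = theta z (theta w a);
  torus_action_continuous : forall a, S a ->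
    {within torus, continuous (fun z => theta z a)}
}.

End Torus.

(* [pcomp l m] stands for the path "l m" and is meaningful only when
   [src l = rng m]. *)
Record kgraph (k : nat) := KGraph {
  vertex : countType;
  kpath :> countType;
  src : kpath -> vertex;
  rng : kpath -> vertex;
  idp : vertex -> kpath;
  pcomp : kpath -> kpath -> kpath;
  deg : kpath -> {ffun 'I_k -> nat};
  src_idp : forall v, src (idp v) = v;
  rng_idp : forall v, rng (idp v) = v;
  src_comp : forall l m, src l = rng m -> src (pcomp l m) = src m;
  rng_comp : forall l m, src l = rng m -> rng (pcomp l m) = rng l;
  pcomp_idl : forall l, pcomp (idp (rng l)) l = l;
  pcomp_idr : forall l, pcomp l (idp (src l)) = l;
  pcompA : forall l m n, src l = rng m -> src m = rng n ->
    pcomp l (pcomp m n) = pcomp (pcomp l m) n;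
  deg_idp : forall v, deg (idp v) = 0;
  deg_comp : forall l m, src l = rng m -> deg (pcomp l m) = deg l + deg m;
  factorisation : forall l (m n : {ffun 'I_k -> nat}), deg l = m + n ->
    exists! p : kpath * kpath,
      [/\ deg p.1 = m, deg p.2 = n, src p.1 = rng p.2 & l = pcomp p.1 p.2]
}.

Section KGraphs.
Context {k : nat}.

Definition deg_join (m n : {ffun 'I_k -> nat}) : {ffun 'I_k -> nat} :=
  [ffun i => maxn (m i) (n i)].

Definition Lmin (L : kgraph k) (l m : L) : set (L * L) :=
  [set p | [/\ src l = rng p.1, src m = rng p.2, pcomp l p.1 = pcomp m p.2
             & deg (pcomp l p.1) = deg_join (deg l) (deg m)]].

Definition finitely_aligned (L : kgraph k) : Prop :=
  forall l m : L, finite_set (Lmin l m).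

Definition exhaustive (L : kgraph k) (v : vertex L) (E : set L) : Prop :=
  E `<=` [set l | rng l = v] /\
  forall m : L, rng m = v -> exists2 l, E l & Lmin l m !=set0.

(* In [ck_prod] the product starts from t_v, the unit of the corner
   t_v A t_v in which all factors lie, so it is the product of the factors
   alone: an exhaustive set is nonempty.  The factors commute by [ck_min], so
   the enumeration order of E does not matter.  The sum in [ck_min] is finite
   as soon as L is finitely aligned. *)
Record ck_family (L : kgraph k) (R : realType) (A : cstarAlgType R)
    (t : L -> A) : Prop := {
  ck_partial_isometry : forall l, t l ** star (t l) ** t l = t l;
  ck_proj_idem : forall v, t (idp v) ** t (idp v) = t (idp v);
  ck_proj_star : forall v, star (t (idp v)) = t (idp v);
  ck_proj_orth : forall v w : vertex L, v != w -> t (idp v) ** t (idp w) = 0;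
  ck_comp : forall l m, src l = rng m -> t l ** t m = t (pcomp l m);
  ck_min : forall l m,
    star (t l) ** t m = \sum_(p \in Lmin l m) (t p.1 ** star (t p.2));
  ck_prod : forall (v : vertex L) (E : {fset L}), exhaustive v [set` E] ->
    \big[cmul/t (idp v)]_(l <- E) (t (idp v) - t l ** star (t l)) = 0
}.

Definition gauge_ck_family (L : kgraph k) (R : realType) (A : cstarAlgType R)
    (t : L -> A) : Prop :=
  [/\ ck_family t,
      forall v, t (idp v) != 0
    & exists2 theta : 'rV[R[i]^o]_k -> A -> A,
        torus_action (cstar_gen (range t)) theta
      & forall z l, torus z -> theta z (t l) = torus_exp z (deg l) *: t l].

End KGraphs.

(* Main.v *)
From Pilot Require Import Defs.
From HB Require Import structures.
From mathcomp Require Import all_boot all_order all_algebra finmap.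
From mathcomp Require Import complex.
From mathcomp Require Import all_classical all_reals all_analysis.
From mathcomp Require Import zify ring lra.
(* Defs.pcomp is shadowed by ssrfun.pcomp above. *)
Import Pilot.Defs.

(* Uniqueness.  A gauge-equivariant family spans its C*-algebra by the elements
   t_l t_m^*, so it is enough to bound the norm of a formal combination E
   evaluated at t by its norm evaluated at t'.  If E is homogeneous of degree 0
   its legs generate a finite set G of paths that is closed under minimal common
   extensions and under exchanging prefixes; cutting E by the projections of the
   paths s in G that are not covered by longer paths of G reads off its
   coefficients, and the uncovered part is nonzero as soon as the extensions of
   s in G are not exhaustive.  This gives |E(t)| <= C |E(t')| with C depending
   only on G; applied to the powers (E^* E)^(2^j), whose legs are still in G, it
   gives |E(t)| <= |E(t')|.  In general the powers of E^* E have only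
   polynomially many homogeneous components, each of them dominated by E(t')
   through averages of the gauge action over 2^r-th roots of unity, and the same
   power trick applies.  Automorphisms are contractive because a selfadjoint
   element of norm < 1 is the real part of a unitary of the unitization.

   Existence.  The family acts on l^2 of pairs (x, d), where x is a directed,
   prefix-closed set of paths that is maximal in the sense that each path outside
   x has no common extension with some path of x, and d is in Z^k; conjugating by
   the diagonal unitaries z^d gives the gauge action. *)

Set Implicit Arguments.
Unset Strict Implicit.
Unset Printing Implicit Defensive.

Import Order.TTheory GRing.Theory Num.Theory.
Import numFieldNormedType.Exports.

Local Open Scope classical_set_scope.
Local Open Scope ring_scope.
Local Open Scope complex_scope.

(** * Real-valued norms *)

(** The comparison of two families rests on a combinatorial witness. If the part of t_s left
    uncovered by the longer paths of G is nonzero in t, relation (iv) says that the continuations of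
    s are not exhaustive, so some path n has no common extension with any of them. The same n serves
    in t', where the nonzero vertex projection at its source makes the coefficients visible. Only a
    crude constant is lost, and the C*-identity removes every factor growing slower than
    exponentially in the power taken. Roots of unity of order 2^r replace Haar measure because a
    finite sum has finitely many degrees, and they need only square roots.

    In the model, maximality gives relation (iv): each path of a finite set lying outside x is
    refuted by a path of x, directedness yields one path refuting them all, and this contradicts
    exhaustiveness. Countability of the graph produces such an x through every vertex, and finite
    alignment preserves maximality when a path is prepended. Degrees range over Z^k because removing
    a path subtracts its degree at every d. *)

Section RealNorm.
Variable R : realType.

(** The norm is real but typed in [R[i]]; its value in [R] is open to linear and nonlinear
    arithmetic. *)
Definition rn (V : normedZmodType R[i]) (x : V) : R := complex.Re `|x|.

Variable V : normedZmodType R[i].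
Implicit Types x y : V.

Lemma rnE x : `|x| = (rn x)%:C.
Proof. by rewrite /rn RRe_real// ger0_real. Qed.

Lemma rn_ge0 x : 0 <= rn x.
Proof. by rewrite -ler0c -rnE. Qed.

Lemma rn0 : rn (0 : V) = 0.
Proof. by rewrite /rn normr0. Qed.

Lemma rn_eq0 x : rn x = 0 -> x = 0.
Proof. by move=> x0; apply/eqP; rewrite -normr_eq0 rnE x0. Qed.

Lemma rnN x : rn (- x) = rn x.
Proof. by rewrite /rn normrN. Qed.

Lemma rnBC x y : rn (x - y) = rn (y - x).
Proof. by rewrite -rnN opprB. Qed.

Lemma rnD x y : rn (x + y) <= rn x + rn y.
Proof. by rewrite -lecR rmorphD/= -!rnE ler_normD. Qed.

Lemma rn_triangle x y z : rn (x - z) <= rn (x - y) + rn (y - z).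
Proof. by have := rnD (x - y) (y - z); rewrite addrA subrK. Qed.

Lemma rn_sum (I : Type) (r : seq I) (P : pred I) (F : I -> V) :
  rn (\sum_(i <- r | P i) F i) <= \sum_(i <- r | P i) rn (F i).
Proof.
elim/big_rec2: _ => [|i y x _ le]; first by rewrite rn0.
by apply: le_trans (rnD _ _) _; rewrite lerD2l.
Qed.

Lemma rn_small x : (forall e : R, 0 < e -> rn x <= e) -> x = 0.
Proof.
move=> small; apply: rn_eq0; apply/eqP; rewrite eq_le rn_ge0 andbT.
by apply/ler_addgt0Pr => e e0; rewrite add0r small.
Qed.

End RealNorm.

Lemma rnZ (R : realType) (V : normedModType R[i]) (c : R[i]) (x : V) :
  rn (c *: x) = rn c * rn x.
Proof. by apply: (@complexI R); rewrite rmorphM/= -!rnE normrZ. Qed.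

Lemma rnMc (R : realType) (c d : R[i]) : rn (c * d) = rn c * rn d.
Proof. by apply: (@complexI R); rewrite rmorphM/= -!rnE normrM. Qed.

Lemma rnXc (R : realType) (c : R[i]) n : rn (c ^+ n) = rn c ^+ n.
Proof. by apply: (@complexI R); rewrite rmorphXn/= -!rnE normrX. Qed.

Lemma rn_real (R : realType) (x : R) : rn x%:C = `|x|.
Proof. by rewrite /rn/= /ComplexField.Normc.normc/= expr0n/= addr0 sqrtr_sqr. Qed.

Lemma rn_conj (R : realType) (c : R[i]) : rn c^*%C = rn c.
Proof. by rewrite /rn normcJ. Qed.

Lemma rn_Re (R : realType) (c : R[i]) : `|complex.Re c| <= rn c.
Proof. by rewrite -lecR -rnE normc_ge_Re. Qed.

Lemma rn_sqr (R : realType) (c : R[i]) : (rn c ^+ 2)%:C = c * c^*%C.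
Proof. by rewrite rmorphXn/= -rnE sqr_normc. Qed.

Lemma rn_i (R : realType) : rn ('i%C : R[i]) = 1.
Proof. by rewrite /rn/= /ComplexField.Normc.normc/= expr0n expr1n add0r sqrtr1. Qed.

Lemma rn_Im (R : realType) (c : R[i]) : `|complex.Im c| <= rn c.
Proof. by have := rn_Re (c * 'i%C); rewrite ReiNIm normrN rnMc rn_i mulr1. Qed.

Lemma sqr_le_double (R : realType) (p q r : R) :
  0 <= p -> p <= q + r -> p ^+ 2 <= 2 * q ^+ 2 + 2 * r ^+ 2.
Proof.
move=> p0 pqr; have := sqr_ge0 (q - r); have := sqr_ge0 (q + r).
by have : p ^+ 2 <= (q + r) ^+ 2; [rewrite ler_sqr ?nnegrE//; lra|nra].
Qed.

Lemma rn_sum_size (R : realType) (V : normedZmodType R[i]) (I : eqType)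
    (r : seq I) (F : I -> V) (c : R) :
  (forall i, i \in r -> rn (F i) <= c) ->
  rn (\sum_(i <- r) F i) <= (size r)%:R * c.
Proof.
elim: r => [|i r IH] hc; first by rewrite big_nil rn0 mul0r.
rewrite big_cons -natr1 mulrDl mul1r addrC; apply: le_trans (rnD _ _) _.
apply: lerD; first by apply: IH => j jr; apply: hc; rewrite inE jr orbT.
by apply: hc; rewrite mem_head.
Qed.

(** * C*-algebras *)

Section Complete.
Variables (R : realType) (V : normedModType R[i]).

Lemma ltc_rn (x : V) (e : R[i]) : 0 < e -> (`|x| < e) = (rn x < complex.Re e).
Proof. by move=> e0; rewrite rnE -[e in LHS]RRe_real ?gtr0_real// ltcR. Qed.

Lemma half_expn_small (e : R) : 0 < e -> exists n, 2^-1 ^+ n < e.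
Proof.
move=> e0; have [n ne] : exists n : nat, e^-1 < n%:R.
  by exists (Num.bound e^-1); apply: archi_boundP; rewrite ltW ?invr_gt0.
exists n; rewrite exprVn -(invrK e) ltf_pV2 ?posrE ?invr_gt0 ?exprn_gt0//.
apply: lt_trans ne _; rewrite -natrX ltr_nat; exact: ltn_expl.
Qed.

Lemma half_expn_gt0 n : 0 < (2^-1 : R) ^+ n.
Proof. by rewrite exprn_gt0// invr_gt0. Qed.

Lemma half_expn_le n m : (n <= m)%N -> (2^-1 : R) ^+ m <= 2^-1 ^+ n.
Proof.
move=> nm; apply: ler_wiXn2l nm; first by rewrite invr_ge0.
by rewrite invf_le1// ler1n.
Qed.

(** A Cauchy filter contains a ball of radius 2^-n for every n. Two such balls meet, so their
    centres differ by at most 2^-n + 2^-m, whence the rate in the hypothesis; a limit of the centres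
    is a limit of the filter. *)
Lemma lim_cauchy_cvg :
  (forall u : nat -> V,
    (forall n m, (n <= m)%N -> rn (u n - u m) <= 2 * 2^-1 ^+ n) ->
    exists x, forall n, rn (u n - x) <= 2 * 2^-1 ^+ n) ->
  forall F : set_system V, ProperFilter F -> cauchy F -> cvg F.
Proof.
move=> Vlim F FF /cauchyP Fc.
have Fex n : exists x, F (ball x (2^-1 ^+ n)%:C).
  by apply: Fc; rewrite ltcR half_expn_gt0.
pose u n := sval (cid (Fex n)).
have uP n : F (ball (u n) (2^-1 ^+ n)%:C) := svalP (cid (Fex n)).
have ub n z : ball (u n) (2^-1 ^+ n)%:C z -> rn (u n - z) < 2^-1 ^+ n.
  by rewrite -ball_normE /ball_/= ltc_rn ?ltcR ?half_expn_gt0.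
have [|x hx] := Vlim u.
  move=> n m nm.
  have [z [/ub zn /ub zm]] : (ball (u n) (2^-1 ^+ n)%:C `&` ball (u m) (2^-1 ^+
    m)%:C) !=set0.
    exact: filter_ex (filterI (uP n) (uP m)).
  have := rn_triangle (u n) z (u m); rewrite (rnBC z).
  by have := half_expn_le nm; lra.
apply/cvg_ex; exists x; apply/cvgrPdist_lt => e e0.
have e1 : 0 < complex.Re e by rewrite -ltcR RRe_real// gtr0_real.
have [n hn] := half_expn_small (e := complex.Re e / 3) ltac:(by rewrite divr_gt0).
apply: filterS (uP n) => z /ub uz; rewrite ltc_rn//.
have := rn_triangle x (u n) z; rewrite (rnBC x (u n)); have := hx n; lra.
Qed.

End Complete.

(** * Exponential against polynomial growth *)

Section Growth.
Variable R : realType.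

Lemma bernoulli (h : R) n : 0 <= h -> 1 + n%:R * h <= (1 + h) ^+ n.
Proof.
move=> h0; elim: n => [|n IH]; first by rewrite mul0r addr0 expr0.
rewrite exprS -natr1; have n0 : 0 <= n%:R :> R by [].
have := ler_wpM2l (_ : 0 <= 1 + h) IH; rewrite addr_ge0// => /(_ isT).
by apply: le_trans; nra.
Qed.

Lemma expn_bound_exists (M : R) : exists i, M < (2 ^ i)%:R.
Proof.
exists (Num.bound `|M|); apply: le_lt_trans (ler_norm M) _.
apply: lt_trans (archi_boundP (normr_ge0 M)) _; by rewrite ltr_nat ltn_expl.
Qed.

(** If x / y = 1 + h with h > 0, the powers (1 + h)^(2^j) outgrow every polynomial in 2^j.
    Bernoulli's inequality raised to the power 2^k, which is at least k + 1, gives growth of degree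
    k + 1 against degree k. *)
Lemma subexponential_le (x y C : R) (k : nat) : 0 <= x -> 0 <= y -> 0 <= C ->
  (forall j, x ^+ (2 ^ j) <= (C * (2 ^ j)%:R) ^+ k * y ^+ (2 ^ j)) -> x <= y.
Proof.
move=> x0 y0 C0 hxy; rewrite leNgt; apply/negP => yx.
have [yE|yN] := eqVneq y 0.
  have := hxy 0%N; rewrite yE expn0 !expr1 mulr0; lra.
have y1 : 0 < y by rewrite lt_def yN.
pose h := x / y - 1.
have h0 : 0 < h by rewrite subr_gt0 ltr_pdivlMr// mul1r.
have xE : x = (1 + h) * y by rewrite /h addrC subrK divfK.
have {}hxy j : (1 + h) ^+ (2 ^ j) <= (C * (2 ^ j)%:R) ^+ k.
  by have := hxy j; rewrite xE exprMn ler_pM2r ?exprn_gt0.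
(* [D] is chosen so that C 2^(i + k) = D n h for n = 2^i. The lower bounds on n make n h larger than
   1 and than [D ^+ k], contradicting (n h)^(k + 1) <= D^k (n h)^k. *)
pose D := C * (2 ^ k)%:R / h.
have [i hi] := expn_bound_exists (Num.max (D ^+ k / h) h^-1).
move: hi; rewrite gt_max => /andP[hi1 hi2].
set n : R := (2 ^ i)%:R in hi1 hi2.
have nh1 : 1 < n * h by rewrite -ltr_pdivrMr// div1r.
have nh0 : 0 <= n * h by exact: ltW (lt_trans ltr01 nh1).
have nh2 : 1 <= 1 + n * h by rewrite lerDl.
have nh3 : n * h <= 1 + n * h by rewrite lerDr.
have DE : D * (n * h) = C * (2 ^ (i + k))%:R.
  rewrite /D /n expnD natrM; move: (2 ^ i)%N (2 ^ k)%N => p q.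
  by field; rewrite lt0r_neq0.
have nhp : (n * h) ^+ k.+1 <= (1 + n * h) ^+ k.+1.
  by apply: lerXn2r; rewrite ?nnegrE// (le_trans _ nh2).
have nhm : (1 + n * h) ^+ k.+1 <= (1 + n * h) ^+ (2 ^ k).
  by apply: ler_weXn2l => //; exact: ltn_expl.
have nhb : (1 + n * h) ^+ (2 ^ k) <= (1 + h) ^+ (2 ^ (i + k)).
  rewrite expnD exprM; apply: lerXn2r; rewrite ?nnegrE ?exprn_ge0//.
  - exact: le_trans nh2.
  - by rewrite addr_ge0 ?ltW.
  - by apply: bernoulli; exact: ltW.
have := le_trans nhp (le_trans nhm (le_trans nhb (hxy _))).
rewrite -DE exprS (exprMn _ D) ler_pM2r; last first.
  by rewrite exprn_gt0// (lt_trans ltr01).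
by apply/negP; rewrite -ltNge -ltr_pdivrMr.
Qed.

End Growth.

Section CStarCalculus.
Variables (R : realType) (A : cstarAlgType R).
Implicit Types x y z : A.

Lemma cmul0l x : 0 ** x = 0.
Proof. by rewrite -(scale0r (0 : A)) cmulZl !scale0r. Qed.
Lemma cmul0r x : x ** 0 = 0.
Proof. by rewrite -(scale0r (0 : A)) cmulZr !scale0r. Qed.
Lemma cmulNl x y : (- x) ** y = - (x ** y).
Proof. by rewrite -scaleN1r cmulZl scaleN1r. Qed.
Lemma cmulNr x y : x ** (- y) = - (x ** y).
Proof. by rewrite -scaleN1r cmulZr scaleN1r. Qed.
Lemma cmulBl x y z : (x - y) ** z = x ** z - y ** z.
Proof. by rewrite cmulDl cmulNl. Qed.
Lemma cmulBr x y z : x ** (y - z) = x ** y - x ** z.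
Proof. by rewrite cmulDr cmulNr. Qed.

Lemma cmul_suml (I : Type) (r : seq I) (P : pred I) (F : I -> A) x :
  (\sum_(i <- r | P i) F i) ** x = \sum_(i <- r | P i) F i ** x.
Proof. exact: (big_morph (fun z => z ** x) (fun a b => cmulDl a b x) (cmul0l x)). Qed.

Lemma cmul_sumr (I : Type) (r : seq I) (P : pred I) (F : I -> A) x :
  x ** (\sum_(i <- r | P i) F i) = \sum_(i <- r | P i) x ** F i.
Proof. exact: (big_morph (cmul x) (cmulDr x) (cmul0r x)). Qed.

Lemma star0 : star (0 : A) = 0.
Proof. by rewrite -(scale0r (0 : A)) starZ conjc0 !scale0r. Qed.
Lemma starN x : star (- x) = - star x.
Proof. by rewrite -scaleN1r starZ rmorphN1 scaleN1r. Qed.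
Lemma starB x y : star (x - y) = star x - star y.
Proof. by rewrite starD starN. Qed.
Lemma star_sum (I : Type) (r : seq I) (P : pred I) (F : I -> A) :
  star (\sum_(i <- r | P i) F i) = \sum_(i <- r | P i) star (F i).
Proof. exact: (big_morph star (@starD _ A) star0). Qed.

Lemma rnM x y : rn (x ** y) <= rn x * rn y.
Proof. by rewrite -lecR rmorphM/= -!rnE norm_cmul. Qed.

Lemma rn_cstar x : rn (star x ** x) = rn x ^+ 2.
Proof. by apply: (@complexI R); rewrite rmorphXn/= -!rnE norm_cstar. Qed.

Lemma rn_star_le x : rn x <= rn (star x).
Proof.
have [x0|x0] := eqVneq (rn x) 0; first by rewrite x0 rn_ge0.
have x1 : 0 < rn x by rewrite lt_def x0 rn_ge0.
by rewrite -(ler_pM2r x1) -expr2 -rn_cstar rnM.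
Qed.

Lemma rn_star x : rn (star x) = rn x.
Proof. by apply/eqP; rewrite eq_le rn_star_le -{2}(starK x) rn_star_le. Qed.

Lemma rn_sqr_selfadj x : star x = x -> rn (x ** x) = rn x ^+ 2.
Proof. by move=> xx; rewrite -rn_cstar xx. Qed.

Lemma rn_proj_le1 x : star x = x -> x ** x = x -> rn x <= 1.
Proof.
by move=> /rn_sqr_selfadj + xx; rewrite xx => e; have := rn_ge0 x; nra.
Qed.

Lemma rn_proj_eq1 x : star x = x -> x ** x = x -> x != 0 -> rn x = 1.
Proof.
move=> /rn_sqr_selfadj + xx x0; rewrite xx expr2 => e.
have x1 : rn x != 0 by apply: contra_neq x0; exact: rn_eq0.
by apply: (mulfI x1); rewrite mulr1.
Qed.

End CStarCalculus.

Section NormTopology.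
Variable R : realType.

Lemma closed_rn (V : normedModType R[i]) (S : set V) (a : V) : closed S ->
  (forall e : R, 0 < e -> exists2 x, S x & rn (a - x) <= e) -> S a.
Proof.
move=> cS hS; apply: cS => B /nbhs_ballP[e /= e0 eB].
have e1 : 0 < complex.Re e by rewrite -ltcR RRe_real// gtr0_real.
have [x Sx ax] := hS (complex.Re e / 2) ltac:(by rewrite divr_gt0).
exists x; split=> //; apply: eB; rewrite -ball_normE /ball_/= ltc_rn//; lra.
Qed.

Lemma rn_closed (V : normedModType R[i]) (S : set V) :
  (forall a, (forall e : R, 0 < e -> exists2 x, S x & rn (a - x) <= e) -> S a) ->
  closed S.
Proof.
move=> hS a aS; apply: hS => e e0.
have [x [Sx]] := aS _ (nbhsx_ballx a e%:C ltac:(by rewrite ltcR)).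
rewrite -ball_normE /ball_/= ltc_rn ?ltcR// => /ltW ax.
by exists x.
Qed.

Lemma complete_rn (V : completeNormedModType R[i]) (u : nat -> V) (eps : nat -> R) :
  (forall e, 0 < e -> exists n, eps n <= e) ->
  (forall n m, (n <= m)%N -> rn (u n - u m) <= eps n) ->
  exists x, forall n, rn (u n - x) <= eps n.
Proof.
move=> eps0 uC.
have : cauchy (u @ \oo).
  apply/cauchyP => e e0.
  have e1 : 0 < complex.Re e by rewrite -ltcR RRe_real// gtr0_real.
  have [n hn] := eps0 (complex.Re e / 2) ltac:(by rewrite divr_gt0).
  exists (u n); exists n => // m /= nm; rewrite -ball_normE /ball_/= ltc_rn//.
  by have := uC _ _ nm; lra.
move=> /cauchy_cvg/cvg_ex[x ux]; exists x => n.
apply/ler_addgt0Pr => e e0.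
have /cvgrPdist_lt/(_ e%:C) := ux; rewrite ltcR => /(_ e0)[N _ hN].
have := hN (maxn n N) (leq_maxr _ _); rewrite /= ltc_rn ?ltcR// rnBC => /ltW h1.
have h2 := uC n (maxn n N) (leq_maxl _ _).
apply: le_trans (rn_triangle _ (u (maxn n N)) _) _; exact: lerD.
Qed.

End NormTopology.

(** * Contractivity of star-isomorphisms *)

Section Contractivity.
Variable R : realType.

Lemma pow_small (r e : R) : 0 <= r -> r < 1 -> 0 < e -> exists n, r ^+ n <= e.
Proof.
move=> r0 r1 e0.
have /cvgrPdist_lt/(_ e e0)[N _ hN] : (GRing.exp r : nat -> R) @ \oo --> (0 : R).
  by apply: cvg_expr; rewrite ger0_norm.
exists N; have := hN N (leqnn N); rewrite /= sub0r normrN => /ltW.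
exact: le_trans (ler_norm _).
Qed.

Variable A : cstarAlgType R.
Implicit Types h k x y : A.

(* k is 'sqrt(1 - h^2) - 1' in the unitization, so that 1 + k + 'i h is
   unitary. *)
Lemma unitary_completion (S : set A) h : cstar_subalgebra S -> S h ->
  star h = h -> rn h < 1 ->
  exists k, [/\ S k, star k = k, k ** h = h ** k & k + k + k ** k + h ** h = 0].
Proof.
move=> SS Sh hs h1; set r := rn h in h1.
have r0 : 0 <= r := rn_ge0 _.
(* The equation (1 + k)^2 = 1 - h^2 reads k = [K] k. [K] maps the ball of radius r = |h| < 1 into
   itself and contracts it by the factor r. The iterates of 0 are selfadjoint elements of [S]
   commuting with h, and so is their limit. *)
pose c : R[i] := (- 2^-1 : R)%:C; pose K x := c *: (h ** h + x ** x).
have rhalf : rn c = 2^-1 by rewrite rn_real normrN ger0_norm// invr_ge0.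
have KS x : S x -> S (K x).
  by move=> Sx; apply: cstar_subalgebraZ => //; apply: cstar_subalgebraD => //;
     apply: cstar_subalgebraM.
have Kstar x : star x = x -> star (K x) = K x.
  by move=> xs; rewrite starZ starD !starM hs xs conjc_real.
have Kcomm x : x ** h = h ** x -> K x ** h = h ** K x.
  move=> xh; rewrite cmulZl cmulZr cmulDl cmulDr; congr (_ *: (_ + _)).
    by rewrite cmulA.
  by rewrite -cmulA xh !cmulA xh.
have Kbound x : rn x <= r -> rn (K x) <= r.
  move=> xr; rewrite rnZ rhalf; have x0 := rn_ge0 x.
  have := rnD (h ** h) (x ** x); have := rnM h h; have := rnM x x.
  by rewrite -/r; nra.
have Klip x y : rn x <= r -> rn y <= r -> rn (K x - K y) <= r * rn (x - y).
  move=> xr yr; have -> : K x - K y = c *: (x ** (x - y) + (x - y) ** y).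
    by rewrite -scalerBr cmulBr cmulBl addrA subrK opprD addrACA subrr add0r.
  rewrite rnZ rhalf; have := rnD (x ** (x - y)) ((x - y) ** y).
  have := rnM x (x - y); have := rnM (x - y) y; have := rn_ge0 (x - y).
  have := rn_ge0 x; have := rn_ge0 y; nra.
pose u n := iter n K 0.
have ubnd n : rn (u n) <= r by elim: n => [|n IH]; [rewrite rn0|exact: Kbound].
have ulip n j : rn (u n - u (n + j)%N) <= r ^+ n * r.
  elim: n => [|n IH]; first by rewrite expr0 mul1r sub0r rnN.
  apply: le_trans (Klip _ _ (ubnd n) (ubnd _)) _.
  by rewrite exprS -mulrA ler_wpM2l.
have eps0 (e : R) : 0 < e -> exists n, r ^+ n * r <= e.
  move=> e0; have [n hn] := pow_small r0 h1 e0; exists n.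
  by apply: le_trans hn; rewrite ler_piMr ?exprn_ge0// ltW.
have [|k hk] := complete_rn (u := u) eps0.
  by move=> n m nm; rewrite -(subnKC nm).
have kr : rn k <= r by have := hk 0%N; rewrite sub0r rnN expr0 mul1r.
have lim0 x (d : R) : 0 <= d -> (forall n, rn x <= d * (r ^+ n * r)) -> x = 0.
  move=> d0 xk; apply: rn_small => e e0.
  have [n hn] := eps0 (e / (d + 1)) ltac:(by rewrite divr_gt0//; lra).
  apply: le_trans (xk n) _; apply: le_trans (ler_wpM2l d0 hn) _.
  by rewrite mulrA ler_pdivrMr; nra.
have uS n : S (u n).
  by elim: n => [|n IH]; [exact: cstar_subalgebra0|exact: KS].
have us n : star (u n) = u n.
  by elim: n => [|n IH]; [exact: star0|exact: Kstar].
have uh n : u n ** h = h ** u n.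
  by elim: n => [|n IH]; [rewrite /= cmul0l cmul0r|exact: Kcomm].
have Kk : K k = k.
  apply/eqP; rewrite -subr_eq0; apply/eqP; apply: (lim0 _ (r + r)) => [|n].
    exact: addr_ge0.
  apply: le_trans (rn_triangle _ (K (u n)) _) _.
  rewrite mulrDl; apply: lerD.
    by apply: le_trans (Klip _ _ kr (ubnd n)) _; rewrite rnBC ler_wpM2l.
  by apply: le_trans (hk n.+1) _; rewrite exprS mulrA.
exists k; split.
- apply: (closed_rn (cstar_subalgebra_closed SS)) => e e0.
  have [n hn] := eps0 e e0; exists (u n) => //.
  by rewrite rnBC; exact: le_trans hn.
- apply/eqP; rewrite -subr_eq0; apply/eqP; apply: (lim0 _ 2) => // n.
  apply: le_trans (rn_triangle _ (u n) _) _.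
  by rewrite -{1}us -starB rn_star (rnBC k); have := hk n; lra.
- apply/eqP; rewrite -subr_eq0; apply/eqP; apply: (lim0 _ 2) => // n.
  have -> : k ** h - h ** k = (k - u n) ** h - h ** (k - u n).
    by rewrite cmulBl cmulBr uh opprB addrA subrK.
  apply: le_trans (rnD _ _) _; rewrite rnN.
  have := rnM (k - u n) h; have := rnM h (k - u n); rewrite rnBC -/r.
  have := hk n; have := rn_ge0 (u n - k); nra.
- rewrite -addrA (addrC (k ** k)).
  have -> : h ** h + k ** k = - (k + k); last by rewrite subrr.
  rewrite -{3 4}Kk /K -scalerDl -scaleNr -rmorphD -rmorphN/=.
  by rewrite -[LHS]scale1r; congr (_%:C *: _); field.
Qed.

(** The hypotheses say that 1 + x is unitary in the unitization, so left multiplication by it and by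
    its adjoint preserves norms. With D = x - x^* and z = D^*, the element D z is the difference of
    the two images of z, hence |D D^*| <= 2 |D|, and the C*-identity finishes. *)
Lemma unitary_diff_le2 x : x + star x + star x ** x = 0 ->
  x + star x + x ** star x = 0 -> rn (x - star x) <= 2.
Proof.
move=> x1 x2.
have isom y z : y + star y + star y ** y = 0 -> rn (z + y ** z) = rn z.
  move=> y0; apply/eqP; rewrite -(eqrXn2 (n := 2))// ?rn_ge0//; apply/eqP.
  rewrite -!rn_cstar; congr rn.
  transitivity (star z ** (z + (y + star y + star y ** y) ** z)).
    by rewrite starD starM !(cmulDl, cmulDr) !cmulA !addrA.
  by rewrite y0 cmul0l addr0.
set D := x - star x; pose z := star D.
have le1 : rn (D ** z) <= 2 * rn z.
  have -> : D ** z = (z + x ** z) - (z + star x ** z).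
    by rewrite opprD addrACA subrr add0r cmulBl.
  apply: le_trans (rnD _ _) _; rewrite rnN !isom//; first lra.
  by rewrite starK addrC (addrC (star x)) addrC.
have := rn_cstar z; rewrite /z starK rn_star => e.
by move: le1; rewrite /z e rn_star; have := rn_ge0 D; nra.
Qed.

End Contractivity.

Section StarIsoContractive.
Variables (R : realType) (A B : cstarAlgType R) (S : set A) (T : set B).
Variable f : A -> B.
Hypotheses (SS : cstar_subalgebra S) (fST : star_iso S T f).

Let SD := cstar_subalgebraD SS.
Let SZ := cstar_subalgebraZ SS.
Let SM := cstar_subalgebraM SS.

(** For w = k + 'i h the element 1 + w is unitary, a condition written with sums, products and
    adjoints of elements of [S] alone. It therefore passes to f w, and w - w^* = 2 'i h bounds f
    h. *)
Lemma star_iso_selfadj_contractive h : S h -> star h = h -> rn h < 1 ->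
  rn (f h) <= 1.
Proof.
move=> Sh hs h1; have [k [Sk ks kh kE]] := unitary_completion SS Sh hs h1.
pose w := k + 'i%C *: h.
have Sw : S w by apply: SD => //; exact: SZ.
have i2 : 'i%C * 'i%C = -1 :> R[i] by rewrite -expr2 sqr_i.
have ws : star w = k - 'i%C *: h.
  by rewrite /w starD starZ ks hs -scaleNr; congr (_ + _ *: _);
     apply/eqP; rewrite eq_complex/= oppr0 !eqxx.
have Sws : S (star w) by exact: cstar_subalgebra_star.
have sumE : w + star w = k + k by rewrite ws /w addrACA subrr addr0.
have w1 : w + star w + star w ** w = 0.
  rewrite sumE -[RHS]kE -[RHS]addrA; congr (_ + _).
  rewrite ws /w cmulBl !cmulDr !cmulZl !cmulZr kh scalerA i2 scaleN1r.
  by rewrite opprD opprK addrA addrK.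
have w2 : w + star w + w ** star w = 0.
  rewrite sumE -[RHS]kE -[RHS]addrA; congr (_ + _).
  rewrite ws /w cmulBr !cmulDl !cmulZl !cmulZr kh scalerA i2 scaleN1r.
  by rewrite opprD opprK addrA addrK.
have f0 : f 0 = 0.
  by rewrite -(scale0r (0 : A)) (star_isoZ fST) ?scale0r//; exact: cstar_subalgebra0.
have fs : star (f w) = f (star w) by rewrite (star_iso_star fST).
have := @unitary_diff_le2 _ _ (f w); rewrite fs.
rewrite -!(star_isoM fST)// -!(star_isoD fST)//;
  [|exact: SD|exact: SM|exact: SD|exact: SM].
rewrite w1 w2 f0 => /(_ erefl erefl).
rewrite -scaleN1r -(star_isoZ fST)// -(star_isoD fST)//; last exact: SZ.
have -> : w + (-1) *: star w = (2 * 'i)%C *: h.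
  by rewrite ws /w scaleN1r opprD opprK addrACA subrr add0r -scalerDl -mulr2n mulr_natl.
rewrite (star_isoZ fST)// rnZ rnMc rn_i mulr1.
have -> : rn (2 : R[i]) = 2 by rewrite -[2 in LHS](rmorph_nat (real_complex R))
  rn_real ger0_norm.
lra.
Qed.

Lemma star_iso_contractive x : S x -> rn (f x) <= rn x.
Proof.
move=> Sx.
suff sa h : S h -> star h = h -> rn (f h) <= rn h.
  rewrite -ler_sqr ?nnegrE ?rn_ge0// -!rn_cstar -(star_iso_star fST)//.
  have Sxs : S (star x) by exact: cstar_subalgebra_star.
  by rewrite -(star_isoM fST)//; apply: sa; [exact: SM|rewrite starM starK].
move=> Sh hs; apply/ler_addgt0Pr => e e0.
have c0 : 0 < rn h + e by have := rn_ge0 h; lra.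
have rc : rn ((rn h + e)^-1%:C : R[i]) = (rn h + e)^-1.
  by rewrite rn_real ger0_norm// invr_ge0 ltW.
have := star_iso_selfadj_contractive (h := (rn h + e)^-1%:C *: h) (SZ _ Sh).
rewrite starZ hs conjc_real (star_isoZ fST)// !rnZ rc => /(_ erefl).
by rewrite mulrC ltr_pdivrMr// mul1r ler_pdivrMl// mulr1; apply; lra.
Qed.

End StarIsoContractive.

(** * Paths *)

Section KGraphTheory.
Variables (k : nat) (L : kgraph k).
Implicit Types (l m n a b d s : L).

Lemma degM l m i : src l = rng m -> deg (pcomp l m) i = (deg l i + deg m i)%N.
Proof. by move=> lm; rewrite deg_comp// ffunE. Qed.

Definition len l := (\sum_i deg l i)%N.

Lemma lenM l m : src l = rng m -> len (pcomp l m) = (len l + len m)%N.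
Proof. by move=> lm; rewrite /len -big_split/=; apply: eq_bigr => i _; exact: degM. Qed.

Lemma len_ext l m : deg l = deg m -> len l = len m.
Proof. by rewrite /len => ->. Qed.

Lemma len_eq0 l : len l = 0%N -> deg l = 0.
Proof.
move=> /eqP; rewrite sum_nat_eq0 => /forallP h; apply/ffunP => i.
by rewrite ffunE; apply/eqP; exact: h.
Qed.

Lemma pcomp_inj l m a b : src l = rng a -> src m = rng b ->
  deg l = deg m -> pcomp l a = pcomp m b -> l = m /\ a = b.
Proof.
move=> la mb lm e.
have dab : deg a = deg b.
  apply/ffunP => i; have := congr1 (fun x => deg x i) e.
  by rewrite !degM// lm => /addnI.
have [p [_ pu]] := factorisation (deg_comp la).
have e1 : p = (l, a) by apply: pu.
have e2 : p = (m, b) by apply: pu; rewrite /= -lm -dab.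
by move: e2; rewrite e1 => -[-> ->].
Qed.

Lemma pcompI l a b : src l = rng a -> src l = rng b ->
  pcomp l a = pcomp l b -> a = b.
Proof. by move=> la lb /pcomp_inj[]. Qed.

Lemma pcomp_factor l (m : {ffun 'I_k -> nat}) : (forall i, m i <= deg l i)%N ->
  exists a b, [/\ deg a = m, src a = rng b & l = pcomp a b].
Proof.
move=> ml; pose n := [ffun i => (deg l i - m i)%N].
have lmn : deg l = m + n by apply/ffunP => i; rewrite !ffunE;
  rewrite -[RHS]/(_ + _)%N subnKC.
have [[a b] [[/= am _ ab lE] _]] := factorisation lmn.
by exists a, b.
Qed.

Lemma deg0_idp a : deg a = 0 -> a = idp (rng a).
Proof.
move=> a0.
by have [] := @pcomp_inj (idp (rng a)) a a (idp (src a));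
  rewrite ?src_idp ?rng_idp ?deg_idp ?pcomp_idl ?pcomp_idr.
Qed.

Lemma pcomp_deg0 l a : src l = rng a -> deg a = 0 -> pcomp l a = l.
Proof. by move=> la /deg0_idp ->; rewrite -la pcomp_idr. Qed.

Lemma deg_pcomp_le l a i : src l = rng a -> (deg l i <= deg (pcomp l a) i)%N.
Proof. by move=> la; rewrite degM// leq_addr. Qed.

(** Cutting m at the degree of l gives two factorisations of the common path, and uniqueness
    identifies the initial segment with l. *)
Lemma factor_prefix l m a b : src l = rng a -> src m = rng b ->
  pcomp l a = pcomp m b -> (forall i, deg l i <= deg m i)%N ->
  exists d, [/\ src l = rng d, m = pcomp l d, src d = rng b & a = pcomp d b].
Proof.
move=> la mb e lm.
have [l' [d [l'd l'dr mE]]] := pcomp_factor lm.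
have db : src d = rng b by rewrite -mb mE src_comp.
have [] := @pcomp_inj l l' a (pcomp d b); rewrite ?rng_comp//.
  by rewrite e mE pcompA.
move=> ll' aE; exists d; rewrite ll'; split=> //.
Qed.

(** The join of the two degrees lies below the degree of the common extension, so cutting the latter
    at the join yields the minimal one. *)
Lemma Lmin_factor l m a b : src l = rng a -> src m = rng b ->
  pcomp l a = pcomp m b -> exists a' b' d,
  [/\ Lmin l m (a', b'), src a' = rng d, src b' = rng d,
      a = pcomp a' d & b = pcomp b' d].
Proof.
move=> la mb e; pose j := deg_join (deg l) (deg m).
have jle i : (j i <= deg (pcomp l a) i)%N.
  by rewrite ffunE geq_max deg_pcomp_le// e deg_pcomp_le.
have [w [d [wj wd wE]]] := pcomp_factor jle.
have [|a' [la' wa' a'd aE]] := factor_prefix la wd wE.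
  by move=> i; rewrite wj ffunE leq_maxl.
have [|b' [mb' wb' b'd bE]] := factor_prefix mb wd (etrans (esym e) wE).
  by move=> i; rewrite wj ffunE leq_maxr.
exists a', b', d; split=> //; split=> //=; first by rewrite -wa' -wb'.
by rewrite -wa'.
Qed.

Lemma Lmin_deg l m a b i : Lmin l m (a, b) ->
  (deg l i + deg a i = maxn (deg l i) (deg m i))%N.
Proof. by move=> [/= la mb e]; rewrite deg_comp// => /ffunP/(_ i); rewrite !ffunE. Qed.

Lemma Lmin_fun l m a b b' : Lmin l m (a, b) -> Lmin l m (a, b') -> b = b'.
Proof.
by move=> [/= _ mb e _] [/= _ mb' e' _]; apply: (@pcompI m); rewrite // -e -e'.
Qed.

Definition prefix_of m s := exists a, src m = rng a /\ s = pcomp m a.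

Definition mce_closed (G : set L) := forall l m a b,
  G l -> G m -> Lmin l m (a, b) -> G (pcomp l a).

(** With [mce_closed], this keeps products of degree-zero terms inside G: if m a = l' b is a minimal
    common extension, t_l t_m^* times t_l' t_m'^* contributes the legs l a and m' b, which arise
    from it by exchanging m for l and l' for m'. *)
Definition swap_closed (G : set L) := forall l m a, G l -> G m ->
  deg l = deg m -> src l = src m -> src m = rng a ->
  G (pcomp m a) -> G (pcomp l a).

Inductive path_closure (E : set L) : L -> Prop :=
| path_closure_base l : E l -> path_closure E l
| path_closure_mce l m a b : path_closure E l -> path_closure E m ->
    Lmin l m (a, b) -> path_closure E (pcomp l a)
| path_closure_swap l m a : path_closure E l -> path_closure E m ->
    deg l = deg m -> src l = src m -> src m = rng a ->
    path_closure E (pcomp m a) -> path_closure E (pcomp l a).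

(** * Finiteness of the closure of a finite set of paths *)

Section Finiteness.
Variable E : set L.
Let G := path_closure E.
(** Induction on the total degree: a path of the closure of total degree at most N has smaller total
    degree, or is a generator or a minimal common extension of such shorter paths ([HN]), or arises
    from a path in [HN] by one exchange of short prefixes ([WN]). *)
Let GN N := [set s | G s /\ (len s < N)%N].
Let HN N := E `|` [set s | exists l m a b,
  [/\ GN N l, GN N m, Lmin l m (a, b) & s = pcomp l a]].
Let WN N := [set s | exists l m a, [/\ GN N l, GN N m &
  [/\ deg l = deg m, src l = src m, src m = rng a, HN N (pcomp m a) & s = pcomp l a]]].

(* Iterated exchanges of short prefixes collapse to a single one: the prefix
   exchanged first and the one exchanged last have a minimal common extension
   in G. *)
Let step N s : GN N.+1 s -> GN N s \/ HN N s \/ WN N s.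
Proof.
move=> [Gs]; elim: Gs => {s}
    [s Es _|l m a b Gl IHl Gm IHm ab lN|l m a Gl IHl Gm IHm lm slm ma Gma IHma lN].
- by right; left; left.
- have [la mb e _] := ab; rewrite /= in la mb e.
  have [a0|a0] := eqVneq (len a) 0%N.
    rewrite pcomp_deg0 ?(len_eq0 a0)//; apply: IHl.
    by move: lN; rewrite lenM//; lia.
  have [b0|b0] := eqVneq (len b) 0%N.
    rewrite e pcomp_deg0 ?(len_eq0 b0)//; apply: IHm.
    by move: lN; rewrite e lenM//; lia.
  right; left; right; exists l, m, a, b; split=> //; split=> //.
    by move: lN; rewrite lenM//; lia.
  by move: lN; rewrite e lenM//; lia.
have la : src l = rng a by rewrite slm.
have Gla : G (pcomp l a) by apply: path_closure_swap Gma.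
have [a0|a0] := eqVneq (len a) 0%N.
  rewrite pcomp_deg0 ?(len_eq0 a0)//; apply: IHl.
  by move: lN; rewrite lenM//; lia.
have lN' : (len l < N)%N by move: lN; rewrite lenM//; lia.
have mN' : (len m < N)%N by rewrite -(len_ext lm).
have lenE : len (pcomp m a) = len (pcomp l a) by rewrite !lenM// (len_ext lm).
have [|[_ maN]|[Hma|]] := IHma; first by rewrite lenE.
- by left; split=> //; rewrite -lenE.
- by right; right; exists l, m, a.
move=> [l' [m' [a' [[Gl' l'N] [Gm' m'N] [lm' slm' ma' Hma' e]]]]].
have l'a' : src l' = rng a' by rewrite slm'.
have [c [c' [d [cc' cd c'd aE a'E]]]] := Lmin_factor ma l'a' e.
have [mc l'c' ce _] := cc'; rewrite /= in mc l'c' ce.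
have m'c' : src m' = rng c' by rewrite -slm'.
have lc : src l = rng c by rewrite slm.
have Gmc : G (pcomp m c) by apply: path_closure_mce cc'.
have [d0|d0] := eqVneq (len d) 0%N.
  right; right; exists l, m, a; split=> //; split=> //.
  right; exists m, l', c, c'; split=> //.
  by rewrite aE (pcomp_deg0 cd (len_eq0 d0)).
have Glc : G (pcomp l c) by apply: path_closure_swap Gmc.
have Gm'c' : G (pcomp m' c').
  by apply: (path_closure_swap Gm' Gl') => //; rewrite -ce.
have dE : deg (pcomp l c) = deg (pcomp m' c').
  by rewrite !deg_comp// lm -deg_comp// ce deg_comp// lm'.
have lcN : (len (pcomp l c) < N)%N.
  by move: lN; rewrite aE !lenM ?rng_comp//; lia.
have s1 : src (pcomp l c) = rng d by rewrite src_comp.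
have s2 : src (pcomp m' c') = rng d by rewrite src_comp.
right; right; exists (pcomp l c), (pcomp m' c'), d; split.
- by split.
- by split=> //; rewrite -(len_ext dE).
- split=> //; first by rewrite s1 s2.
    by rewrite -pcompA// -a'E.
  by rewrite aE pcompA.
Qed.

(** A minimal common extension has the join of the two degrees and an exchange preserves the degree,
    so coordinatewise bounds never grow. The total degree is thus bounded, and a single [GN N]
    contains the closure. *)
Lemma path_closure_deg (M : 'I_k -> nat) : (forall s, E s -> forall i, deg s i
  <= M i)%N ->
  forall s, G s -> forall i, (deg s i <= M i)%N.
Proof.
move=> EM s; elim=> {s} [s /EM //|l m a b _ IHl _ IHm ab i|l m a _ IHl _ IHm lm
  slm ma _ IH i].
  by have [la _ _ _] := ab; rewrite degM// (Lmin_deg _ ab) geq_max IHl IHm.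
by have := IH i; rewrite !degM ?slm// lm.
Qed.

Hypothesis (falign : finitely_aligned L) (Efin : finite_set E).

Let finite_HN N : finite_set (GN N) -> finite_set (HN N).
Proof.
move=> fG; rewrite finite_setU; split=> //.
apply: (@sub_finite_set _ _ (\bigcup_(lm in GN N `*` GN N)
    [set pcomp lm.1 ab.1 | ab in Lmin lm.1 lm.2])).
  move=> s [l [m [a [b [Gl Gm ab ->]]]]].
  by exists (l, m) => //; exists (a, b).
apply: bigcup_finite; first exact: finite_setX.
by move=> lm _; apply: finite_image; exact: falign.
Qed.

Let finite_WN N : finite_set (GN N) -> finite_set (WN N).
Proof.
move=> fG; have fH := finite_HN fG.
(* Cancelling [lm.2] from h determines a, so each [T lm h] has at most one element. *)
pose T lm h : set L := [set s | exists a, [/\ src lm.2 = rng a,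
  h = pcomp lm.2 a & s = pcomp lm.1 a]].
apply: (@sub_finite_set _ _ (\bigcup_(lm in GN N `*` GN N)
    \bigcup_(h in HN N) T lm h)).
  move=> s [l [m [a [Gl Gm [_ _ ma Hma ->]]]]].
  by exists (l, m) => //; exists (pcomp m a) => //; exists a.
apply: bigcup_finite; first exact: finite_setX.
move=> lm _; apply: bigcup_finite => // h _.
have [[s Ts]|T0] := pselect (T lm h !=set0); last first.
  by apply: (sub_finite_set _ (finite_set0 _)) => s Ts; apply: T0; exists s.
apply: (@sub_finite_set _ _ [set s]) => [s'|]; last exact: finite_set1.
move: Ts => [a [ma hE ->]] [a' [ma' hE' ->]] /=.
by have := pcompI ma ma' (etrans (esym hE) hE') => ->.
Qed.

Let finite_GN N : finite_set (GN N).
Proof.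
elim: N => [|N fG].
  by apply: (sub_finite_set _ (finite_set0 _)) => s [].
apply: (@sub_finite_set _ _ (GN N `|` (HN N `|` WN N))).
  by move=> s /step.
rewrite finite_setU; split=> //; rewrite finite_setU.
by split; [exact: finite_HN|exact: finite_WN].
Qed.

Lemma path_closure_finite : finite_set G.
Proof.
have [M EM] : exists M : {ffun 'I_k -> nat}, forall s, E s -> forall i, (deg s
  i <= M i)%N.
  exists [ffun i => \max_(s <- fset_set E) deg s i] => s Es i; rewrite ffunE.
  by apply: leq_bigmax_seq => //; rewrite in_fset_set// inE.
apply: sub_finite_set (finite_GN (\sum_i M i).+1) => s Gs; split=> //.
by rewrite ltnS; apply: leq_sum => i _; exact: path_closure_deg EM _ Gs i.
Qed.

End Finiteness.

Lemma finite_closure (E : set L) : finitely_aligned L -> finite_set E ->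
  exists G : {fset L}, [/\ E `<=` [set` G], mce_closed [set` G] &
    swap_closed [set` G]].
Proof.
move=> fa fE; have fG := path_closure_finite fa fE.
exists (fset_set (path_closure E)); rewrite fset_setK//; split.
- by move=> l; exact: path_closure_base.
- by move=> l m a b; exact: path_closure_mce.
- by move=> l m a; exact: path_closure_swap.
Qed.
End KGraphTheory.

(** * Cuntz-Krieger families and the core *)

Section CKCalculus.
Variables (k : nat) (L : kgraph k) (R : realType) (A : cstarAlgType R).
Variable t : L -> A.
Hypotheses (fa : finitely_aligned L) (ck : ck_family t).
Implicit Types l m n a b s : L.

Local Notation p l := (t l ** star (t l)).
Local Notation lmins l m := (fset_set (Lmin l m)).

Lemma ck_rng l : t (idp (rng l)) ** t l = t l.
Proof. by rewrite (ck_comp ck) ?src_idp// pcomp_idl. Qed.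

Lemma ck_src l : t l ** t (idp (src l)) = t l.
Proof. by rewrite (ck_comp ck) ?rng_idp// pcomp_idr. Qed.

Lemma ck_rng_star l : star (t l) ** t (idp (rng l)) = star (t l).
Proof. by rewrite -{1}(ck_proj_star ck) -starM ck_rng. Qed.

Lemma ck_src_star l : t (idp (src l)) ** star (t l) = star (t l).
Proof. by rewrite -{1}(ck_proj_star ck) -starM ck_src. Qed.

Lemma ck_comp_star l m : src l = rng m ->
  star (t m) ** star (t l) = star (t (pcomp l m)).
Proof. by move=> lm; rewrite -starM (ck_comp ck). Qed.

Lemma ck_lmins l m :
  star (t l) ** t m = \sum_(q <- lmins l m) t q.1 ** star (t q.2).
Proof. by rewrite (ck_min ck) fsbig_finite. Qed.

Lemma ck_Lmin0 l m : Lmin l m = set0 -> star (t l) ** t m = 0.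
Proof. by move=> lm0; rewrite ck_lmins lm0 fset_set0 big_seq_fset0. Qed.

(** A minimal common extension of l with itself adds degree 0, so relation (iii) collapses to one
    term. *)
Lemma ck_isom l : star (t l) ** t l = t (idp (src l)).
Proof.
have lmE : Lmin l l = [set (idp (src l), idp (src l))].
  apply/seteqP; split=> [[a b] ab|_ ->].
    have [/= la lb e _] := ab.
    have a0 : deg a = 0.
      by apply/ffunP => i; rewrite ffunE; have := Lmin_deg i ab;
        rewrite maxnn -[RHS]addn0 => /addnI.
    have := pcompI la lb e => eab; rewrite -eab (deg0_idp a0) -la.
    by [].
  split; rewrite /= ?rng_idp// pcomp_idr.
  by apply/ffunP => i; rewrite ffunE maxnn.
rewrite ck_lmins lmE fset_set1 big_seq_fset1/=.
by rewrite (ck_proj_star ck) (ck_proj_idem ck).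
Qed.

Lemma ck_orth l m : deg l = deg m -> l != m -> star (t l) ** t m = 0.
Proof.
move=> lm neq; apply: ck_Lmin0; apply/seteqP; split=> // -[a b] ab.
have [/= la mb e _] := ab.
have [lE _] := pcomp_inj la mb lm e.
by rewrite lE eqxx in neq.
Qed.

Lemma ck_cancel l a : src l = rng a -> star (t l) ** t (pcomp l a) = t a.
Proof. by move=> la; rewrite -(ck_comp ck)// cmulA ck_isom la ck_rng. Qed.

Lemma rn_vertex_le1 v : rn (t (idp v)) <= 1.
Proof. exact: rn_proj_le1 (ck_proj_star ck v) (ck_proj_idem ck v). Qed.

Lemma rn_ck_le1 l : rn (t l) <= 1.
Proof.
rewrite -(@expr_le1 _ 2)// ?rn_ge0// -rn_cstar ck_isom.
exact: rn_vertex_le1.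
Qed.

(** By relation (iii) the product is the sum of t_(l a) t_(m b)^* over minimal common extensions.
    Since l a = m b this sum is selfadjoint, and selfadjoint elements with a selfadjoint product
    commute. *)
Lemma ck_range_comm l m : p l ** p m = p m ** p l.
Proof.
have sum : p l ** p m =
    \sum_(q <- lmins l m) t (pcomp l q.1) ** star (t (pcomp m q.2)).
  rewrite -cmulA [star _ ** (_ ** _)]cmulA ck_lmins cmul_suml cmul_sumr.
  rewrite big_seq [RHS]big_seq; apply: eq_bigr => q; rewrite in_fset_set// inE.
  case=> la mb _ _.
  by rewrite -cmulA -(ck_comp ck)// -(ck_comp_star mb) !cmulA.
have star_p n : star (p n) = p n by rewrite starM starK.
rewrite -[RHS]starK starM !star_p [in RHS]sum star_sum sum.
rewrite big_seq [RHS]big_seq; apply: eq_bigr => q; rewrite in_fset_set// inE.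
by case=> _ _ e _; rewrite starM starK e.
Qed.

(** The projection onto the part of t_v orthogonal to the ranges of all t_l with l in F; it has the
    exact form of the product in [ck_prod], so it vanishes when F is a finite exhaustive set. *)
Definition ck_gap v (F : seq L) :=
  \big[cmul/t (idp v)]_(l <- F) (t (idp v) - p l).

Lemma ck_vertex_range l : t (idp (rng l)) ** p l = p l.
Proof. by rewrite cmulA ck_rng. Qed.

Lemma ck_range_vertex l : p l ** t (idp (rng l)) = p l.
Proof. by rewrite -cmulA ck_rng_star. Qed.

Section Gap.
Variables (v : vertex L) (F : seq L).
Hypothesis Fv : forall l, l \in F -> rng l = v.

Lemma ck_gap_fix z : (forall l, l \in F -> star (t l) ** z = 0) ->
  ck_gap v F ** z = t (idp v) ** z.
Proof.
rewrite /ck_gap; elim: F Fv => [|l G IH] Gv zG; first by rewrite big_nil.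
rewrite big_cons -cmulA IH; last 2 first.
- by move=> m mG; apply: Gv; rewrite inE mG orbT.
- by move=> m mG; apply: zG; rewrite inE mG orbT.
have lv : rng l = v by apply: Gv; rewrite mem_head.
rewrite cmulA cmulBl (ck_proj_idem ck) -{2}lv ck_range_vertex.
by rewrite cmulBl -cmulA zG ?mem_head// cmul0r subr0.
Qed.

Lemma ck_gap_vertex : t (idp v) ** ck_gap v F = ck_gap v F.
Proof.
rewrite /ck_gap; case: F Fv => [|l G] Gv; first by rewrite big_nil (ck_proj_idem ck).
have lv : rng l = v by apply: Gv; rewrite mem_head.
by rewrite big_cons cmulA cmulBr (ck_proj_idem ck) -{2}lv ck_vertex_range.
Qed.

Lemma ck_gap_comm m : rng m = v -> p m ** ck_gap v F = ck_gap v F ** p m.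
Proof.
move=> mv; rewrite /ck_gap; elim: F => [|l G IH].
  by rewrite big_nil -mv ck_range_vertex ck_vertex_range.
rewrite big_cons cmulA cmulBr -[in LHS]mv ck_range_vertex.
rewrite -[RHS]cmulA -IH [RHS]cmulA [in RHS]cmulBl -[in RHS]mv ck_vertex_range.
by rewrite ck_range_comm.
Qed.

Lemma ck_gap_kill l : l \in F -> star (t l) ** ck_gap v F = 0.
Proof.
rewrite /ck_gap; elim: F Fv => [//|m G IH] Gv; rewrite inE big_cons => /orP[/eqP ->|lG].
  have mv : rng m = v by apply: Gv; rewrite mem_head.
  rewrite cmulA cmulBr -mv ck_rng_star cmulA ck_isom ck_src_star subrr.
  by rewrite cmul0l.
have lv : rng l = v by apply: Gv; rewrite inE lG orbT.
have IHl : star (t l) ** ck_gap v G = 0.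
  by apply: IH => // n nG; apply: Gv; rewrite inE nG orbT.
rewrite cmulA cmulBr -{1}lv ck_rng_star cmulBl -/(ck_gap v G) IHl sub0r.
(* Commutation of range projections lets p_l reappear to the right of p_m, where the induction
   hypothesis applies. *)
have -> : star (t l) ** p m = star (t l) ** p m ** p l.
  rewrite -[RHS]cmulA (ck_range_comm m l) [RHS]cmulA; congr (_ ** _).
  by rewrite cmulA ck_isom ck_src_star.
by rewrite -[_ ** p l ** _]cmulA -[p l ** _]cmulA IHl !cmul0r oppr0.
Qed.

Lemma ck_gap_killr l : l \in F -> ck_gap v F ** t l = 0.
Proof.
move=> lF; have -> : t l = p l ** t l by rewrite -cmulA ck_isom ck_src.
rewrite cmulA -ck_gap_comm ?Fv// -cmulA -[p l ** _]cmulA.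
by rewrite [star _ ** (_ ** _)]cmulA ck_gap_kill// cmul0l cmul0r.
Qed.

Lemma ck_gap_idem : ck_gap v F ** ck_gap v F = ck_gap v F.
Proof. by rewrite ck_gap_fix ?ck_gap_vertex// => l; exact: ck_gap_kill. Qed.

Lemma rn_ck_gap_le1 : rn (ck_gap v F) <= 1.
Proof.
rewrite /ck_gap; elim: F Fv => [|l G IH] Gv; first by rewrite big_nil rn_vertex_le1.
have lv : rng l = v by apply: Gv; rewrite mem_head.
have IHG : rn (ck_gap v G) <= 1.
  by apply: IH => m mG; apply: Gv; rewrite inE mG orbT.
rewrite big_cons; apply: le_trans (rnM _ _) _.
have le1 : rn (t (idp v) - p l) <= 1.
  apply: rn_proj_le1.
    by rewrite starB (ck_proj_star ck) starM starK.
  rewrite cmulBl !cmulBr (ck_proj_idem ck) -lv ck_vertex_range ck_range_vertex.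
  by rewrite [p l ** p l]cmulA (ck_partial_isometry ck) subrr subr0.
by have := rn_ge0 (t (idp v) - p l); have := rn_ge0 (ck_gap v G); rewrite /ck_gap; nra.
Qed.

End Gap.
End CKCalculus.

(** * Formal sums and their matrix entries *)

Section FormalSums.
Variables (k : nat) (L : kgraph k) (R : realType).
Implicit Types l m n a b s : L.

(** A term (c, (l, m)) stands for c t_l t_m^*. Sums are kept as syntax so that one expression can be
    evaluated in two families. *)
Definition fterm := (R[i] * (L * L))%type.
Implicit Types (E F : seq fterm) (x y : fterm).

Definition ev (A : cstarAlgType R) (t : L -> A) E : A :=
  \sum_(x <- E) x.1 *: (t x.2.1 ** star (t x.2.2)).

Definition balanced E := forall x, x \in E -> src x.2.1 = src x.2.2.

Definition legs_in (G : {fset L}) E :=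
  forall x, x \in E -> x.2.1 \in G /\ x.2.2 \in G.

Definition degree0 E := forall x, x \in E -> deg x.2.1 = deg x.2.2.

(** The proper continuations of s inside G; cutting t_s by them leaves the part covered by no longer
    path of G. *)
Definition tails (G : {fset L}) s : {fset L} := fset_set
  [set n | [/\ rng n = src s, pcomp s n \in G & n != idp (src s)]].

Lemma in_tails (G : {fset L}) s n : (n \in tails G s) =
  `[< [/\ rng n = src s, pcomp s n \in G & n != idp (src s)] >].
Proof.
rewrite in_fset_set ?inE//.
apply: (@sub_finite_set _ _ ([set n | rng n = src s] `&` pcomp s @^-1` [set` G])).
  by move=> a [].
(* By left cancellation the continuations lie in the image of [G] under a partial inverse of
   [pcomp s], with s as default value. *)
apply: (@sub_finite_set _ _ ((fun h => if pselect (exists a, rng a = src s /\ h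
  = pcomp s a)
   is left e then sval (cid e) else s) @` [set` G])).
  move=> a [/= as_ aG]; exists (pcomp s a) => //.
  case: pselect => [e|[]]; last by exists a.
  case: (cid e) => b [/= bs e']; apply: (@pcompI _ _ s) => //.
apply: finite_image; exact: finite_fset.
Qed.

Lemma tails_rng (G : {fset L}) s n : n \in tails G s -> rng n = src s.
Proof. by rewrite in_tails => /asboolP[]. Qed.

Definition matches x m s := exists a,
  [/\ src x.2.2 = rng a, s = pcomp x.2.2 a & m = pcomp x.2.1 a].

(** The matrix entry of E from s to m: a term c t_l t_l'^* sends t_s with s = l' a to c t_(l a). *)
Definition coef E m s : R[i] := \sum_(x <- E | `[< matches x m s >]) x.1.

Hypothesis fa : finitely_aligned L.

Section Family.
Variables (A : cstarAlgType R) (t : L -> A).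
Hypothesis ck : ck_family t.
Variable G : {fset L}.
Hypotheses (Gmce : mce_closed [set` G]) (Gswap : swap_closed [set` G]).

Let gap s := ck_gap t (src s) (tails G s).
Let trng s l (lF : l \in tails G s) := tails_rng lF.

(** In each term t_a t_b^* of t_m^* t_s the path s b lies in G. If b were trivial, m would be a
    prefix of s; hence b is a tail of s and its adjoint annihilates the gap. *)
Lemma gap_not_prefix m s : m \in G -> s \in G -> ~ prefix_of m s ->
  star (t m) ** t s ** gap s = 0.
Proof.
move=> mG sG mNs; rewrite (ck_lmins fa ck) cmul_suml big_seq big1// => -[a b].
rewrite in_fset_set// inE => ab; have [/= ma sb e _] := ab.
rewrite -cmulA (ck_gap_kill fa ck) ?cmul0r//; first exact: trng.
rewrite in_tails; apply/asboolP; split=> //; first by rewrite -e;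
  exact: (Gmce mG sG ab).
by apply: contra_not_neq mNs => b0; exists a; split=> //; rewrite e b0 pcomp_idr.
Qed.

(** If s = m a, then t_m^* t_s = t_a with a tail a of m, which the gap of m annihilates. *)
Lemma gap_prefix m s : m \in G -> s \in G -> prefix_of m s -> m <> s ->
  gap m ** star (t m) ** t s = 0.
Proof.
move=> mG sG [a [ma sE]] ms; rewrite sE -cmulA (ck_cancel fa ck)//.
apply: (ck_gap_killr fa ck); first exact: trng.
rewrite in_tails; apply/asboolP; split=> //; first by rewrite -sE.
by apply: contra_not_neq ms => a0; rewrite sE a0 pcomp_idr.
Qed.

Let unitG := \sum_(s <- G) t s ** gap s ** star (t s).

Lemma gap_vertex s : t (idp (src s)) ** gap s = gap s.
Proof. by apply: (ck_gap_vertex ck); exact: trng. Qed.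

(** Descending induction on the length of m. Let z be the defect t_m^* - t_m^* [unitG]. For every
    tail l of m the case of m l gives t_l^* z = 0, so the gap of m fixes z. But it also kills z: by
    [gap_prefix] and [gap_not_prefix] only the summand s = m survives, and it returns the gap of m
    times t_m^*. *)
Lemma gap_unit m : m \in G -> star (t m) ** unitG = star (t m).
Proof.
have [B GB] : exists B, forall m, m \in G -> (len m <= B)%N.
  exists (\max_(m <- G) len m) => n nG; exact: leq_bigmax_seq.
have [N] : exists N : nat, (B - len m < N)%N by exists (B - len m).+1.
elim: N m => [//|N IH] m mN mG.
pose z := star (t m) - star (t m) ** unitG.
have z1 : gap m ** z = t (idp (src m)) ** z.
  apply: (ck_gap_fix ck) => [|l lF]; first exact: trng.
  have ml := trng lF; move: lF; rewrite in_tails => /asboolP[_ mlG lN].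
  rewrite cmulBr cmulA (ck_comp_star ck)// IH ?subrr//.
  have l0 : (0 < len l)%N.
    rewrite lt0n; apply: contra_neq lN => /len_eq0/deg0_idp.
    by rewrite ml.
  by have := GB _ mlG; rewrite lenM//; lia.
have z2 : gap m ** z = 0.
  rewrite cmulBr cmulA -[X in X - _](_ : gap m ** star (t m) ** unitG = _) ?subrr//.
  rewrite /unitG cmul_sumr (big_fsetD1 m mG)/= big_seq big1 ?addr0.
    rewrite !cmulA -[gap m ** _ ** _ ]cmulA (ck_isom fa ck) -[_ ** _ ** gap m]cmulA.
    by rewrite gap_vertex (ck_gap_idem fa ck)//; exact: trng.
  move=> s; rewrite !inE => /andP[sm sG].
  have [ms|msN] := pselect (prefix_of m s).
    by rewrite !cmulA gap_prefix ?cmul0l//; apply/eqP; rewrite eq_sym.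
  rewrite !cmulA -[gap m ** _ ** _]cmulA -[gap m ** _ ** _]cmulA.
  by rewrite gap_not_prefix// cmul0r cmul0l.
apply/esym/eqP; rewrite -subr_eq0; apply/eqP; rewrite -/z.
have <- : t (idp (src m)) ** z = z.
  by rewrite cmulBr cmulA (ck_src_star ck).
by rewrite -z1.
Qed.

(** A term of E whose second leg is not a prefix of s dies on the gap of s. Any other term replaces
    that prefix, and [Gswap] keeps the result in G. *)
Lemma ev_gap E s : balanced E -> degree0 E -> legs_in G E -> s \in G ->
  ev t E ** t s ** gap s = \sum_(m <- G) coef E m s *: (t m ** gap s).
Proof.
move=> bE dE lE sG; rewrite /coef.
under eq_bigr do rewrite scaler_suml.
rewrite /ev !cmul_suml (exchange_big_dep xpredT)//=.
rewrite big_seq [RHS]big_seq; apply: eq_bigr => x xE.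
have [lG mG] := lE _ xE.
rewrite !cmulZl -!cmulA [star _ ** _]cmulA.
have [[a [ma sE]]|N] := pselect (prefix_of x.2.2 s); last first.
  rewrite gap_not_prefix// cmul0r scaler0 big1// => m /asboolP[a [ma sE _]].
  by case: N; exists a.
have la : src x.2.1 = rng a by rewrite bE.
have laG : pcomp x.2.1 a \in G.
  by apply: (Gswap lG mG) => //; [exact: dE|exact: bE|rewrite /= -sE].
have mtch m : matches x m s <-> m = pcomp x.2.1 a.
  split=> [[b [mb sE' ->]]|->]; last by exists a.
  by have := pcompI ma mb (etrans (esym sE) sE') => ->.
rewrite [RHS]big_mkcond (big_fsetD1 _ laG)/= ifT; last by apply/asboolP/mtch.
rewrite big_seq big1 ?addr0.
  have -> : star (t x.2.2) ** t s = t a by rewrite sE (ck_cancel fa ck).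
  by rewrite cmulA (ck_comp ck).
move=> m; rewrite !inE => /andP[mN _]; rewrite asboolF// => /mtch.
exact/eqP.
Qed.

(** A witness that the tails of s are not exhaustive. It mentions no family, so a witness obtained
    from one family may be used in another. *)
Definition refutes s n := rng n = src s /\
  forall l, l \in tails G s -> Lmin l n = set0.

Lemma gap_refuted s : gap s != 0 -> exists n, refutes s n.
Proof.
move=> s0; apply: contrapT => N; move/eqP: s0; apply.
apply: (ck_prod ck); split=> [l /= /trng//|m ms].
apply: contrapT => N'; apply: N; exists m; split=> // l lF.
apply/seteqP; split=> // q q1; apply: N'; exists l => //; by exists q.
Qed.

Lemma ev_gap_le E s c : balanced E -> degree0 E -> legs_in G E -> s \in G ->
  (forall m, m \in G -> rn (coef E m s) <= c) ->
  rn (ev t E ** t s ** gap s) <= (size G)%:R * c.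
Proof.
move=> bE dE lE sG hc; rewrite ev_gap//; apply: rn_sum_size => m mG.
rewrite rnZ; apply: le_trans (hc m mG); rewrite ler_piMr ?rn_ge0//.
apply: le_trans (rnM _ _) _.
have := rn_ck_le1 fa ck m.
have : rn (gap s) <= 1 by apply: (rn_ck_gap_le1 ck); exact: trng.
have := rn_ge0 (t m); have := rn_ge0 (gap s); nra.
Qed.

(** Compressing E by t_(m n)^* on the left and t_(s n) on the right isolates the entry: the result
    is the coefficient times the vertex projection at the source of n, a nonzero projection and
    hence of norm 1. *)
Lemma coef_le E m s n : balanced E -> degree0 E -> legs_in G E ->
  m \in G -> s \in G -> refutes s n -> t (idp (src n)) != 0 ->
  rn (coef E m s) <= rn (ev t E).
Proof.
move=> bE dE lE mG sG [ns nF] vn0.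
(* When degrees or sources of m and s differ, no balanced term of degree 0 matches them, and the
   entry is 0. *)
have [[dms sms]|N] := pselect (deg m = deg s /\ src m = src s); last first.
  rewrite /coef big1_seq ?rn0 ?rn_ge0// => x /andP[/asboolP[a [ma sE mE]] xE].
  case: N; have la : src x.2.1 = rng a by rewrite bE.
  by rewrite mE sE !deg_comp// dE// !src_comp.
have mn : src m = rng n by rewrite sms.
have cE : star (t (pcomp m n)) ** ev t E ** t (pcomp s n) =
    coef E m s *: t (idp (src n)).
  rewrite /ev cmul_sumr cmul_suml /coef scaler_suml [RHS]big_mkcond/=.
  rewrite big_seq [RHS]big_seq; apply: eq_bigr => x xE.
  have [lG mG'] := lE _ xE.
  rewrite cmulZr cmulZl -!cmulA.
  have [[a [ma sE]]|P] := pselect (prefix_of x.2.2 s); last first.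
    rewrite asboolF; last by move=> [a [ma sE _]]; apply: P; exists a.
    (* If the leg is not a prefix of s, a common extension of it with s n passes through s b' for a
       tail b' of s; then b' and n have a common extension, which [refutes] excludes. *)
    rewrite (ck_Lmin0 fa ck) ?cmul0r ?scaler0//.
    apply/seteqP; split=> // -[a b] [/= xa snb e _].
    rewrite src_comp// in snb.
    rewrite -pcompA// in e.
    have snb' : src s = rng (pcomp n b) by rewrite rng_comp.
    have [a' [b' [d [ab' a'd b'd aE bE']]]] := Lmin_factor xa snb' e.
    have [/= xa' sb' e' _] := ab'.
    have b'F : b' \in tails G s.
      rewrite in_tails; apply/asboolP; split=> //.
        by rewrite -e'; exact: (Gmce mG' sG ab').
      by apply: contra_not_neq P => b0; exists a'; split=> //; rewrite e' b0 pcomp_idr.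
    have [a2 [b2 [d2 [ab2 _ _ _ _]]]] := Lmin_factor b'd snb (esym bE').
    by have := nF _ b'F; rewrite -subset0 => /(_ _ ab2).
  have la : src x.2.1 = rng a by rewrite bE.
  have an : src a = rng n by rewrite -mn sms sE src_comp.
  have -> : star (t x.2.2) ** t (pcomp s n) = t (pcomp a n).
    by rewrite sE -pcompA// (ck_cancel fa ck)// rng_comp.
  rewrite (ck_comp ck) ?rng_comp// pcompA//.
  have [mE|mN] := eqVneq m (pcomp x.2.1 a).
    rewrite asboolT; last by exists a.
    by rewrite -mE (ck_isom fa ck) src_comp.
  rewrite asboolF; last first.
    move=> [b [mb sE' mE]]; move/eqP: mN; apply.
    by have := pcompI ma mb (etrans (esym sE) sE') => ->.
  rewrite (ck_orth fa ck) ?scaler0//.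
    by rewrite !deg_comp ?src_comp// dms sE !deg_comp// dE.
  apply: contra_neq mN => /pcomp_inj[]//; rewrite ?src_comp//.
  by rewrite dms sE !deg_comp// dE.
have := rnZ (coef E m s) (t (idp (src n))).
rewrite (rn_proj_eq1 (ck_proj_star ck _) (ck_proj_idem ck _) vn0) mulr1 => <-.
rewrite -cE; apply: le_trans (rnM _ _) _;
  apply: le_trans (ler_wpM2r (rn_ge0 _) (rnM _ _)) _.
rewrite rn_star -[leRHS]mulr1 -[X in _ <= X * _]mul1r.
by rewrite !ler_pM ?mulr_ge0 ?rn_ge0 ?(rn_ck_le1 fa ck).
Qed.

End Family.
End FormalSums.

(** * Formal products and the comparison of cores *)

Section FormalProducts.
Variables (k : nat) (L : kgraph k) (R : realType).
Hypothesis fa : finitely_aligned L.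
Implicit Types (l m n a b s : L) (E F : seq (fterm L R)) (x y : fterm L R).

Definition fstar E : seq (fterm L R) :=
  [seq (x.1^*%C, (x.2.2, x.2.1)) | x <- E].

Definition tmul x y : seq (fterm L R) :=
  [seq (x.1 * y.1, (pcomp x.2.1 q.1, pcomp y.2.2 q.2))
    | q : L * L <- fset_set (Lmin x.2.2 y.2.1)].

Definition fmul E F : seq (fterm L R) :=
  flatten [seq flatten [seq tmul x y | y <- F] | x <- E].

Lemma mem_fmul E F z : z \in fmul E F -> exists x y a b,
  [/\ x \in E, y \in F, Lmin x.2.2 y.2.1 (a, b) &
      z = (x.1 * y.1, (pcomp x.2.1 a, pcomp y.2.2 b))].
Proof.
move=> /flattenP[_ /mapP[x xE ->]] /flattenP[_ /mapP[y yF ->]] /mapP[[a b]].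
by rewrite in_fset_set// inE => ab ->; exists x, y, a, b.
Qed.

Lemma mem_fstar E z : z \in fstar E -> exists2 x, x \in E & z = (x.1^*%C,
  (x.2.2, x.2.1)).
Proof. by move=> /mapP[x xE ->]; exists x. Qed.

Lemma balanced_fmul E F : balanced E -> balanced F -> balanced (fmul E F).
Proof.
move=> bE bF z /mem_fmul[x [y [a [b [xE yF [/= xa yb e _] ->]]]]] /=.
rewrite !src_comp ?bE// -?bF//.
by have := congr1 (@src _ _) e; rewrite !src_comp.
Qed.

Lemma balanced_fstar E : balanced E -> balanced (fstar E).
Proof. by move=> bE z /mem_fstar[x xE ->] /=; rewrite bE. Qed.

Lemma degree0_fmul E F : balanced E -> balanced F -> degree0 E -> degree0 F ->
  degree0 (fmul E F).
Proof.
move=> bE bF dE dF z /mem_fmul[x [y [a [b [xE yF [/= xa yb e _] ->]]]]] /=.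
rewrite !deg_comp ?bE// -?bF// dE// -(dF _ yF).
by have := congr1 (@deg _ _) e; rewrite !deg_comp.
Qed.

Lemma degree0_fstar E : degree0 E -> degree0 (fstar E).
Proof. by move=> dE z /mem_fstar[x xE ->] /=; rewrite dE. Qed.

Lemma legs_in_fmul (G : {fset L}) E F : mce_closed [set` G] ->
  swap_closed [set` G] -> balanced E -> balanced F -> degree0 E -> degree0 F ->
  legs_in G E -> legs_in G F -> legs_in G (fmul E F).
Proof.
move=> Gmce Gswap bE bF dE dF lE lF z /mem_fmul[x [y [a [b [xE yF ab ->]]]]] /=.
have [/= xa yb e _] := ab.
have [xl xm] := lE _ xE; have [yl ym] := lF _ yF.
have xaG : pcomp x.2.2 a \in G by exact: (Gmce _ _ _ _ xm yl ab).
split.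
  by apply: (Gswap _ x.2.2) => //; [exact: dE|exact: bE].
apply: (Gswap _ y.2.1) => //; [by rewrite dF|by rewrite bF|].
by rewrite /= -e.
Qed.

Lemma legs_in_fstar (G : {fset L}) E : legs_in G E -> legs_in G (fstar E).
Proof. by move=> lE z /mem_fstar[x xE ->] /=; have [] := lE _ xE. Qed.

Section Eval.
Variables (A : cstarAlgType R) (t : L -> A).
Hypothesis ck : ck_family t.

Lemma ev_cat E F : ev t (E ++ F) = ev t E + ev t F.
Proof. by rewrite /ev big_cat. Qed.

Lemma ev_fstar E : ev t (fstar E) = star (ev t E).
Proof.
rewrite /ev star_sum big_map; apply: eq_bigr => x _ /=.
by rewrite starZ starM starK.
Qed.

Lemma ev_fmul E F : balanced E -> balanced F ->
  ev t (fmul E F) = ev t E ** ev t F.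
Proof.
move=> bE bF; rewrite [in RHS]/ev cmul_suml /fmul /ev big_flatten big_map.
rewrite big_seq [RHS]big_seq; apply: eq_bigr => x xE.
rewrite big_flatten big_map cmul_sumr big_seq [RHS]big_seq; apply: eq_bigr => y yF.
rewrite big_map cmulZl cmulZr scalerA -!cmulA [star _ ** (_ ** _)]cmulA.
rewrite (ck_lmins fa ck) cmul_suml cmul_sumr scaler_sumr.
rewrite big_seq [RHS]big_seq; apply: eq_bigr => -[a b]; rewrite in_fset_set// inE.
move=> [/= xa yb e _]; congr (_ *: _).
rewrite -(ck_comp ck) ?bE// -(ck_comp_star ck); last by rewrite -bF.
by rewrite -!cmulA.
Qed.

End Eval.

(** Evaluates to the 2^j-th power of E^* E by repeated squaring; every stage is selfadjoint, so the
    C*-identity gives its norm exactly. *)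
Fixpoint sqpow E j := if j is j'.+1 then let P := sqpow E j' in fmul P P
  else fmul (fstar E) E.

Lemma balanced_sqpow E j : balanced E -> balanced (sqpow E j).
Proof.
move=> bE; elim: j => [|j IH] /=; last exact: balanced_fmul.
exact: balanced_fmul (balanced_fstar bE) bE.
Qed.

Lemma sqpow_selfadj (A : cstarAlgType R) (t : L -> A) E j : ck_family t ->
  balanced E -> star (ev t (sqpow E j)) = ev t (sqpow E j).
Proof.
move=> ck bE; elim: j => [|j IH] /=.
  by rewrite ev_fmul//; [rewrite ev_fstar starM starK|exact: balanced_fstar].
by rewrite ev_fmul ?starM ?IH//; exact: balanced_sqpow.
Qed.

Lemma rn_sqpow (A : cstarAlgType R) (t : L -> A) E j : ck_family t ->
  balanced E -> rn (ev t (sqpow E j)) = (rn (ev t E) ^+ 2) ^+ (2 ^ j).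
Proof.
move=> ck bE; elim: j => [|j IH] /=.
  by rewrite ev_fmul//; [rewrite ev_fstar rn_cstar expr1|exact: balanced_fstar].
rewrite ev_fmul//; [|exact: balanced_sqpow|exact: balanced_sqpow].
by rewrite rn_sqr_selfadj ?sqpow_selfadj// IH expnSr exprM.
Qed.

Section Comparison.
Variables (A B : cstarAlgType R) (t : L -> A) (t' : L -> B).
Hypotheses (ck : ck_family t) (ck' : ck_family t').
Hypothesis nz' : forall v, t' (idp v) != 0.

(** By [gap_unit], E(t) is the sum over s in G of E t_s gap_s t_s^*. A summand with zero gap drops
    out. Otherwise some path refutes the tails of s, and [coef_le] bounds each coefficient at s by
    |E(t')|. One factor |G| counts the s, the other the entries at a fixed s. *)
Lemma core_bound (G : {fset L}) E : mce_closed [set` G] ->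
  swap_closed [set` G] -> balanced E -> degree0 E -> legs_in G E ->
  rn (ev t E) <= (size G)%:R * ((size G)%:R * rn (ev t' E)).
Proof.
move=> Gmce Gswap bE dE lE.
have -> : ev t E = \sum_(s <- G)
    ev t E ** t s ** ck_gap t (src s) (tails G s) ** star (t s).
  under [RHS]eq_bigr do rewrite -!cmulA [t _ ** (_ ** _)]cmulA.
  rewrite -cmul_sumr {2}/ev cmul_suml.
  rewrite /ev big_seq [RHS]big_seq; apply: eq_bigr => x xE.
  by rewrite cmulZl -cmulA (gap_unit fa ck Gmce)//; have [] := lE _ xE.
apply: rn_sum_size => s sG; apply: le_trans (rnM _ _) _.
rewrite rn_star -[leRHS]mulr1; apply: ler_pM; rewrite ?rn_ge0 ?(rn_ck_le1 fa ck)//.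
have [->|gap0] := eqVneq (ck_gap t (src s) (tails G s)) 0.
  by rewrite cmul0r rn0 mulr_ge0 ?rn_ge0.
have [n sn] := gap_refuted ck gap0.
apply: (ev_gap_le fa ck Gmce Gswap) => // m mG.
exact: (coef_le fa ck' Gmce bE dE lE mG sG sn).
Qed.

Lemma core_le E : balanced E -> degree0 E -> rn (ev t E) <= rn (ev t' E).
Proof.
move=> bE dE.
have [|G [EG Gmce Gswap]] := @finite_closure _ L
  [set` [seq x.2.1 | x <- E] ++ [seq x.2.2 | x <- E]] fa; first exact: finite_seq.
have lE : legs_in G E.
  by move=> x xE; split; apply: EG; rewrite /= mem_cat; apply/orP; [left|right];
     apply/mapP; exists x.
have core j : degree0 (sqpow E j) /\ legs_in G (sqpow E j).
  elim: j => [|j [dj lj]] /=; have bs := balanced_fstar bE.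
    have ds := degree0_fstar dE; have ls := legs_in_fstar lE.
    by split; [exact: degree0_fmul|exact: legs_in_fmul].
  by have bj := balanced_sqpow (j := j) bE; split;
    [exact: degree0_fmul|exact: legs_in_fmul].
rewrite -ler_sqr ?nnegrE ?rn_ge0//.
(* The factor |G|^2 is the same for all powers, since their legs remain in G; it is below |G|^2 2^j,
   the linear case of the growth lemma. *)
apply: (@subexponential_le _ _ _ ((size G)%:R * (size G)%:R) 1);
  rewrite ?mulr_ge0 ?exprn_ge0 ?rn_ge0// => j.
have [dj lj] := core j.
rewrite -!rn_sqpow// expr1.
apply: le_trans (core_bound Gmce Gswap (balanced_sqpow bE) dj lj) _.
rewrite mulrA ler_wpM2r ?rn_ge0// ler_peMr ?mulr_ge0//.
by rewrite ler1n expn_gt0.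
Qed.

End Comparison.
End FormalProducts.

(** * Gauge-invariant uniqueness *)

Section RootsOfUnity.
Variable R : realType.

(** A primitive 2^r-th root of unity. The value -1 at r = 1 is prescribed, since a chosen square
    root of 1 need not be primitive; further square roots double the order. *)
Fixpoint root2 r : R[i] :=
  if r is r'.+1 then (if r' is 0 then -1 else sqrtc (root2 r')) else 1.

Lemma root2S r : root2 r.+1 ^+ 2 = root2 r.
Proof. by case: r => [|r] /=; [rewrite sqrrN expr1n|rewrite sqr_sqrtc]. Qed.

Lemma rn_root2 r : rn (root2 r) = 1.
Proof.
elim: r => [|r IH]; first by rewrite (rn_real (1 : R)) normr1.
apply/eqP; rewrite -(eqrXn2 (n := 2))// ?rn_ge0//; apply/eqP.
by rewrite -rnXc root2S IH expr1n.
Qed.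

Lemma root2_order r n : root2 r ^+ n = 1 -> (2 ^ r %| n)%N.
Proof.
elim: r n => [|[|r] IH] n; first by rewrite dvd1n.
  rewrite /= -signr_odd dvdn2; case: (odd n) => //= /eqP.
  by rewrite expr1 eqNr oner_eq0.
move=> h; have /IH : root2 r.+1 ^+ n = 1 by rewrite -root2S -exprM mulnC exprM h expr1n.
move=> d1; have /dvdnP[m nE] : (2 %| n)%N.
  by apply: dvdn_trans d1; rewrite expnS dvdn_mulr.
move: h; rewrite nE mulnC exprM root2S => /IH d.
by rewrite [(2 ^ r.+2)%N]expnS dvdn_pmul2l.
Qed.

Lemma conj_rn1 (u : R[i]) : rn u = 1 -> u * u^*%C = 1.
Proof. by move=> u1; rewrite -rn_sqr u1 expr1n. Qed.

(** Clearing conjugates turns a comparison of degree differences into one of sums of naturals. *)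
Lemma unit_eq (u : R[i]) a b c d : rn u = 1 ->
  (u ^+ a * (u ^+ b)^*%C == u ^+ c * (u ^+ d)^*%C) = (u ^+ (a + d) == u ^+ (c + b)).
Proof.
move=> u1; have uu n : u ^+ n * (u ^+ n)^*%C = 1.
  by apply: conj_rn1; rewrite rnXc u1 expr1n.
have un n : u ^+ n != 0.
  by apply: contra_eqN (uu n) => /eqP ->; rewrite mul0r eq_sym oner_eq0.
rewrite -(inj_eq (mulIf (un b))) -mulrA [_^*%C * _]mulrC uu mulr1.
rewrite -(inj_eq (mulIf (un d))) -exprD.
by rewrite -!mulrA [u ^+ b * _]mulrC [_^*%C * _]mulrA [_^*%C * _]mulrC uu mul1r -exprD.
Qed.

End RootsOfUnity.

Section Generated.
Variables (R : realType) (A : cstarAlgType R) (G : set A).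

Lemma cstar_gen_subalgebra : cstar_subalgebra (cstar_gen G).
Proof.
split.
- by move=> S [SS _]; exact: cstar_subalgebra0.
- by move=> x y xG yG S SG; have [SS _] := SG; apply: (cstar_subalgebraD SS);
  [exact: xG|exact: yG].
- by move=> c x xG S SG; have [SS _] := SG; apply: (cstar_subalgebraZ SS); exact: xG.
- by move=> x y xG yG S SG; have [SS _] := SG; apply: (cstar_subalgebraM SS);
  [exact: xG|exact: yG].
- by move=> x xG S SG; have [SS _] := SG; apply: (cstar_subalgebra_star SS); exact: xG.
- apply: rn_closed => a h S SG; have [SS _] := SG.
  apply: (closed_rn (cstar_subalgebra_closed SS)) => e /h[x xG ax].
  by exists x => //; exact: xG.
Qed.

Lemma sub_cstar_gen : G `<=` cstar_gen G.
Proof. exact: sub_gen_smallest. Qed.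

Lemma cstar_gen_sub S : cstar_subalgebra S -> G `<=` S -> cstar_gen G `<=` S.
Proof. by move=> SS GS x; apply. Qed.

End Generated.

(** * Separating degrees by the gauge action *)

Section Gauge.
Variables (k : nat) (L : kgraph k) (R : realType).
Hypothesis fa : finitely_aligned L.
Implicit Types (E F : seq (fterm L R)) (x y : fterm L R).

Lemma ev_gen (A : cstarAlgType R) (t : L -> A) E : cstar_gen (range t) (ev t E).
Proof.
have SS := cstar_gen_subalgebra (range t).
rewrite /ev; elim: E => [|x E IH].
  by rewrite big_nil; exact: cstar_subalgebra0.
rewrite big_cons; apply: (cstar_subalgebraD SS) => //.
have tS l : cstar_gen (range t) (t l) by apply: sub_cstar_gen; exists l.
by apply: (cstar_subalgebraZ SS); apply: (cstar_subalgebraM SS) => //;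
  apply: (cstar_subalgebra_star SS).
Qed.

(** The scalar by which the gauge automorphism at z multiplies t_l t_m^*. *)
Definition chi (z : 'rV[R[i]^o]_k) x : R[i] :=
  torus_exp z (deg x.2.1) * (torus_exp z (deg x.2.2))^*%C.

Definition twist z E : seq (fterm L R) := [seq (x.1 * chi z x, x.2) | x <- E].

Section Action.
Variables (B : cstarAlgType R) (t : L -> B) (theta : 'rV[R[i]^o]_k -> B -> B).
Hypothesis act : torus_action (cstar_gen (range t)) theta.
Hypothesis theta_t : forall z l, torus z -> theta z (t l) = torus_exp z (deg l) *: t l.

Lemma theta_ev z E : torus z -> theta z (ev t E) = ev t (twist z E).
Proof.
move=> tz; have iso := torus_action_aut act tz.
have SS := cstar_gen_subalgebra (range t).
have tS l : cstar_gen (range t) (t l) by apply: sub_cstar_gen; exists l.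
elim: E => [|x E IH].
  rewrite /ev !big_nil -(scale0r (0 : B)) (star_isoZ iso) ?scale0r//.
  exact: cstar_subalgebra0.
rewrite /twist /= /ev !big_cons -/(ev t E) -/(ev t (twist z E)) -IH.
have S1 : cstar_gen (range t) (star (t x.2.2)) by apply: (cstar_subalgebra_star SS).
have S2 : cstar_gen (range t) (t x.2.1 ** star (t x.2.2)) by apply:
  (cstar_subalgebraM SS).
rewrite (star_isoD iso); [|exact: (cstar_subalgebraZ SS)|exact: ev_gen].
rewrite (star_isoZ iso)// (star_isoM iso)// (star_iso_star iso)//.
rewrite !theta_t// starZ cmulZl cmulZr !scalerA /chi.
by [].
Qed.

Lemma rn_twist z E : torus z -> rn (ev t (twist z E)) <= rn (ev t E).
Proof.
move=> tz; rewrite -theta_ev//.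
apply: (star_iso_contractive (cstar_gen_subalgebra (range t)) (torus_action_aut
  act tz)).
exact: ev_gen.
Qed.

(** If the automorphism multiplies each term by w or by -w, the average of E and w^* times its image
    keeps the first kind and cancels the second. The average is no larger in norm than E because the
    automorphism is contractive. *)
Lemma filter_chi_le z (w : R[i]) (P : pred (fterm L R)) E : torus z -> rn w = 1 ->
  (forall x, x \in E -> chi z x = if P x then w else - w) ->
  rn (ev t [seq x <- E | P x]) <= rn (ev t E).
Proof.
move=> tz w1 hE.
have -> : ev t [seq x <- E | P x] = (2^-1 : R)%:C *: (ev t E + w^*%C *: ev t
  (twist z E)).
  rewrite /ev big_filter big_mkcond/= /twist big_map scaler_sumr -big_split/=
    scaler_sumr.
  rewrite big_seq [RHS]big_seq; apply: eq_bigr => x xE /=.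
  rewrite !scalerA -scalerDl scalerA (hE _ xE) mulrCA [w^*%C * _]mulrC.
  have half2 : (2^-1 : R)%:C * 2 = 1 :> R[i].
    by rewrite -[2 in X in _ * X](rmorph_nat (real_complex R)) -rmorphM/= mulVf.
  case: ifP => _; rewrite ?mulNr conj_rn1// ?mulrN mulr1.
    by congr (_ *: _); rewrite -mulr2n -[x.1 *+ 2]mulr_natl mulrA half2 mul1r.
  by rewrite subrr mulr0 scale0r.
rewrite rnZ rn_real ger0_norm ?invr_ge0//.
have := rnD (ev t E) (w^*%C *: ev t (twist z E)); rewrite rnZ rn_conj w1 mul1r.
have := rn_twist E tz; lra.
Qed.

Definition row_at (i : 'I_k) (u : R[i]) : 'rV[R[i]^o]_k :=
  \row_j (if j == i then u else 1).

Lemma torus_row_at i u : rn u = 1 -> torus (row_at i u).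
Proof.
move=> u1 j; rewrite mxE; case: ifP => _; last exact: normr1.
by have := rnE u; rewrite u1.
Qed.

Lemma torus_exp_row_at i u m : torus_exp (row_at i u) m = u ^+ m i.
Proof.
rewrite /torus_exp (bigD1 i)//= mxE eqxx big1 ?mulr1// => j /negPf ji.
by rewrite mxE ji expr1n.
Qed.

(** Says, without subtraction, that the i-th degree differences of x and y agree modulo 2^r. *)
Definition same_at r (i : 'I_k) y x : bool :=
  root2 R r ^+ (deg x.2.1 i + deg y.2.2 i) == root2 R r ^+ (deg y.2.1 i + deg x.2.2 i).

(* Degrees identified by [root2 r] are separated by the sign of the ratio of
   their powers of [root2 r.+1], which averaging over two gauge automorphisms
   detects. *)
Lemma filter_same_at_le r i y E : rn (ev t [seq x <- E | same_at r i y x]) <=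
  rn (ev t E).
Proof.
elim: r => [|r IH].
  by rewrite (eq_filter (a2 := xpredT)) ?filter_predT// => x;
    rewrite /same_at !expr1n eqxx.
apply: le_trans IH.
have sub x : same_at r.+1 i y x -> same_at r i y x.
  by rewrite /same_at -(root2S R r) -!exprM ![(2 * _)%N]mulnC !exprM => /eqP ->.
rewrite (_ : [seq x <- E | same_at r.+1 i y x] =
    [seq x <- [seq x <- E | same_at r i y x] | same_at r.+1 i y x]); last first.
  rewrite -filter_predI; apply: eq_filter => x /=.
  by case: (boolP (same_at r.+1 i y x)) => //= /sub ->.
have u1 := rn_root2 R r.+1.
apply: (@filter_chi_le (row_at i (root2 R r.+1)) (chi (row_at i (root2 R r.+1)) y)).
- exact: torus_row_at.
- by rewrite /chi !torus_exp_row_at rnMc rn_conj !rnXc u1 !expr1n mulr1.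
move=> x; rewrite mem_filter => /andP[xy _].
rewrite /chi !torus_exp_row_at.
case: ifP => sx; first by apply/eqP; rewrite unit_eq.
have : (root2 R r.+1 ^+ deg x.2.1 i * (root2 R r.+1 ^+ deg x.2.2 i)^*%C) ^+ 2 =
  (root2 R r.+1 ^+ deg y.2.1 i * (root2 R r.+1 ^+ deg y.2.2 i)^*%C) ^+ 2.
  rewrite !exprMn -!rmorphXn/= -!exprM ![(_ * 2)%N]mulnC !exprM root2S.
  by apply/eqP; rewrite unit_eq ?rn_root2.
move=> /eqP; rewrite eqf_sqr unit_eq// -/(same_at _ _ _ _) sx /=.
by move=> /eqP.
Qed.

Definition same_deg (i : 'I_k) y x : bool :=
  (deg x.2.1 i + deg y.2.2 i == deg y.2.1 i + deg x.2.2 i)%N.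

Lemma filter_same_deg_le i y E : rn (ev t [seq x <- E | same_deg i y x]) <= rn (ev t E).
Proof.
pose N x := (deg x.2.1 i + deg y.2.2 i + (deg y.2.1 i + deg x.2.2 i))%N.
(* For terms of E both exponents are at most r, hence below 2^r, so agreement modulo 2^r is
   equality. *)
pose r := (\max_(x <- E) N x)%N.
apply: le_trans (filter_same_at_le r i y E).
suff -> : [seq x <- E | same_deg i y x] = [seq x <- E | same_at r i y x] by [].
apply: eq_in_filter => x xE; rewrite /same_deg /same_at.
have xr : (N x <= r)%N by exact: leq_bigmax_seq.
have := ltn_expl r (ltnSn 1); move: xr; rewrite /N.
set a := (deg x.2.1 i + deg y.2.2 i)%N; set b := (deg y.2.1 i + deg x.2.2 i)%N
  => abr r2.
have gen c d : (c <= d)%N -> (d <= r)%N -> root2 R r ^+ c = root2 R r ^+ d -> c = d.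
  move=> cd dr e; have : root2 R r ^+ (d - c) = 1.
    have u0 : root2 R r ^+ c != 0.
      rewrite expf_neq0//; apply: contra_eqN (rn_root2 R r) => /eqP ->.
      by rewrite rn0 eq_sym oner_eq0.
    by apply: (mulfI u0); rewrite -exprD subnKC// mulr1.
  move=> /root2_order; have [dc _|dc0] := posnP (d - c)%N; first lia.
  by move=> /(dvdn_leq dc0); lia.
apply/eqP/eqP => [-> //|e].
case: (leqP a b) => [ab|/ltnW ba].
  by apply: gen => //; exact: leq_trans (leq_addl _ _) abr.
by apply/esym/gen => //; exact: leq_trans (leq_addr _ _) abr.
Qed.

Definition same_class y x : bool := [forall i, same_deg i y x].

Lemma filter_same_class_le y E : rn (ev t [seq x <- E | same_class y x]) <= rn (ev t E).
Proof.
have gen (s : seq 'I_k) : rn (ev t [seq x <- E | all (fun i => same_deg i y x)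
  s]) <= rn (ev t E).
  elim: s => [|i s IH] /=; first by rewrite filter_predT.
  by apply: le_trans IH; rewrite filter_predI; exact: filter_same_deg_le.
rewrite (eq_filter (a2 := fun x => all (fun i => same_deg i y x) (enum 'I_k)))
  => [|x]; first exact: gen.
apply/forallP/allP => [h i _|h i]; first exact: h.
by apply: h; rewrite mem_enum.
Qed.

End Action.
End Gauge.

(** * Norm comparison for sums of mixed degree *)

Section GaugeUniqueness.
Variables (k : nat) (L : kgraph k) (R : realType).
Hypothesis fa : finitely_aligned L.
Implicit Types (E F : seq (fterm L R)) (x y : fterm L R).

Lemma leq_expn2r m n e : (m <= n)%N -> (m ^ e <= n ^ e)%N.
Proof. by case: e => [|e] mn; rewrite ?expn0 ?leq_exp2r. Qed.

(** All degree differences lie between -D and D, which leaves at most (2 D + 1)^k homogeneous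
    components. Spreads add under products, so this count grows polynomially along powers. *)
Definition spread_le (D : nat) E := forall x, x \in E -> forall i,
  (deg x.2.1 i <= deg x.2.2 i + D)%N /\ (deg x.2.2 i <= deg x.2.1 i + D)%N.

Lemma spread_exists E : exists D, spread_le D E.
Proof.
pose N x := (\max_i (deg x.2.1 i + deg x.2.2 i))%N.
exists (\max_(x <- E) N x)%N => x xE i.
have le1 : (deg x.2.1 i + deg x.2.2 i <= N x)%N.
  exact: (leq_bigmax (F := fun i => deg x.2.1 i + deg x.2.2 i)%N i).
have le2 : (N x <= \max_(x <- E) N x)%N by exact: leq_bigmax_seq.
by move: le1 le2; lia.
Qed.

Lemma spread_fstar D E : spread_le D E -> spread_le D (fstar E).
Proof. by move=> sE z /mem_fstar[x xE ->] i /=; have [] := sE _ xE i. Qed.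

Lemma spread_fmul D D' E F : balanced E -> balanced F ->
  spread_le D E -> spread_le D' F -> spread_le (D + D') (fmul E F).
Proof.
move=> bE bF sE sF z /(mem_fmul fa)[x [y [a [b [xE yF [/= xa yb e _] ->]]]]] i /=.
have [h1 h2] := sE _ xE i; have [h3 h4] := sF _ yF i.
have := congr1 (fun l => deg l i) e.
rewrite /= !degM ?(bE _ xE) -?(bF _ yF)//; lia.
Qed.

Lemma spread_sqpow D E j : balanced E -> spread_le D E ->
  spread_le (2 * D * 2 ^ j) (sqpow E j).
Proof.
move=> bE sE; elim: j => [|j IH] /=.
  rewrite muln1 mul2n -addnn; apply: spread_fmul => //; last exact: spread_fstar.
  exact: balanced_fstar.
rewrite expnS mulnCA mul2n -addnn; have bj := balanced_sqpow fa (j := j) bE.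
exact: spread_fmul.
Qed.

(** The offset D makes the degree difference a natural number; [inord] is faithful only when
    [spread_le D] holds. *)
Definition class_of D x : {ffun 'I_k -> 'I_(2 * D).+1} :=
  [ffun i => inord (D + deg x.2.1 i - deg x.2.2 i)].

Lemma same_class_of D E x y : spread_le D E -> x \in E -> y \in E ->
  (class_of D x == class_of D y) = same_class y x.
Proof.
move=> sE xE yE; apply/eqP/forallP => [e i|e].
  have [h1 h2] := sE _ xE i; have [h3 h4] := sE _ yE i.
  have := congr1 (fun f : {ffun 'I_k -> 'I_(2 * D).+1} => val (f i)) e.
  rewrite /= !ffunE !inordK /same_deg; try lia.
apply/ffunP => i; rewrite !ffunE; congr inord.
have [h1 h2] := sE _ xE i; have [h3 h4] := sE _ yE i.
by have := e i; rewrite /same_deg => /eqP; lia.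
Qed.

Section Comparison.
Variables (A B : cstarAlgType R) (t : L -> A) (t' : L -> B).
Hypotheses (ck : ck_family t) (gt' : gauge_ck_family t').

(** Split E into homogeneous components u. Since u^* u has degree 0, [core_le] and the C*-identity
    give |u(t)| <= |u(t')|, and the gauge action on the side of t' gives |u(t')| <= |E(t')|. *)
Lemma graded_bound D E : balanced E -> spread_le D E ->
  rn (ev t E) <= ((2 * D).+1 ^ k)%:R * rn (ev t' E).
Proof.
have [ck' nz' [theta act theta_t]] := gt'.
move=> bE sE.
have -> : ev t E = \sum_(c : {ffun 'I_k -> 'I_(2 * D).+1})
    ev t [seq x <- E | class_of D x == c].
  rewrite /ev; under [RHS]eq_bigr do rewrite big_filter.
  rewrite (exchange_big_dep xpredT)//=; apply: eq_bigr => x _.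
  by rewrite (big_pred1 (class_of D x)).
apply: le_trans (rn_sum _ _ _) _.
have -> : ((2 * D).+1 ^ k)%:R * rn (ev t' E) =
    \sum_(c : {ffun 'I_k -> 'I_(2 * D).+1}) rn (ev t' E).
  by rewrite sumr_const card_ffun !card_ord mulr_natl.
apply: ler_sum => c _; set u := [seq x <- E | class_of D x == c].
have uE x : x \in u -> x \in E by rewrite mem_filter => /andP[].
have [u0|[y yu]] : u = [::] \/ exists y, y \in u.
  by case: u {uE} => [|y u]; [left|right; exists y; rewrite mem_head].
  by rewrite u0 /ev big_nil rn0 rn_ge0.
have uF : u = [seq x <- E | same_class y x].
  apply: eq_in_filter => x xE; rewrite -(same_class_of sE)//; last exact: uE.
  by move: yu; rewrite mem_filter => /andP[/eqP ->].
have bu : balanced u by move=> x /uE; exact: bE.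
have bsu := balanced_fstar bu.
(* All terms of u have the same degree difference, and it cancels in u^* u. *)
have du : degree0 (fmul (fstar u) u).
  move=> z /(mem_fmul fa)[x' [w [a [b [/mem_fstar[x xu ->] wu [/= xa wb e _] ->]]]]].
  have cls v : v \in u -> same_class y v by rewrite uF mem_filter => /andP[].
  apply/ffunP => i; rewrite /= !degM -?bu//.
  have := congr1 (fun l => deg l i) e; rewrite !degM//.
  move: (cls _ xu) (cls _ wu) => /forallP/(_ i)/eqP + /forallP/(_ i)/eqP.
  lia.
apply: le_trans (filter_same_class_le act theta_t y E); rewrite -uF.
rewrite -ler_sqr ?nnegrE ?rn_ge0// -!rn_cstar -!ev_fstar -!(ev_fmul fa)//.
exact: core_le (balanced_fmul fa bsu bu) du.
Qed.

Lemma gauge_le E : balanced E -> rn (ev t E) <= rn (ev t' E).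
Proof.
have [ck' _ _] := gt'.
move=> bE; have [D sE] := spread_exists E.
rewrite -ler_sqr ?nnegrE ?rn_ge0//.
(* The 2^j-th power of E^* E has spread at most 2 D 2^j, and 2 (2 D 2^j) + 1 <= (2 (2 D) + 1) 2^j;
   the k coordinates give the exponent. *)
apply: (@subexponential_le _ _ _ (2 * (2 * D)).+1%:R k);
  rewrite ?exprn_ge0 ?rn_ge0// => j.
rewrite -!(rn_sqpow fa)//.
apply: le_trans (graded_bound (balanced_sqpow fa bE) (spread_sqpow (j := j) bE sE)) _.
rewrite ler_wpM2r ?rn_ge0// -natrM -natrX ler_nat; apply: leq_expn2r.
nia.
Qed.

End Comparison.
End GaugeUniqueness.

(** * From equal norms to the canonical isomorphism *)

Section CanonicalIsomorphism.
Variables (k : nat) (L : kgraph k) (R : realType).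
Hypothesis fa : finitely_aligned L.
Implicit Types (E F : seq (fterm L R)).

Definition fscale (c : R[i]) E : seq (fterm L R) := [seq (c * x.1, x.2) | x <- E].

Definition fgen (l : L) : seq (fterm L R) := [:: (1, (l, idp (src l)))].

Lemma balanced_cat E F : balanced E -> balanced F -> balanced (E ++ F).
Proof. by move=> bE bF x; rewrite mem_cat => /orP[/bE|/bF]. Qed.

Lemma balanced_fscale c E : balanced E -> balanced (fscale c E).
Proof. by move=> bE x /mapP[y /bE + ->]. Qed.

Lemma balanced_fgen l : balanced (fgen l).
Proof. by move=> x; rewrite inE => /eqP ->; rewrite /= src_idp. Qed.

Section Eval.
Variables (A : cstarAlgType R) (t : L -> A).
Hypothesis ck : ck_family t.

Lemma ev_fscale c E : ev t (fscale c E) = c *: ev t E.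
Proof. by rewrite /ev big_map scaler_sumr; apply: eq_bigr => x _; rewrite scalerA. Qed.

Lemma ev_fgen l : ev t (fgen l) = t l.
Proof. by rewrite /ev big_seq1 scale1r (ck_proj_star ck) (ck_src ck). Qed.

Lemma rnM_sub (a b a' b' : A) e : 0 <= e -> e <= 1 -> rn (a - a') <= e -> rn (b
  - b') <= e ->
  rn (a ** b - a' ** b') <= e * (rn a + rn b + 1).
Proof.
move=> e0 e1 ha hb.
have -> : a ** b - a' ** b' = (a - a') ** b + (a' ** (b - b')).
  by rewrite cmulBl cmulBr addrA subrK.
apply: le_trans (rnD _ _) _; have := rnM (a - a') b; have := rnM a' (b - b').
have ha' : rn a' <= rn a + e.
  by have := rn_triangle a' a 0; rewrite !subr0 (rnBC a'); lra.
have := rn_ge0 a; have := rn_ge0 b; have := rn_ge0 a'; have := rn_ge0 (b - b').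
nra.
Qed.

Definition approximable (a : A) := forall e : R, 0 < e ->
  exists E, balanced E /\ rn (a - ev t E) <= e.

Lemma small_scale (e M : R) : 0 < e -> 0 <= M ->
  exists d, [/\ 0 < d, d <= 1 & d * M <= e].
Proof.
move=> e0 M0; exists (Num.min 1 (e / (M + 1))); split.
- by rewrite lt_min ltr01 divr_gt0//; lra.
- by rewrite ge_min lexx.
- apply: (@le_trans _ _ (e / (M + 1) * M));
  first by rewrite ler_wpM2r// ge_min lexx orbT.
  by rewrite mulrAC ler_pdivrMr; nra.
Qed.

(** The approximable elements form a C*-subalgebra containing the generators: formal sums are closed
    under the operations, and approximation passes to norm limits. *)
Lemma approximable_gen a : cstar_gen (range t) a -> approximable a.
Proof.
apply: (cstar_gen_sub (S := approximable)) => [|_ [l _ <-] e e0]; last first.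
  by exists (fgen l); split; [exact: balanced_fgen|rewrite ev_fgen subrr rn0 ltW].
split.
- by move=> e e0; exists [::]; split=> //; rewrite /ev big_nil subrr rn0 ltW.
- move=> x y hx hy e e0; have e2 : 0 < e / 2 by rewrite divr_gt0.
  have [E [bE xE]] := hx _ e2; have [F [bF yF]] := hy _ e2.
  exists (E ++ F); split; first exact: balanced_cat.
  by rewrite ev_cat opprD addrACA; apply: le_trans (rnD _ _) _; lra.
- move=> c x hx e e0; have [d [d0 _ dc]] := small_scale e0 (rn_ge0 c).
  have [E [bE xE]] := hx _ d0; exists (fscale c E); split; first exact: balanced_fscale.
  rewrite ev_fscale -scalerBr rnZ; have := rn_ge0 c; nra.
- move=> x y hx hy e e0.
  have [|d [d0 d1 dc]] := small_scale (M := rn x + rn y + 1) e0.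
    by have := rn_ge0 x; have := rn_ge0 y; lra.
  have [E [bE xE]] := hx _ d0; have [F [bF yF]] := hy _ d0.
  exists (fmul E F); split; first exact: balanced_fmul.
  by rewrite (ev_fmul fa)//; apply: le_trans dc; apply: rnM_sub => //; exact: ltW.
- move=> x hx e e0; have [E [bE xE]] := hx _ e0; exists (fstar E).
  by split; [exact: balanced_fstar|rewrite ev_fstar -starB rn_star].
- apply: rn_closed => b h e e0; have e2 : 0 < e / 2 by rewrite divr_gt0.
  have [x hx ax] := h _ e2; have [E [bE xE]] := hx _ e2; exists E; split=> //.
  by apply: le_trans (rn_triangle _ x _) _; lra.
Qed.

End Eval.

(** The closure of the pairs (E(t), E(t')), that is, the graph of the isomorphism. Its symmetry in t
    and t' provides the inverse without a second construction. *)
Definition matched (A B : cstarAlgType R) (t : L -> A) (t' : L -> B) a b :=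
  forall e : R, 0 < e ->
    exists E, [/\ balanced E, rn (a - ev t E) <= e & rn (b - ev t' E) <= e].

Lemma matched_sym (A B : cstarAlgType R) (t : L -> A) (t' : L -> B) a b :
  matched t t' a b -> matched t' t b a.
Proof. by move=> ab e /ab[E [bE aE bE']]; exists E. Qed.

Lemma matched_gen (A B : cstarAlgType R) (t : L -> A) (t' : L -> B) a b :
  matched t t' a b -> cstar_gen (range t') b.
Proof.
move=> ab; apply: (closed_rn (cstar_subalgebra_closed (cstar_gen_subalgebra _))).
by move=> e /ab[E [_ _ bE]]; exists (ev t' E) => //; exact: ev_gen.
Qed.

Section Isometric.
Variables (A B : cstarAlgType R) (t : L -> A) (t' : L -> B).
Hypotheses (ck : ck_family t) (ck' : ck_family t').
Hypothesis isom : forall E, balanced E -> rn (ev t E) = rn (ev t' E).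

Lemma isom_sub E F : balanced E -> balanced F ->
  rn (ev t E - ev t F) = rn (ev t' E - ev t' F).
Proof.
move=> bE bF; have := isom (balanced_cat bE (balanced_fscale (c := -1) bF)).
by rewrite !ev_cat !ev_fscale !scaleN1r.
Qed.

(** Formal sums approximating a form a Cauchy sequence under t, hence under t' by the isometry; its
    limit is the partner of a. *)
Lemma matched_total a : cstar_gen (range t) a -> exists b, matched t t' a b.
Proof.
move=> /(approximable_gen ck) ha.
pose E n := sval (cid (ha _ (half_expn_gt0 R n))).
have EP n : balanced (E n) /\ rn (a - ev t (E n)) <= 2^-1 ^+ n :=
  svalP (cid (ha _ (half_expn_gt0 R n))).
have small (e : R) : 0 < e -> exists n, 2 * 2^-1 ^+ n <= e.
  move=> e0; have [n hn] := half_expn_small (e := e / 2) ltac:(by rewrite divr_gt0).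
  by exists n; lra.
have [|b hb] := complete_rn (u := fun n => ev t' (E n)) small.
  move=> n m nm; have [[bn an] [bm am]] := (EP n, EP m).
  rewrite -isom_sub//; have := rn_triangle (ev t (E n)) a (ev t (E m)).
  by rewrite (rnBC _ a); have := half_expn_le R nm; lra.
exists b => e e0; have [n hn] := small _ e0; exists (E n); have [bn an] := EP n.
split=> //; last by rewrite rnBC; exact: le_trans hn.
by apply: le_trans an _; apply: le_trans hn; have := half_expn_gt0 R n; lra.
Qed.

Lemma matched_fun a b b' : matched t t' a b -> matched t t' a b' -> b = b'.
Proof.
move=> ab ab'; apply/eqP; rewrite -subr_eq0; apply/eqP/rn_small => e e0.
have e4 : 0 < e / 4 by rewrite divr_gt0.
have [E [bE aE bE']] := ab _ e4; have [F [bF aF bF']] := ab' _ e4.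
apply: le_trans (rn_triangle _ (ev t' E) _) _.
have := rn_triangle (ev t' E) (ev t' F) b'; rewrite -isom_sub// (rnBC (ev t' F) b').
have := rn_triangle (ev t E) a (ev t F); rewrite (rnBC _ a); lra.
Qed.

Lemma matchedD a b a' b' : matched t t' a b -> matched t t' a' b' ->
  matched t t' (a + a') (b + b').
Proof.
move=> ab ab' e e0; have e2 : 0 < e / 2 by rewrite divr_gt0.
have [E [bE aE bE']] := ab _ e2; have [F [bF aF bF']] := ab' _ e2.
exists (E ++ F); split; first exact: balanced_cat.
  by rewrite ev_cat opprD addrACA; apply: le_trans (rnD _ _) _; lra.
by rewrite ev_cat opprD addrACA; apply: le_trans (rnD _ _) _; lra.
Qed.

Lemma matchedZ c a b : matched t t' a b -> matched t t' (c *: a) (c *: b).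
Proof.
move=> ab e e0; have [d [d0 _ dc]] := small_scale e0 (rn_ge0 c).
have [E [bE aE bE']] := ab _ d0; exists (fscale c E).
by split; [exact: balanced_fscale| |]; rewrite ev_fscale -scalerBr rnZ;
  have := rn_ge0 c; nra.
Qed.

Lemma matchedM a b a' b' : matched t t' a b -> matched t t' a' b' ->
  matched t t' (a ** a') (b ** b').
Proof.
move=> ab ab' e e0.
have [|d [d0 d1 dc]] := small_scale (M := (rn a + rn a' + 1) + (rn b + rn b' + 1)) e0.
  by have := rn_ge0 a; have := rn_ge0 a'; have := rn_ge0 b; have := rn_ge0 b'; lra.
have [E [bE aE bE']] := ab _ d0; have [F [bF aF bF']] := ab' _ d0.
have := rn_ge0 a; have := rn_ge0 a'; have := rn_ge0 b; have := rn_ge0 b'.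
move=> p0 q0 r0 s0; exists (fmul E F); split; first exact: balanced_fmul.
  rewrite (ev_fmul fa)//; apply: le_trans (rnM_sub (ltW d0) d1 aE aF) _; nra.
rewrite (ev_fmul fa)//; apply: le_trans (rnM_sub (ltW d0) d1 bE' bF') _; nra.
Qed.

Lemma matched_star a b : matched t t' a b -> matched t t' (star a) (star b).
Proof.
move=> ab e e0; have [E [bE aE bE']] := ab _ e0; exists (fstar E).
by split; [exact: balanced_fstar| |]; rewrite ev_fstar -starB rn_star.
Qed.

Lemma matched_t l : matched t t' (t l) (t' l).
Proof.
move=> e e0; exists (fgen l); split; first exact: balanced_fgen.
  by rewrite ev_fgen// subrr rn0 ltW.
by rewrite ev_fgen// subrr rn0 ltW.
Qed.

End Isometric.

Lemma canonical_iso (A B : cstarAlgType R) (t : L -> A) (t' : L -> B) :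
  ck_family t -> ck_family t' ->
  (forall E, balanced E -> rn (ev t E) = rn (ev t' E)) ->
  exists2 phi : A -> B, star_iso (cstar_gen (range t)) (cstar_gen (range t')) phi
    & forall l, phi (t l) = t' l.
Proof.
move=> ck ck' isom.
have isom' E : balanced E -> rn (ev t' E) = rn (ev t E) by move=> /isom.
pose phi a := if pselect (exists b, matched t t' a b) is left h then sval (cid
  h) else 0.
have phiP a : cstar_gen (range t) a -> matched t t' a (phi a).
  move=> /(matched_total ck isom) h; rewrite /phi; case: pselect => // h'.
  exact: svalP (cid h').
have phi_eq a b : cstar_gen (range t) a -> matched t t' a b -> phi a = b.
  by move=> /phiP pa ab; exact: (matched_fun isom pa ab).
have SS := cstar_gen_subalgebra (range t).
exists phi; last first.
  by move=> l; apply: phi_eq; [apply: sub_cstar_gen; exists l|exact: matched_t].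
split.
- split.
  + by move=> a /phiP; exact: matched_gen.
  + move=> a a'; rewrite !inE => /phiP pa /phiP pa' e.
    by rewrite e in pa; exact: (matched_fun isom' (matched_sym pa) (matched_sym pa')).
  + move=> b /(matched_total ck' isom')[a /matched_sym ab].
    have Sa : cstar_gen (range t) a by exact: matched_gen (matched_sym ab).
    by exists a => //; exact: phi_eq.
- move=> x y Sx Sy; apply: phi_eq; first exact: (cstar_subalgebraD SS).
  by apply: matchedD; exact: phiP.
- move=> c x Sx; apply: phi_eq; first exact: (cstar_subalgebraZ SS).
  by apply: matchedZ; exact: phiP.
- move=> x y Sx Sy; apply: phi_eq; first exact: (cstar_subalgebraM SS).
  by apply: matchedM => //; exact: phiP.
- move=> x Sx; apply: phi_eq; first exact: (cstar_subalgebra_star SS).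
  by apply: matched_star; exact: phiP.
Qed.

Lemma gauge_uniqueness (A B : cstarAlgType R) (t : L -> A) (t' : L -> B) :
  gauge_ck_family t -> gauge_ck_family t' ->
  exists2 phi : A -> B, star_iso (cstar_gen (range t)) (cstar_gen (range t')) phi
    & forall l, phi (t l) = t' l.
Proof.
move=> gt gt'; have [ck _ _] := gt; have [ck' _ _] := gt'.
apply: canonical_iso => // E bE; apply/eqP.
by rewrite eq_le !(gauge_le fa).
Qed.

End CanonicalIsomorphism.

(** * Operators on l^2 *)

Section Sums.
Variables (R : realType) (Y : choiceType).
Implicit Types (f g : Y -> R[i]) (F : {fset Y}).

(** Unconditional summation along finite subsets, because the index set of the representation may be
    uncountable. *)
Definition has_sum f (l : R[i]) := forall e : R, 0 < e ->
  exists F0 : {fset Y}, forall F, (F0 `<=` F)%fset ->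
    rn (\sum_(y <- F) f y - l) <= e.

Lemma has_sum_unique f l l' : has_sum f l -> has_sum f l' -> l = l'.
Proof.
move=> fl fl'; apply/eqP; rewrite -subr_eq0; apply/eqP/rn_small => e e0.
have e2 : 0 < e / 2 by rewrite divr_gt0.
have [F1 h1] := fl _ e2; have [F2 h2] := fl' _ e2.
have := h1 (F1 `|` F2)%fset (fsubsetUl _ _).
have := h2 (F1 `|` F2)%fset (fsubsetUr _ _).
move=> le2; rewrite rnBC => le1.
by apply: le_trans (rn_triangle _ (\sum_(y <- (F1 `|` F2)%fset) f y) _) _; lra.
Qed.

Lemma has_sum_ext f g l : f =1 g -> has_sum f l -> has_sum g l.
Proof. by move=> /funext ->. Qed.

Lemma has_sumD f g l m :
  has_sum f l -> has_sum g m -> has_sum (fun y => f y + g y) (l + m).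
Proof.
move=> fl gm e e0.
have e2 : 0 < e / 2 by rewrite divr_gt0.
have [F1 h1] := fl _ e2; have [F2 h2] := gm _ e2.
exists (F1 `|` F2)%fset => F; rewrite fsubUset => /andP[/h1 le1 /h2 le2].
rewrite big_split/= opprD addrACA.
by apply: le_trans (rnD _ _) _; lra.
Qed.

Lemma has_sumZ c f l : has_sum f l -> has_sum (fun y => c * f y) (c * l).
Proof.
move=> fl e e0; have c0 := rn_ge0 c.
have [F1 h1] := fl (e / (rn c + 1)) ltac:(rewrite divr_gt0//; lra).
exists F1 => F /h1 le1; rewrite -mulr_sumr -mulrBr rnMc.
apply: le_trans (ler_wpM2l c0 le1) _.
rewrite mulrA ler_pdivrMr; last by lra.
by nra.
Qed.

Lemma has_sum_conj f l : has_sum f l -> has_sum (fun y => (f y)^*%C) l^*%C.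
Proof.
move=> fl e /fl[F1 h1]; exists F1 => F /h1.
by rewrite -rmorph_sum -rmorphB/= rn_conj.
Qed.

Lemma ler_sum_fset (g : Y -> R) (F G : {fset Y}) :
  (forall y, 0 <= g y) -> (F `<=` G)%fset ->
  \sum_(y <- F) g y <= \sum_(y <- G) g y.
Proof.
move=> g0 FG; rewrite [leLHS]big_seq (eq_bigr (fun y => if y \in F then g y
  else 0)); last first.
  by move=> y ->.
rewrite -big_seq (big_fset_incl _ FG); last by move=> y _ /negPf ->.
by apply: ler_sum => y _; case: ifP.
Qed.

Lemma has_sum_nonneg (g : Y -> R) (M : R) : (forall y, 0 <= g y) ->
  (forall F, \sum_(y <- F) g y <= M) ->
  exists l : R, has_sum (fun y => (g y)%:C) l%:C.
Proof.
move=> g0 gM; pose S := [set \sum_(y <- F) g y | F in [set: {fset Y}]].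
have hS : has_sup S.
  split; first by exists (\sum_(y <- fset0) g y); exists fset0.
  by exists M => _ [F _ <-].
exists (sup S) => e e0.
have [_ [F0 _ <-] lt] := sup_adherent e0 hS.
exists F0 => F F0F; rewrite -rmorph_sum -rmorphB/= rn_real.
have le1 : \sum_(y <- F) g y <= sup S by apply: ub_le_sup; [case: hS|exists F].
have := ler_sum_fset g0 F0F.
rewrite ler_norml; lra.
Qed.

Lemma has_sum_abs f (M : R) : (forall F, \sum_(y <- F) rn (f y) <= M) ->
  exists l, has_sum f l.
Proof.
move=> fM.
pose pos (h : Y -> R) y := (rn (f y) + h y) / 2.
have ex (h : Y -> R) : (forall y, `|h y| <= rn (f y)) ->
    exists l : R, has_sum (fun y => (pos h y)%:C) l%:C.
  move=> hf; apply: (has_sum_nonneg (M := M)).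
    by move=> y; have := hf y; rewrite ler_norml /pos; lra.
  move=> F; apply: le_trans (fM F); apply: ler_sum => y _.
  by have := hf y; rewrite ler_norml /pos; lra.
have Re_le y : `|complex.Re (f y)| <= rn (f y) by apply: rn_Re.
have Im_le y : `|complex.Im (f y)| <= rn (f y) by apply: rn_Im.
have [l1 h1] := ex _ Re_le.
have [l2 h2] := ex (fun y => - complex.Re (f y)) (fun y => ltac:(rewrite
  normrN; exact: Re_le)).
have [l3 h3] := ex _ Im_le.
have [l4 h4] := ex (fun y => - complex.Im (f y)) (fun y => ltac:(rewrite
  normrN; exact: Im_le)).
exists ((l1%:C + (-1) * l2%:C) + 'i%C * (l3%:C + (-1) * l4%:C)).
apply: has_sum_ext (has_sumD (has_sumD h1 (has_sumZ _ h2)) (has_sumZ _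
  (has_sumD h3 (has_sumZ _ h4)))) => y.
apply/eqP; rewrite eq_complex /pos; move: (rn (f y)) => r.
case: (f y) => a b /=.
apply/andP; split; apply/eqP; lra.
Qed.

Lemma has_sum_Re_le f l (M : R) : has_sum f l ->
  (forall F, complex.Re (\sum_(y <- F) f y) <= M) -> complex.Re l <= M.
Proof.
move=> fl fM; apply/ler_addgt0Pr => e /fl[F1 /(_ F1 (fsubset_refl _)) le].
have := rn_Re (\sum_(y <- F1) f y - l).
move=> /le_trans/(_ le); rewrite raddfB/= ler_norml.
by have := fM F1; lra.
Qed.

Lemma has_sum_Re_ge (g : Y -> R) l F : (forall y, 0 <= g y) ->
  has_sum (fun y => (g y)%:C) l -> \sum_(y <- F) g y <= complex.Re l.
Proof.
move=> g0 fl; apply/ler_addgt0Pr => e /fl[F1 /(_ (F1 `|` F)%fset (fsubsetUl _ _)) le].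
have := rn_Re (\sum_(y <- (F1 `|` F)%fset) (g y)%:C - l).
move=> /le_trans/(_ le); rewrite raddfB/= -rmorph_sum/= ler_norml.
have := ler_sum_fset g0 (fsubsetUr F1 F); lra.
Qed.

Lemma has_sum_real (g : Y -> R) l :
  has_sum (fun y => (g y)%:C) l -> l = (complex.Re l)%:C.
Proof.
move=> gl; apply: (has_sum_unique gl) => e /gl[F1 h]; exists F1 => F /h.
rewrite -rmorph_sum -rmorphB/= rn_real; apply: le_trans.
by have := rn_Re (\sum_(y <- F) (g y)%:C - l); rewrite raddfB/= -rmorph_sum/=.
Qed.

End Sums.

Section Limits.
Variable R : realType.

Lemma real_lim (r eps : nat -> R) :
  (forall n m, (n <= m)%N -> `|r n - r m| <= eps n) ->
  exists l, forall n, `|r n - l| <= eps n.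
Proof.
move=> rC; pose S := [set r n - eps n | n in [set: nat]].
have Sub m : ubound S (r m + eps m).
  move=> _ [n _ <-]; case: (leqP n m) => [nm|/ltnW mn].
    have := rC _ _ nm; have := rC m m (leqnn m); rewrite !ler_norml; lra.
  by have := rC _ _ mn; have := rC n n (leqnn n); rewrite !ler_norml; lra.
have S0 : S !=set0 by exists (r 0 - eps 0)%R; exists 0%N.
exists (sup S) => n.
have le1 : r n - eps n <= sup S.
  by apply: ub_le_sup; [exists (r n + eps n)|exists n].
have le2 : sup S <= r n + eps n by apply: ge_sup.
by rewrite ler_norml; lra.
Qed.

Lemma complex_lim (z : nat -> R[i]) (eps : nat -> R) :
  (forall e, 0 < e -> exists n, eps n <= e) ->
  (forall n m, (n <= m)%N -> rn (z n - z m) <= eps n) ->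
  exists l, forall e, 0 < e -> exists n, forall m, (n <= m)%N ->
    rn (z m - l) <= e.
Proof.
move=> eps0 zC.
have [a ha] : exists l, forall n, `|complex.Re (z n) - l| <= eps n.
  apply: real_lim => n m nm; apply: le_trans (zC _ _ nm).
  by rewrite -raddfB; exact: rn_Re.
have [b hb] : exists l, forall n, `|complex.Im (z n) - l| <= eps n.
  apply: real_lim => n m nm; apply: le_trans (zC _ _ nm).
  by rewrite -raddfB; exact: rn_Im.
have lim n : rn (z n - (a +i* b)) <= eps n + eps n.
  have -> : z n - (a +i* b) = (complex.Re (z n) - a)%:C + 'i%C * (complex.Im (z
    n) - b)%:C.
    by rewrite [LHS]complexE; case: (z n).
  apply: le_trans (rnD _ _) _; rewrite rnMc !rn_real rn_i mul1r.
  exact: lerD (ha n) (hb n).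
exists (a +i* b) => e e0; have [n en] := eps0 (e / 3) ltac:(by rewrite divr_gt0).
exists n => m nm.
apply: le_trans (rn_triangle _ (z n) _) _; rewrite rnBC.
by have := zC _ _ nm; have := lim n; lra.
Qed.

End Limits.

Section Ell2.
Variables (R : realType) (Y : choiceType).

Definition sqsum (x : Y -> R[i]) :=
  exists M : R, forall F : {fset Y}, \sum_(y <- F) rn (x y) ^+ 2 <= M.

Record ell2 := Ell2 { ell2_fun :> Y -> R[i]; ell2P : sqsum ell2_fun }.

Lemma ell2_eq (x y : ell2) : x =1 y -> x = y.
Proof.
case: x y => [x xP] [y yP] /= /funext xy; rewrite xy in xP *.
by congr Ell2; exact: Prop_irrelevance.
Qed.

HB.instance Definition _ := gen_eqMixin ell2.
HB.instance Definition _ := gen_choiceMixin ell2.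

Lemma sqsum0 : sqsum (fun=> 0).
Proof. by exists 0 => F; rewrite big1// => y _; rewrite rn0 expr0n. Qed.

Lemma sqsumN (x : ell2) : sqsum (fun y => - x y).
Proof. by have [M h] := ell2P x; exists M => F; under eq_bigr do rewrite rnN. Qed.

Lemma sqsumD (x y : ell2) : sqsum (fun i => x i + y i).
Proof.
have [M hM] := ell2P x; have [N hN] := ell2P y; exists (2 * M + 2 * N) => F.
apply: (@le_trans _ _ (\sum_(i <- F) (2 * rn (x i) ^+ 2 + 2 * rn (y i) ^+ 2))).
  apply: ler_sum => i _.
  exact: sqr_le_double (rn_ge0 _) (rnD _ _).
rewrite big_split/= -!mulr_sumr.
by have := hM F; have := hN F; lra.
Qed.

Lemma sqsumZ c (x : ell2) : sqsum (fun i => c * x i).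
Proof.
have [M hM] := ell2P x; exists (rn c ^+ 2 * M) => F.
under eq_bigr do rewrite rnMc exprMn.
by rewrite -mulr_sumr ler_wpM2l// sqr_ge0.
Qed.

Let zero := Ell2 sqsum0.
Let opp x := Ell2 (sqsumN x).
Let add x y := Ell2 (sqsumD x y).
Let scale c x := Ell2 (sqsumZ c x).

Let addA : associative add.
Proof. by move=> x y z; apply: ell2_eq => i /=; rewrite addrA. Qed.
Let addC : commutative add.
Proof. by move=> x y; apply: ell2_eq => i /=; rewrite addrC. Qed.
Let add0 : left_id zero add.
Proof. by move=> x; apply: ell2_eq => i /=; rewrite add0r. Qed.
Let addN : left_inverse zero opp add.
Proof. by move=> x; apply: ell2_eq => i /=; rewrite addNr. Qed.

HB.instance Definition _ := GRing.isZmodule.Build ell2 addA addC add0 addN.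

Let scaleA a b v : scale a (scale b v) = scale (a * b) v.
Proof. by apply: ell2_eq => i /=; rewrite mulrA. Qed.
Let scale1 : left_id 1 scale.
Proof. by move=> v; apply: ell2_eq => i /=; rewrite mul1r. Qed.
Let scaleDr : right_distributive scale +%R.
Proof. by move=> c x y; apply: ell2_eq => i /=; rewrite mulrDr. Qed.
Let scaleDl v : {morph scale^~ v : a b / a + b}.
Proof. by move=> a b; apply: ell2_eq => i /=; rewrite mulrDl. Qed.

HB.instance Definition _ :=
  GRing.Zmodule_isLmodule.Build R[i] ell2 scaleA scale1 scaleDr scaleDl.

Implicit Types (x y z : ell2) (F : {fset Y}).

Lemma ell2D x y i : (x + y) i = x i + y i. Proof. by []. Qed.
Lemma ell2N x i : (- x) i = - x i. Proof. by []. Qed.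
Lemma ell2B x y i : (x - y) i = x i - y i. Proof. by []. Qed.
Lemma ell2Z c x i : (c *: x) i = c * x i. Proof. by []. Qed.
Lemma ip_ex x y : exists l, has_sum (fun i => x i * (y i)^*%C) l.
Proof.
have [M hM] := ell2P x; have [N hN] := ell2P y.
apply: (has_sum_abs (M := M + N)) => F; apply: le_trans (lerD (hM F) (hN F)).
rewrite -big_split/=; apply: ler_sum => i _; rewrite rnMc rn_conj.
by have := sqr_ge0 (rn (x i) - rn (y i)); have := sqr_ge0 (rn (x i));
  have := sqr_ge0 (rn (y i)); nra.
Qed.

Definition ip x y : R[i] := sval (cid (ip_ex x y)).

Lemma ipP x y : has_sum (fun i => x i * (y i)^*%C) (ip x y).
Proof. exact: svalP (cid (ip_ex x y)). Qed.

Lemma ip_uniq x y l : has_sum (fun i => x i * (y i)^*%C) l -> ip x y = l.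
Proof. exact/has_sum_unique/ipP. Qed.

Lemma ipDl x y z : ip (x + y) z = ip x z + ip y z.
Proof.
apply: ip_uniq; apply: has_sum_ext (has_sumD (ipP x z) (ipP y z)) => i.
by rewrite -mulrDl.
Qed.

Lemma ipZl c x y : ip (c *: x) y = c * ip x y.
Proof.
by apply: ip_uniq; apply: has_sum_ext (has_sumZ c (ipP x y)) => i; rewrite mulrA.
Qed.

Lemma ipC x y : ip y x = (ip x y)^*%C.
Proof.
apply: ip_uniq; apply: has_sum_ext (has_sum_conj (ipP x y)) => i.
by rewrite rmorphM/= conjcK mulrC.
Qed.

Lemma ipDr x y z : ip x (y + z) = ip x y + ip x z.
Proof. by rewrite ipC ipDl rmorphD/= -!ipC. Qed.

Lemma ipZr c x y : ip x (c *: y) = c^*%C * ip x y.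
Proof. by rewrite ipC ipZl rmorphM/= -ipC. Qed.

Lemma ipNl x y : ip (- x) y = - ip x y.
Proof. by rewrite -scaleN1r ipZl mulN1r. Qed.

Lemma ipNr x y : ip x (- y) = - ip x y.
Proof. by rewrite ipC ipNl rmorphN/= -ipC. Qed.

Lemma ipBl x y z : ip (x - y) z = ip x z - ip y z.
Proof. by rewrite ipDl ipNl. Qed.

Lemma ipBr x y z : ip x (y - z) = ip x y - ip x z.
Proof. by rewrite ipDr ipNr. Qed.

Definition hn x : R := Num.sqrt (complex.Re (ip x x)).

Lemma ip_sqr x : has_sum (fun i => (rn (x i) ^+ 2)%:C) (ip x x).
Proof. by apply: has_sum_ext (ipP x x) => i; rewrite rn_sqr. Qed.

Lemma ip_sum_le x F : \sum_(i <- F) rn (x i) ^+ 2 <= complex.Re (ip x x).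
Proof. by apply: has_sum_Re_ge (ip_sqr x) => i; exact: sqr_ge0. Qed.

Lemma Re_ip_ge0 x : 0 <= complex.Re (ip x x).
Proof. by have := ip_sum_le x fset0; rewrite big_seq_fset0. Qed.

Lemma hn_ge0 x : 0 <= hn x. Proof. exact: sqrtr_ge0. Qed.

Lemma hn_sqr x : hn x ^+ 2 = complex.Re (ip x x).
Proof. by rewrite sqr_sqrtr// Re_ip_ge0. Qed.

Lemma ip_self x : ip x x = (hn x ^+ 2)%:C.
Proof. by rewrite hn_sqr; exact: has_sum_real (ip_sqr x). Qed.

Lemma hn_sum_le x F : \sum_(i <- F) rn (x i) ^+ 2 <= hn x ^+ 2.
Proof. by rewrite hn_sqr ip_sum_le. Qed.

Lemma hn_coord x i : rn (x i) <= hn x.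
Proof.
rewrite -ler_sqr ?nnegrE ?rn_ge0 ?hn_ge0//.
by apply: le_trans (hn_sum_le x [fset i]%fset); rewrite big_seq_fset1.
Qed.

Lemma hn_lub x (M : R) : 0 <= M ->
  (forall F, \sum_(i <- F) rn (x i) ^+ 2 <= M ^+ 2) -> hn x <= M.
Proof.
move=> M0 hM; rewrite -ler_sqr ?nnegrE ?hn_ge0// hn_sqr.
apply: (has_sum_Re_le (ip_sqr x)) => F.
by rewrite -rmorph_sum/=.
Qed.

Lemma hn_eq0 x : hn x = 0 -> x = 0.
Proof.
move=> x0; apply: ell2_eq => i; apply: rn_eq0; apply/eqP.
by rewrite eq_le rn_ge0 andbT -x0 hn_coord.
Qed.

Lemma hn0 : hn 0 = 0.
Proof. by rewrite /hn -(scale0r 0) ipZl mul0r sqrtr0. Qed.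

Lemma hnZ c x : hn (c *: x) = rn c * hn x.
Proof.
apply/eqP; rewrite -(eqrXn2 (n := 2))// ?mulr_ge0 ?rn_ge0 ?hn_ge0//.
apply/eqP; apply: (@complexI R).
by rewrite -ip_self ipZl ipZr mulrA -rn_sqr ip_self -rmorphM exprMn.
Qed.

Lemma hnN x : hn (- x) = hn x.
Proof.
have := hnZ (-1) x; rewrite scaleN1r rnN => ->.
by rewrite (rn_real (1 : R)) normr1 mul1r.
Qed.

Lemma cauchy_schwarz x y : rn (ip x y) <= hn x * hn y.
Proof.
have [/hn_eq0 -> | y0] := eqVneq (hn y) 0.
  by rewrite -(scale0r 0) ipZr conjc0 mul0r rn0 mulr_ge0 ?hn_ge0.
have y1 : 0 < hn y ^+ 2 by rewrite exprn_gt0// lt_def y0 hn_ge0.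
have := sqr_ge0 (hn ((hn y ^+ 2)%:C *: x - ip x y *: y)).
rewrite -ler0c -(ip_self (_ - _)) ipBl !ipBr !(ipZl, ipZr) (ipC x y) !ip_self
  conjc_real.
set a := hn x ^+ 2; set b := hn y ^+ 2 in y1 *.
have -> : b%:C * (b%:C * a%:C) - b%:C * ((ip x y)^*%C * ip x y) -
  (ip x y * (b%:C * (ip x y)^*%C) - ip x y * ((ip x y)^*%C * b%:C)) =
  (b * (b * a - rn (ip x y) ^+ 2))%:C.
  by clearbody a b; rewrite rmorphM/= rmorphB/= rmorphM/= rn_sqr; ring.
rewrite ler0c pmulr_rge0// subr_ge0 => le.
rewrite -ler_sqr ?nnegrE ?mulr_ge0 ?rn_ge0 ?hn_ge0//.
by rewrite exprMn -/a -/b mulrC.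
Qed.

Lemma hnD x y : hn (x + y) <= hn x + hn y.
Proof.
rewrite -ler_sqr ?nnegrE ?addr_ge0 ?hn_ge0// [leLHS]hn_sqr ipDl !ipDr.
rewrite (ipC x y) !ip_self !raddfD/=.
have -> : complex.Re (ip x y)^*%C = complex.Re (ip x y) by case: (ip x y).
have := cauchy_schwarz x y; have := rn_Re (ip x y); rewrite ler_norml; nra.
Qed.

Lemma hnBC x y : hn (x - y) = hn (y - x).
Proof. by rewrite -hnN opprB. Qed.

Lemma ell2_lim (u : nat -> ell2) (eps : nat -> R) :
  (forall e, 0 < e -> exists n, eps n <= e) ->
  (forall n m, (n <= m)%N -> hn (u n - u m) <= eps n) ->
  exists x, forall n, hn (u n - x) <= eps n.
Proof.
move=> eps0 uC.
have ex i : exists l, forall e : R, 0 < e -> exists n, forall m, (n <= m)%N ->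
    rn (u m i - l) <= e.
  apply: complex_lim eps0 _ => n m nm; apply: le_trans (uC _ _ nm).
  by rewrite -ell2B hn_coord.
pose x i := sval (cid (ex i)).
have xP i := svalP (cid (ex i)); rewrite -/(x _) in xP.
have xF (F : {fset Y}) (e : R) : 0 < e -> exists n, forall m, (n <= m)%N ->
    forall i, i \in F -> rn (u m i - x i) <= e.
  move=> e0; elim/fset1U_rect: F => [|i F iF [n hn]]; first by exists 0%N.
  have [n' hn'] := xP i _ e0; exists (maxn n n') => m; rewrite geq_max.
  move=> /andP[/hn h /hn' h'] j; rewrite !inE => /orP[/eqP ->|]; [exact: h'|exact: h].
have eps_ge0 n : 0 <= eps n by apply: le_trans (uC _ _ (leqnn n)); rewrite hn_ge0.
have bound n F : \sum_(i <- F) rn (u n i - x i) ^+ 2 <= eps n ^+ 2.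
  pose c : R := \sum_(i <- F) 1.
  have c0 : 0 <= c by apply: sumr_ge0.
  apply/ler_addgt0Pr => e e0.
  pose d := Num.min 1 (e / (c + 2 * c * eps n + 1)).
  have den0 : 0 < c + 2 * c * eps n + 1 by have := mulr_ge0 c0 (eps_ge0 n); nra.
  have d0 : 0 < d by rewrite lt_min ltr01/= divr_gt0.
  have d1 : d <= 1 by rewrite ge_min lexx.
  have de : d * (c + 2 * c * eps n + 1) <= e by rewrite -ler_pdivlMr// ge_min lexx orbT.
  have [n1 h1] := xF F _ d0.
  have := h1 (maxn n n1) (leq_maxr _ _); set m := maxn n n1 => h2.
  have unm := uC n m (leq_maxl _ _).
  apply: (@le_trans _ _ (\sum_(i <- F) (rn ((u n - u m) i) ^+ 2 + (d + 2 * eps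
    n * d)))).
    rewrite big_seq [leRHS]big_seq; apply: ler_sum => i /h2 hi.
    have := rn_triangle (u n i) (u m i) (x i); rewrite -ell2B => tr.
    have := rn_ge0 (u n i - x i); have := rn_ge0 ((u n - u m) i).
    have := hn_coord (u n - u m) i; have := rn_ge0 (u m i - x i).
    move: (rn _) (rn _) (rn _) hi tr => p q r; move: unm; nra.
  rewrite big_split/= (_ : \sum_(i <- F) (d + _) = c * (d + 2 * eps n * d)); last first.
    by rewrite mulr_suml; apply: eq_bigr => i _; rewrite mul1r.
  have := hn_sum_le (u n - u m) F; have := hn_ge0 (u n - u m).
  move: (\sum_(i <- F) _) => s; move: unm; nra.
have xq : sqsum x.
  exists (2 * hn (u 0%N) ^+ 2 + 2 * eps 0%N ^+ 2) => F.
  apply: (@le_trans _ _ (\sum_(i <- F) (2 * rn (u 0%N i) ^+ 2 + 2 * rn (u 0%N i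
    - x i) ^+ 2))).
    apply: ler_sum => i _; have := rnD (u 0%N i) (x i - u 0%N i).
    rewrite addrC subrK (rnBC (x i)); exact: sqr_le_double (rn_ge0 _).
  rewrite big_split/= -!mulr_sumr.
  by have := bound 0%N F; have := hn_sum_le (u 0%N) F; lra.
exists (Ell2 xq) => n; apply: hn_lub => // F; exact: bound.
Qed.

End Ell2.

Section BoundedOperators.
Variables (R : realType) (Y : choiceType).
Notation H := (ell2 R Y).
Implicit Types (x y z : H).

Definition adjoint_pair (T S : H -> H) := forall x y, ip (T x) y = ip x (S y).

Definition bounded_by (T : H -> H) (M : R) :=
  0 <= M /\ forall x, hn (T x) <= M * hn x.

Record bop := Bop { bop_fun :> H -> H;
  bop_bounded : exists M, bounded_by bop_fun M;
  bop_adjoint : exists S, adjoint_pair bop_fun S }.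

Lemma bop_eq (S T : bop) : S =1 T -> S = T.
Proof.
case: S T => [S bS aS] [T bT aT] /= /funext ST; rewrite ST in bS aS *.
by congr Bop; exact: Prop_irrelevance.
Qed.

HB.instance Definition _ := gen_eqMixin bop.
HB.instance Definition _ := gen_choiceMixin bop.

Lemma ip_ext x y : (forall z, ip x z = ip y z) -> x = y.
Proof.
move=> xy; apply/eqP; rewrite -subr_eq0; apply/eqP/hn_eq0.
have := ip_self (x - y); rewrite [LHS]ipBl xy subrr => /esym/eqP.
by rewrite -[0]/(0%:C) (inj_eq (@complexI R)) sqrf_eq0 => /eqP.
Qed.

Lemma ip_extr x y : (forall z, ip z x = ip z y) -> x = y.
Proof. by move=> xy; apply: ip_ext => z; rewrite ipC xy -ipC. Qed.

Lemma adjoint_pair_sym T S : adjoint_pair T S -> adjoint_pair S T.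
Proof. by move=> TS x y; rewrite ipC -TS -ipC. Qed.

Lemma adjoint_pairD T S x y : adjoint_pair T S -> T (x + y) = T x + T y.
Proof. by move=> TS; apply: ip_ext => z; rewrite ipDl !TS ipDl. Qed.

Lemma adjoint_pairZ T S c x : adjoint_pair T S -> T (c *: x) = c *: T x.
Proof. by move=> TS; apply: ip_ext => z; rewrite ipZl !TS ipZl. Qed.

Lemma adjoint_bounded T S M :
  adjoint_pair T S -> bounded_by T M -> bounded_by S M.
Proof.
move=> TS [M0 TM]; split=> // x.
have [->|Sx0] := eqVneq (hn (S x)) 0; first by rewrite mulr_ge0// hn_ge0.
have Sx1 : 0 < hn (S x) by rewrite lt_def Sx0 hn_ge0.
rewrite -(ler_pM2l Sx1) -expr2 hn_sqr -TS.
apply: le_trans (le_trans (ler_norm _) (rn_Re _)) _.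
apply: le_trans (cauchy_schwarz _ _) _.
rewrite mulrCA mulrA; apply: ler_wpM2r; [exact: hn_ge0|exact: TM].
Qed.

Lemma bopD (T : bop) x y : T (x + y) = T x + T y.
Proof. by have [S TS] := bop_adjoint T; exact: adjoint_pairD TS. Qed.

Lemma bopZ (T : bop) c x : T (c *: x) = c *: T x.
Proof. by have [S TS] := bop_adjoint T; exact: adjoint_pairZ TS. Qed.

Definition bop_of T S M (TS : adjoint_pair T S) (TM : bounded_by T M) : bop :=
  Bop (ex_intro _ M TM) (ex_intro _ S TS).

Let adj (T : bop) := sval (cid (bop_adjoint T)).
Let adjP (T : bop) : adjoint_pair T (adj T) := svalP (cid (bop_adjoint T)).
Let adj_bnd (T : bop) : exists M, bounded_by (adj T) M.
Proof. by have [M TM] := bop_bounded T; exists M; exact: adjoint_bounded TM. Qed.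

Definition bop_star (T : bop) : bop :=
  Bop (adj_bnd T) (ex_intro _ _ (adjoint_pair_sym (adjP T))).

Lemma ip_bop_star (T : bop) x y : ip (T x) y = ip x (bop_star T y).
Proof. exact: adjP. Qed.

Lemma bop_star_uniq (T : bop) (S : H -> H) :
  adjoint_pair T S -> bop_star T =1 S.
Proof. by move=> TS x; apply: ip_extr => z; rewrite -ip_bop_star TS. Qed.

Lemma bounded_by_comp S T M N : bounded_by S M -> bounded_by T N ->
  bounded_by (S \o T) (M * N).
Proof.
move=> [M0 hS] [N0 hT]; split=> [|x /=]; first exact: mulr_ge0.
by apply: le_trans (hS _) _; rewrite -mulrA ler_wpM2l.
Qed.

Lemma adjoint_pair_comp S S' T T' : adjoint_pair S S' -> adjoint_pair T T' ->
  adjoint_pair (S \o T) (T' \o S').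
Proof. by move=> hS hT x y /=; rewrite hS hT. Qed.

Definition bop_mul (S T : bop) : bop.
Proof.
exists (S \o T).
- have [M hM] := bop_bounded S; have [N hN] := bop_bounded T.
  by exists (M * N); exact: bounded_by_comp.
- by exists (bop_star T \o bop_star S); apply: adjoint_pair_comp => x y;
    exact: ip_bop_star.
Defined.

Let zero : bop.
Proof.
exists (fun=> 0); first by exists 0; split=> // x; rewrite hn0 mul0r.
by exists (fun=> 0) => x y; rewrite -(scale0r 0) ipZl ipZr conjc0 !mul0r.
Defined.

Let opp (T : bop) : bop.
Proof.
exists (fun x => - T x).
  by have [M [M0 hM]] := bop_bounded T; exists M; split=> // x; rewrite hnN.
by exists (fun x => - bop_star T x) => x y; rewrite ipNl ipNr ip_bop_star.
Defined.

Let add (S T : bop) : bop.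
Proof.
exists (fun x => S x + T x).
  have [M [M0 hM]] := bop_bounded S; have [N [N0 hN]] := bop_bounded T.
  exists (M + N); split=> [|x]; first exact: addr_ge0.
  by rewrite mulrDl; apply: le_trans (hnD _ _) _; exact: lerD.
by exists (fun x => bop_star S x + bop_star T x) => x y; rewrite ipDl ipDr !ip_bop_star.
Defined.

Let scale (c : R[i]) (T : bop) : bop.
Proof.
exists (fun x => c *: T x).
  have [M [M0 hM]] := bop_bounded T; exists (rn c * M); split=> [|x].
    by rewrite mulr_ge0// rn_ge0.
  by rewrite hnZ -mulrA ler_wpM2l ?rn_ge0.
by exists (fun x => c^*%C *: bop_star T x) => x y; rewrite ipZl ipZr conjcK ip_bop_star.
Defined.

Let addA : associative add.
Proof. by move=> x y z; apply: bop_eq => i /=; rewrite addrA. Qed.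
Let addC : commutative add.
Proof. by move=> x y; apply: bop_eq => i /=; rewrite addrC. Qed.
Let add0 : left_id zero add.
Proof. by move=> x; apply: bop_eq => i /=; rewrite add0r. Qed.
Let addN : left_inverse zero opp add.
Proof. by move=> x; apply: bop_eq => i /=; rewrite addNr. Qed.

HB.instance Definition _ := GRing.isZmodule.Build bop addA addC add0 addN.

Let scaleA a b v : scale a (scale b v) = scale (a * b) v.
Proof. by apply: bop_eq => i /=; rewrite scalerA. Qed.
Let scale1 : left_id 1 scale.
Proof. by move=> v; apply: bop_eq => i /=; rewrite scale1r. Qed.
Let scaleDr : right_distributive scale +%R.
Proof. by move=> c x y; apply: bop_eq => i /=; rewrite scalerDr. Qed.
Let scaleDl v : {morph scale^~ v : a b / a + b}.
Proof. by move=> a b; apply: bop_eq => i /=; rewrite scalerDl. Qed.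

HB.instance Definition _ :=
  GRing.Zmodule_isLmodule.Build R[i] bop scaleA scale1 scaleDr scaleDl.

Implicit Types S T U : bop.

Lemma bop_addE S T x : (S + T) x = S x + T x. Proof. by []. Qed.
Lemma bop_oppE T x : (- T) x = - T x. Proof. by []. Qed.
Lemma bop_scaleE c T x : (c *: T) x = c *: T x. Proof. by []. Qed.
Lemma bop_zeroE x : (0 : bop) x = 0. Proof. by []. Qed.

Definition opn T : R := inf [set M | bounded_by T M].

Lemma opn_lub T M : bounded_by T M -> opn T <= M.
Proof. by move=> TM; apply: ge_inf => //; exists 0 => N []. Qed.

Lemma opn_bound T : bounded_by T (opn T).
Proof.
have T0 : [set M | bounded_by T M] !=set0 by exact: bop_bounded.
split=> [|x]; first by apply: lb_le_inf => // N [].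
have [x0|x0] := eqVneq (hn x) 0.
  have [M [_ /(_ x)]] := bop_bounded T.
  by rewrite x0 !mulr0.
have x1 : 0 < hn x by rewrite lt_def x0 hn_ge0.
rewrite -ler_pdivrMr//; apply: lb_le_inf => // M [_ TM].
by rewrite ler_pdivrMr.
Qed.

Lemma opn_ge0 T : 0 <= opn T. Proof. by have [] := opn_bound T. Qed.

Lemma opnP T x : hn (T x) <= opn T * hn x. Proof. by have [_] := opn_bound T. Qed.

Lemma opnD S T : opn (S + T) <= opn S + opn T.
Proof.
apply: opn_lub; split=> [|x]; first by rewrite addr_ge0// opn_ge0.
by rewrite mulrDl; apply: le_trans (hnD _ _) _; apply: lerD; exact: opnP.
Qed.

Lemma opnZ_le c T : opn (c *: T) <= rn c * opn T.
Proof.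
apply: opn_lub; split=> [|x]; first by rewrite mulr_ge0 ?rn_ge0 ?opn_ge0.
by rewrite bop_scaleE hnZ -mulrA ler_wpM2l ?rn_ge0 ?opnP.
Qed.

Lemma opn_eq0 T : opn T = 0 -> T = 0.
Proof.
move=> T0; apply: bop_eq => x; apply: hn_eq0; apply/eqP.
by rewrite eq_le hn_ge0 andbT; have := opnP T x; rewrite T0 mul0r.
Qed.

Lemma opnZ c T : opn (c *: T) = rn c * opn T.
Proof.
apply/eqP; rewrite eq_le opnZ_le/=.
have [->|c0] := eqVneq c 0; first by rewrite rn0 mul0r opn_ge0.
have rc0 : 0 < rn c by rewrite lt_def rn_ge0 andbT; apply: contra_neq c0 => /rn_eq0.
rewrite -ler_pdivlMl//.
have := opnZ_le c^-1 (c *: T); rewrite scalerA mulVf// scale1r.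
suff -> : rn c^-1 = (rn c)^-1 by [].
apply: (mulfI (lt0r_neq0 rc0)); rewrite -rnMc mulfV// mulfV ?lt0r_neq0//.
by rewrite (rn_real (1 : R)) normr1.
Qed.

Lemma opn_star T : opn (bop_star T) = opn T.
Proof.
apply/eqP; rewrite eq_le !opn_lub//.
- by apply: adjoint_bounded (opn_bound (bop_star T)); apply: adjoint_pair_sym;
  exact: ip_bop_star.
- by apply: adjoint_bounded (opn_bound T); exact: ip_bop_star.
Qed.

Lemma opn_mul S T : opn (bop_mul S T) <= opn S * opn T.
Proof. by apply: opn_lub; apply: bounded_by_comp; exact: opn_bound. Qed.

Lemma opn_cstar T : opn (bop_mul (bop_star T) T) = opn T ^+ 2.
Proof.
apply/eqP; rewrite eq_le; apply/andP; split.
  by apply: le_trans (opn_mul _ _) _; rewrite opn_star.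
set U := bop_mul _ _; have U0 := opn_ge0 U.
suff : opn T <= Num.sqrt (opn U).
  by rewrite -ler_sqr ?nnegrE ?sqrtr_ge0 ?opn_ge0// sqr_sqrtr.
apply: opn_lub; split=> [|x]; first exact: sqrtr_ge0.
rewrite -ler_sqr ?nnegrE ?mulr_ge0 ?hn_ge0 ?sqrtr_ge0// exprMn (sqr_sqrtr U0).
rewrite [leLHS]hn_sqr ip_bop_star ipC.
apply: le_trans (le_trans (ler_norm _) (rn_Re _)) _; rewrite rn_conj.
apply: le_trans (cauchy_schwarz _ _) _; rewrite [hn x ^+ 2]expr2 mulrA.
by apply: ler_wpM2r; [exact: hn_ge0|exact: (opnP U)].
Qed.

Lemma bop_starK : involutive bop_star.
Proof.
move=> T; apply: bop_eq; apply: bop_star_uniq.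
by apply: adjoint_pair_sym => x y; exact: ip_bop_star.
Qed.

Lemma bop_starD : {morph bop_star : S T / S + T}.
Proof.
by move=> S T; apply: bop_eq; apply: bop_star_uniq => x y;
  rewrite ipDl ipDr !ip_bop_star.
Qed.

Lemma bop_starZ c T : bop_star (c *: T) = c^*%C *: bop_star T.
Proof.
by apply: bop_eq; apply: bop_star_uniq => x y; rewrite ipZl ipZr conjcK !ip_bop_star.
Qed.

Lemma bop_starM S T : bop_star (bop_mul S T) = bop_mul (bop_star T) (bop_star S).
Proof.
by apply: bop_eq; apply: bop_star_uniq; apply: adjoint_pair_comp => x y;
  exact: ip_bop_star.
Qed.

Lemma bop_lim (u : nat -> bop) (eps : nat -> R) :
  (forall e, 0 < e -> exists n, eps n <= e) ->
  (forall n m, (n <= m)%N -> opn (u n - u m) <= eps n) ->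
  exists T, forall n, opn (u n - T) <= eps n.
Proof.
move=> eps0 uC.
have eps_ge0 n : 0 <= eps n by apply: le_trans (uC _ _ (leqnn n)); rewrite opn_ge0.
have lim (v : nat -> bop) : (forall n m, (n <= m)%N -> opn (v n - v m) <= eps n) ->
    exists T : H -> H, forall x n, hn (v n x - T x) <= eps n * hn x.
  move=> vC; suff ex x : exists y, forall n, hn (v n x - y) <= eps n * hn x.
    by exists (fun x => sval (cid (ex x))) => x; exact: svalP (cid (ex x)).
  apply: (ell2_lim (u := fun n => v n x)) => [e e0|n m nm].
    have x0 := hn_ge0 x.
    have [n hn] := eps0 (e / (hn x + 1)) ltac:(by rewrite divr_gt0//; lra).
    exists n; apply: le_trans (ler_wpM2r x0 hn) _.
    by rewrite mulrAC ler_pdivrMr; nra.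
  by apply: le_trans (opnP (v n - v m) x) _; rewrite ler_wpM2r ?hn_ge0 ?vC.
have [T hT] := lim u uC.
have [n m /uC|S hS] := lim (fun n => bop_star (u n)).
  by rewrite -opn_star bop_starD -scaleN1r bop_starZ rmorphN1 scaleN1r.
have TS : adjoint_pair T S.
  move=> x y; apply/eqP; rewrite -subr_eq0; apply/eqP/rn_small => e e0.
  have xy0 : 0 <= hn x * hn y by rewrite mulr_ge0 ?hn_ge0.
  have [n hne] := eps0 (e / (2 * (hn x * hn y) + 1)) ltac:(by rewrite divr_gt0//; lra).
  have -> : ip (T x) y - ip x (S y) =
      - ip (u n x - T x) y + ip x (bop_star (u n) y - S y).
    by rewrite ipBl ipBr ip_bop_star; ring.
  apply: le_trans (rnD _ _) _; rewrite rnN.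
  apply: le_trans (lerD (cauchy_schwarz _ _) (cauchy_schwarz _ _)) _.
  have h1 := ler_wpM2r (hn_ge0 y) (hT x n).
  have h2 := ler_wpM2l (hn_ge0 x) (hS y n).
  have : eps n * (2 * (hn x * hn y) + 1) <= e by rewrite -ler_pdivlMr//; lra.
  by have := eps_ge0 n; nra.
have TM : bounded_by T (opn (u 0%N) + eps 0%N).
  split=> [|x]; first by rewrite addr_ge0// opn_ge0.
  rewrite mulrDl; apply: le_trans (lerD (opnP (u 0%N) x) (hT x 0%N)).
  by rewrite hnBC; have := hnD (u 0%N x) (T x - u 0%N x); rewrite addrC subrK.
exists (bop_of TS TM) => n; apply: opn_lub; split=> // x; exact: hT.
Qed.

Let norm T : R[i] := (opn T)%:C.

Let normD S T : norm (S + T) <= norm S + norm T.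
Proof. by rewrite /norm -rmorphD/= lecR opnD. Qed.

Let normZ c T : norm (c *: T) = `|c| * norm T.
Proof. by rewrite /norm opnZ rmorphM/= -rnE. Qed.

Let norm_eq0 T : norm T = 0 -> T = 0.
Proof. by move=> /complexI /opn_eq0. Qed.

HB.instance Definition _ := Lmodule_isNormed.Build R[i] bop normD normZ norm_eq0.

Lemma rn_bop T : rn T = opn T.
Proof. by []. Qed.

Let bop_complete (F : set_system bop) : ProperFilter F -> cauchy F -> cvg F.
Proof.
apply: lim_cauchy_cvg => u uC; apply: bop_lim => // e e0.
have [n hn] := half_expn_small (e := e / 2) ltac:(by rewrite divr_gt0).
by exists n; lra.
Qed.

HB.instance Definition _ := Uniform_isComplete.Build bop bop_complete.

Let mulA : associative bop_mul.
Proof. by move=> S T U; exact: bop_eq. Qed.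
Let mulDl : left_distributive bop_mul +%R.
Proof. by move=> S T U; exact: bop_eq. Qed.
Let mulDr : right_distributive bop_mul +%R.
Proof. by move=> S T U; apply: bop_eq => x /=; rewrite bopD. Qed.
Let mulZl c S T : bop_mul (c *: S) T = c *: bop_mul S T.
Proof. exact: bop_eq. Qed.
Let mulZr c S T : bop_mul S (c *: T) = c *: bop_mul S T.
Proof. by apply: bop_eq => x /=; rewrite bopZ. Qed.
Let norm_mul S T : `|bop_mul S T| <= `|S| * `|T|.
Proof. by rewrite !rnE !rn_bop -rmorphM/= lecR opn_mul. Qed.
Let norm_star T : `|bop_mul (bop_star T) T| = `|T| ^+ 2.
Proof. by rewrite !rnE !rn_bop opn_cstar rmorphXn. Qed.

HB.instance Definition _ := CompleteNormedModule_isCStarAlgebra.Build R bop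
  mulA mulDl mulDr mulZl mulZr bop_starK bop_starD bop_starZ bop_starM
  norm_mul norm_star.

Lemma bop_mulE S T x : (S ** T) x = S (T x). Proof. by []. Qed.

Lemma bop_sumE (I : Type) (r : seq I) (P : pred I) (F : I -> bop) x :
  (\sum_(i <- r | P i) F i) x = \sum_(i <- r | P i) F i x.
Proof. by elim/big_rec2: _ => // i y z _ <-. Qed.

End BoundedOperators.

(** * The path-filter representation *)

Section PathFilters.
Variables (k : nat) (L : kgraph k).
Hypothesis fa : finitely_aligned L.
Implicit Types (l m n a b : L) (x : set L).

Lemma prefix_refl l : prefix_of l l.
Proof. by exists (idp (src l)); rewrite rng_idp pcomp_idr. Qed.

Lemma prefix_trans l m n : prefix_of l m -> prefix_of m n -> prefix_of l n.
Proof.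
move=> [a [la ->]] [b [mb ->]]; exists (pcomp a b).
by rewrite src_comp// in mb; rewrite rng_comp// pcompA.
Qed.

Lemma prefix_rng l m : prefix_of l m -> rng m = rng l.
Proof. by move=> [a [la ->]]; rewrite rng_comp. Qed.

Lemma prefix_pcomp l a : src l = rng a -> prefix_of l (pcomp l a).
Proof. by exists a. Qed.

Lemma prefix_idp l : prefix_of (idp (rng l)) l.
Proof. by exists l; rewrite src_idp pcomp_idl. Qed.

Lemma prefix_pcomp2 l m n : src l = rng m ->
  prefix_of m n -> prefix_of (pcomp l m) (pcomp l n).
Proof.
by move=> lm [a [ma ->]]; exists a; rewrite src_comp// pcompA.
Qed.

Lemma prefix_pcompI l m n : src l = rng m -> src l = rng n ->
  prefix_of (pcomp l m) (pcomp l n) -> prefix_of m n.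
Proof.
move=> lm ln [a []]; rewrite src_comp// => ma; rewrite -pcompA// => e.
by exists a; split=> //; apply: (pcompI ln _ e); rewrite rng_comp.
Qed.

Definition compat l m := exists n, prefix_of l n /\ prefix_of m n.

Lemma compat_Lmin l m : compat l m <-> Lmin l m !=set0.
Proof.
split=> [[n [[a [la ->]] [b [mb e]]]]|[[a b] [/= la mb e _]]].
  by have [a' [b' [d [ab _ _ _ _]]]] := Lmin_factor la mb e; exists (a', b').
by exists (pcomp l a); split; [exists a|exists b].
Qed.

Lemma compat_prefix l l' m : prefix_of l l' -> compat l' m -> compat l m.
Proof. by move=> ll' [n [l'n mn]]; exists n; split=> //; exact: prefix_trans l'n. Qed.

Record ultra x : Prop := Ultra {
  ultra_nonempty : x !=set0;
  ultra_prefix : forall l m, prefix_of l m -> x m -> x l;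
  ultra_directed : forall l m, x l -> x m ->
    exists2 n, x n & prefix_of l n /\ prefix_of m n;
  ultra_max : forall m, ~ x m -> exists2 l, x l & ~ compat l m }.

Definition prepend l x : set L :=
  [set m | exists2 n, x n & src l = rng n /\ prefix_of m (pcomp l n)].

Definition shift l x : set L := [set n | src l = rng n /\ x (pcomp l n)].

Section Ultra.
Variable x : set L.
Hypothesis ux : ultra x.

Lemma ultra_idp l : x l -> x (idp (rng l)).
Proof. exact: ultra_prefix (prefix_idp l). Qed.

Lemma ultra_rng l m : x l -> x m -> rng l = rng m.
Proof.
by move=> xl xm; have [n _ [/prefix_rng <- /prefix_rng <-]] := ultra_directed ux xl xm.
Qed.

Lemma ultra_idp_rng v l : x (idp v) -> x l -> v = rng l.
Proof. by move=> xv /(ultra_rng xv); rewrite rng_idp. Qed.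

Lemma ultra_deg_inj l m : x l -> x m -> deg l = deg m -> l = m.
Proof.
move=> xl xm lm; have [n _ [[a [la ->]] [b [mb e]]]] := ultra_directed ux xl xm.
by have [] := pcomp_inj la mb lm e.
Qed.

Lemma ultra_finite (T : choiceType) (D : {fset T}) (P : T -> L -> Prop) :
  (forall q l m, prefix_of l m -> P q l -> P q m) ->
  (forall q, q \in D -> exists2 l, x l & P q l) ->
  exists2 l, x l & forall q, q \in D -> P q l.
Proof.
move=> Pmono; elim/fset1U_rect: D => [|q D qD IH] hD.
  by have [l xl] := ultra_nonempty ux; exists l.
have [l xl Pl] := IH (fun q' h => hD q' (fset1Ur _ h)).
have [m xm Pm] := hD q (fset1U1 _ _).
have [n xn [ln mn]] := ultra_directed ux xl xm.
exists n => // q'; rewrite !inE => /orP[/eqP ->|/Pl]; first exact: Pmono Pm.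
exact: Pmono.
Qed.

Lemma prepend_ultra l : x (idp (src l)) -> ultra (prepend l x).
Proof.
move=> xl; have root n : x n -> src l = rng n := ultra_idp_rng xl.
have in_pre n : x n -> prepend l x (pcomp l n).
  by move=> xn; exists n => //; split; [exact: root|exact: prefix_refl].
split.
- by exists l; exists (idp (src l)) => //; rewrite rng_idp pcomp_idr;
  split=> //; exact: prefix_refl.
- by move=> m m' mm' [n xn [ln m'n]]; exists n => //; split=> //;
  exact: prefix_trans m'n.
- move=> m m' [n xn [ln mn]] [n' xn' [ln' mn']].
  have [w xw [nw n'w]] := ultra_directed ux xn xn'.
  exists (pcomp l w); first exact: in_pre.
  by split; [apply: prefix_trans mn _|apply: prefix_trans mn' _]; exact: prefix_pcomp2.
- move=> m mN.
  have [w xw hw] : exists2 w, x w &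
      forall q, q \in fset_set (Lmin l m) -> ~ compat w q.1.
    apply: ultra_finite => [q w w' ww' h h'|[a b]].
      by apply: h; exact: compat_prefix h'.
    rewrite in_fset_set// inE => -[/= la mb e _].
    apply: (ultra_max ux) => xa; apply: mN; exists a => //; split=> //.
    by rewrite e; exists b.
  exists (pcomp l w); first exact: in_pre.
  have lw := root _ xw.
  move=> [n [[c []]]]; rewrite src_comp// => wc nE [d [md]]; rewrite nE -pcompA// => e.
  have lwc : src l = rng (pcomp w c) by rewrite rng_comp.
  have [a [b [g [ab ag bg wE dE]]]] := Lmin_factor lwc md e.
  apply: (hw (a, b)); first by rewrite in_fset_set// inE.
  by exists (pcomp w c); split; [exists c|exists g].
Qed.

Lemma shift_ultra l : x l -> ultra (shift l x).
Proof.
move=> xl; have sl : shift l x (idp (src l)).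
  by split; rewrite ?rng_idp// pcomp_idr.
split.
- by exists (idp (src l)).
- move=> m n mn [ln xn]; have lm : src l = rng m by rewrite -(prefix_rng mn).
  by split=> //; apply: ultra_prefix xn => //; exact: prefix_pcomp2.
- move=> m n [lm xm] [ln xn]; have [w xw [mw nw]] := ultra_directed ux xm xn.
  have [c []] := mw; rewrite src_comp// => mc; rewrite -pcompA// => wE.
  have lmc : src l = rng (pcomp m c) by rewrite rng_comp.
  exists (pcomp m c); first by split=> //; rewrite -wE.
  by split; [exact: prefix_pcomp|apply: (prefix_pcompI ln lmc); rewrite -wE].
- move=> m mN; have [lm|lm] := pselect (src l = rng m); last first.
    exists (idp (src l)) => // -[n [/prefix_rng + /prefix_rng]].
    by rewrite rng_idp => -> h; apply: lm.
  have [w xw wm] : exists2 w, x w & ~ compat w (pcomp l m).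
    by apply: (ultra_max ux) => xlm; apply: mN.
  have [u xu [wu [c [lc uE]]]] := ultra_directed ux xw xl.
  exists c; first by split=> //; rewrite -uE.
  move=> [n [cn mn]]; apply: wm; exists (pcomp l n); split.
    by apply: prefix_trans wu _; rewrite uE; exact: prefix_pcomp2.
  exact: prefix_pcomp2.
Qed.

Lemma shift_prepend l : x (idp (src l)) -> shift l (prepend l x) = x.
Proof.
move=> xl; apply/seteqP; split=> [n [ln [n' xn' [ln' h]]]|n xn].
  by apply: ultra_prefix xn' => //; exact: prefix_pcompI h.
have ln := ultra_idp_rng xl xn.
by split=> //; exists n => //; split=> //; exact: prefix_refl.
Qed.

Lemma prepend_shift l : x l -> prepend l (shift l x) = x.
Proof.
move=> xl; apply/seteqP; split=> [m [n [ln xln] [_ h]]|m xm].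
  exact: ultra_prefix h xln.
have [w xw [mw [c [lc wE]]]] := ultra_directed ux xm xl.
by exists c; [split=> //; rewrite -wE|split=> //; rewrite -wE].
Qed.

Lemma prepend_self l : x (idp (src l)) -> prepend l x l.
Proof.
move=> xl; exists (idp (src l)) => //; rewrite rng_idp pcomp_idr.
by split=> //; exact: prefix_refl.
Qed.

Lemma shift_self l : x l -> shift l x (idp (src l)).
Proof. by move=> xl; split; rewrite ?rng_idp// pcomp_idr. Qed.

Lemma shift_idp v : x (idp v) -> shift (idp v) x = x.
Proof.
move=> xv; apply/seteqP; split=> n.
  by move=> [/=]; rewrite src_idp => ->; rewrite pcomp_idl.
by move=> xn; have vn := ultra_idp_rng xv xn; split; rewrite vn ?src_idp ?pcomp_idl.
Qed.

Lemma prepend_idp v : x (idp v) -> prepend (idp v) x = x.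
Proof. by move=> xv; have := prepend_shift xv; rewrite shift_idp. Qed.

End Ultra.

Lemma prepend_pcomp l m x : src l = rng m ->
  prepend l (prepend m x) = prepend (pcomp l m) x.
Proof.
move=> lm; apply/seteqP; split=> w.
  move=> [n [n' xn' [mn' nn']] [ln wn]]; exists n' => //.
  rewrite src_comp//; split=> //; apply: prefix_trans wn _.
  by rewrite -pcompA//; exact: prefix_pcomp2.
move=> [n xn]; rewrite src_comp// => -[mn wn]; exists (pcomp m n).
  by exists n => //; split=> //; exact: prefix_refl.
by rewrite rng_comp// pcompA.
Qed.

Lemma shift_pcomp l m x : src l = rng m ->
  shift m (shift l x) = shift (pcomp l m) x.
Proof.
move=> lm; apply/seteqP; split=> n; rewrite /shift /= src_comp//.
  by move=> [mn [_]]; rewrite pcompA.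
by move=> [mn]; rewrite -pcompA// rng_comp.
Qed.

Section Existence.
Variable v : vertex L.

Let next l (n : nat) : L := if choice.unpickle n is Some m then
  (if pselect (exists q, Lmin l m q) is left h then pcomp l (sval (cid h)).1 else l)
  else l.

Let chain (n : nat) : L := nat_rect (fun=> kpath L) (idp v) (fun i l => next l i) n.

Let next_prefix l (n : nat) : prefix_of l (next l n).
Proof.
rewrite /next; case: choice.unpickle => [m|]; last exact: prefix_refl.
case: pselect => [h|_]; last exact: prefix_refl.
by case: (cid h) => -[a b] [/= la _ _ _]; exists a.
Qed.

Let chain_mono (i j : nat) : (i <= j)%N -> prefix_of (chain i) (chain j).
Proof.
move=> /subnKC <-; elim: (j - i)%N => [|n IH]; first by rewrite addn0;
  exact: prefix_refl.
by rewrite addnS; apply: prefix_trans IH _; exact: next_prefix.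
Qed.

Lemma ultra_exists : exists x, ultra x /\ x (idp v).
Proof.
exists [set l | exists n : nat, prefix_of l (chain n)]; split; last first.
  by exists 0%N; exact: prefix_refl.
split.
- by exists (idp v); exists 0%N; exact: prefix_refl.
- by move=> l m lm [n mn]; exists n; exact: prefix_trans mn.
- move=> l m [i li] [j mj]; exists (chain (maxn i j)).
    by exists (maxn i j); exact: prefix_refl.
  split; [apply: prefix_trans li _|apply: prefix_trans mj _].
    by apply: chain_mono; rewrite leq_maxl.
  by apply: chain_mono; rewrite leq_maxr.
- move=> m mN; exists (chain (choice.pickle m));
  first by exists (choice.pickle m); exact: prefix_refl.
  move=> /compat_Lmin[q hq]; apply: mN; exists (choice.pickle m).+1.
  rewrite /= /next choice.pickleK; case: pselect => [h|[]]; last by exists q.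
  by case: (cid h) => -[a b] [/= la mb e _]; rewrite e; exists b.
Qed.

End Existence.
End PathFilters.

Section WeightedPartialPermutations.
Variables (R : realType) (Y : choiceType).
Variables (g h : Y -> option Y) (w : Y -> R[i]).
Hypothesis gh : forall y z, g y = Some z <-> h z = Some y.
Hypothesis w1 : forall y, rn (w y) <= 1.
Implicit Types (F : {fset Y}) (x y z : Y).

Lemma sum_pmap (V : nmodType) (s : seq Y) (phi : Y -> V) :
  \sum_(y <- s) (if g y is Some z then phi z else 0) = \sum_(z <- pmap g s) phi z.
Proof.
elim: s => [|y s IH]; first by rewrite !big_nil.
by rewrite big_cons IH /=; case: (g y) => [z|] /=; rewrite ?big_cons ?add0r.
Qed.

Lemma pmap_partial_uniq F : uniq (pmap g F).
Proof.
apply: (@pmap_uniq _ _ g (fun z => odflt z (h z))) (fset_uniq F) => y.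
by case e: (g y) => [z|] //=; have /gh -> := e.
Qed.

Lemma sum_fset_seq (V : nmodType) (s : seq Y) (phi : Y -> V) : uniq s ->
  \sum_(z <- s) phi z = \sum_(z <- [fset z in s]%fset) phi z.
Proof.
move=> us; apply: perm_big; apply: uniq_perm => // z; by rewrite !inE.
Qed.

Definition wpop_fun (v : Y -> R[i]) y : R[i] := if g y is Some z then w y * v z else 0.

Lemma wpop_sum_le (v : ell2 R Y) F : \sum_(y <- F) rn (wpop_fun v y) ^+ 2 <= hn v ^+ 2.
Proof.
apply: (@le_trans _ _ (\sum_(y <- F) (if g y is Some z then rn (v z) ^+ 2 else 0))).
  apply: ler_sum => y _; rewrite /wpop_fun; case: (g y) => [z|];
    last by rewrite rn0 expr0n.
  rewrite rnMc exprMn ler_piMl ?sqr_ge0//.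
  by rewrite expr_le1// rn_ge0.
rewrite (sum_pmap F (fun z => rn (v z) ^+ 2)) sum_fset_seq ?pmap_partial_uniq//.
exact: hn_sum_le.
Qed.

Lemma wpop_sqsum (v : ell2 R Y) : sqsum (wpop_fun v).
Proof. by exists (hn v ^+ 2) => F; exact: wpop_sum_le. Qed.

Lemma has_sum_reindex (psi : Y -> R[i]) l :
  (forall z, h z = None -> psi z = 0) -> has_sum psi l ->
  has_sum (fun y => if g y is Some z then psi z else 0) l.
Proof.
move=> psi0 hl e /hl[F0 hF0].
exists [fset y in pmap h F0]%fset => F F1F; rewrite (sum_pmap F psi).
pose F' := ([fset z in pmap g F] `|` F0)%fset.
have -> : \sum_(z <- pmap g F) psi z = \sum_(z <- F') psi z.
  rewrite sum_fset_seq ?pmap_partial_uniq//; apply: big_fset_incl.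
    exact: fsubsetUl.
  move=> z; rewrite !inE /= => /orP[-> //|zF0]; rewrite mem_pmap => zN.
  apply: psi0; case hz : (h z) => [y|] //; case/negP: zN.
  apply/mapP; exists y; last by apply/esym/gh.
  by apply: (fsubsetP F1F); rewrite !inE mem_pmap; apply/mapP; exists z.
by apply: hF0; exact: fsubsetUr.
Qed.

End WeightedPartialPermutations.

Section Wpop.
Variables (R : realType) (Y : choiceType).
Variables (g h : Y -> option Y) (w : Y -> R[i]).
Hypothesis gh : forall y z, g y = Some z <-> h z = Some y.
Hypothesis w1 : forall y, rn (w y) <= 1.
Notation H := (ell2 R Y).

Let hg y z : h y = Some z <-> g z = Some y.
Proof. by split=> /gh. Qed.

Let w' z : R[i] := if h z is Some y then (w y)^*%C else 0.

Let w'1 z : rn (w' z) <= 1.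
Proof. by rewrite /w'; case: (h z) => [y|]; rewrite ?rn_conj// rn0. Qed.

Let T (v : H) : H := Ell2 (wpop_sqsum gh w1 v).
Let S (v : H) : H := Ell2 (wpop_sqsum hg w'1 v).

Let TS : adjoint_pair T S.
Proof.
move=> u v; apply: ip_uniq.
apply: has_sum_ext (has_sum_reindex gh _ (ipP u (S v))).
  move=> y /=; rewrite /wpop_fun; case e : (g y) => [z|]; last by rewrite mul0r.
  have /gh hz := e; rewrite /w' hz rmorphM/= conjcK; ring.
by move=> z hz /=; rewrite /wpop_fun hz conjc0 mulr0.
Qed.

Let T1 : bounded_by T 1.
Proof.
split=> // v; rewrite mul1r; apply: hn_lub => [|F]; first exact: hn_ge0.
exact: wpop_sum_le.
Qed.

Definition wpop : bop R Y := bop_of TS T1.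

Lemma wpopE v y : wpop v y = if g y is Some z then w y * v z else 0.
Proof. by []. Qed.

Lemma wpop_starE v z : star wpop v z = if h z is Some y then (w y)^*%C * v y else 0.
Proof.
have -> : star wpop v = S v by exact: bop_star_uniq.
by rewrite /= /wpop_fun /w'; case: (h z).
Qed.

Lemma rn_wpop_le1 : rn wpop <= 1.
Proof. by rewrite rn_bop; exact: opn_lub. Qed.

End Wpop.

Section Delta.
Variables (R : realType) (Y : choiceType).

Lemma ell2_sumE (I : Type) (r : seq I) (P : pred I) (F : I -> ell2 R Y) y :
  (\sum_(i <- r | P i) F i) y = \sum_(i <- r | P i) F i y.
Proof. by elim/big_rec2: _ => // i a b _ <-. Qed.

Lemma delta_sqsum (a : Y) : sqsum (fun y => if y == a then 1 else 0 : R[i]).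
Proof.
exists 1 => F.
have [aF|aF] := boolP (a \in F); last first.
  rewrite big_seq big1 ?ler01// => y yF; case: eqP => [ya|_];
    last by rewrite rn0 expr0n.
  by rewrite -ya yF in aF.
rewrite (big_fsetD1 a)//= eqxx big_seq big1 ?addr0.
  by rewrite (rn_real (1 : R)) normr1 expr1n.
by move=> y; rewrite !inE => /andP[/negPf -> _]; rewrite rn0 expr0n.
Qed.

Definition delta (a : Y) : ell2 R Y := Ell2 (delta_sqsum a).

Lemma deltaE a y : delta a y = if y == a then 1 else 0. Proof. by []. Qed.

End Delta.

Section Representation.
Variables (k : nat) (L : kgraph k) (R : realType).
Hypothesis fa : finitely_aligned L.
Implicit Types (l m n a b : L) (x : set L) (v : vertex L).

Notation Y := (set L * {ffun 'I_k -> int})%type.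
Notation H := (ell2 R Y).
Implicit Types (y z : Y) (xi : H).

Definition degZ l : {ffun 'I_k -> int} := [ffun i => (deg l i)%:Z].

Lemma degZ_idp v : degZ (idp v) = 0.
Proof. by apply/ffunP => i; rewrite !ffunE deg_idp ffunE. Qed.

Lemma degZ_pcomp l m : src l = rng m -> degZ (pcomp l m) = degZ l + degZ m.
Proof. by move=> lm; apply/ffunP => i; rewrite !ffunE degM// PoszD. Qed.

Definition bwd l y : option Y :=
  if `[< ultra y.1 /\ y.1 l >] then Some (shift l y.1, y.2 - degZ l) else None.

Definition fwd l y : option Y :=
  if `[< ultra y.1 /\ y.1 (idp (src l)) >]
  then Some (prepend l y.1, y.2 + degZ l) else None.

Lemma bwd_fwd l y z : bwd l y = Some z <-> fwd l z = Some y.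
Proof.
case: y z => [x d] [x' d']; rewrite /bwd /fwd /=; split.
  case: asboolP => // -[ux xl] [<- <-].
  rewrite asboolT; last by split; [exact: shift_ultra|exact: shift_self].
  by rewrite prepend_shift// subrK.
case: asboolP => // -[ux xl] [<- <-].
rewrite asboolT; last by split; [exact: prepend_ultra|exact: prepend_self].
by rewrite shift_prepend// addrK.
Qed.

Lemma rn1_le1 (y : Y) : rn (1 : R[i]) <= 1.
Proof. by rewrite (rn_real (1 : R)) normr1. Qed.

Definition rep l : bop R Y := wpop (bwd_fwd l) rn1_le1.

Lemma repE l xi x d : rep l xi (x, d) =
  if `[< ultra x /\ x l >] then xi (shift l x, d - degZ l) else 0.
Proof. by rewrite wpopE /bwd /=; case: ifP => _; rewrite ?mul1r. Qed.

Lemma rep_starE l xi x d : star (rep l) xi (x, d) =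
  if `[< ultra x /\ x (idp (src l)) >] then xi (prepend l x, d + degZ l) else 0.
Proof. by rewrite wpop_starE /fwd; case: ifP => _ //; rewrite conjc1 mul1r. Qed.

Lemma rep_vertexE v xi x d : rep (idp v) xi (x, d) =
  if `[< ultra x /\ x (idp v) >] then xi (x, d) else 0.
Proof.
rewrite repE; case: asboolP => // -[ux xv].
by rewrite shift_idp// degZ_idp subr0.
Qed.

Lemma rep_rangeE l xi x d : (rep l ** star (rep l)) xi (x, d) =
  if `[< ultra x /\ x l >] then xi (x, d) else 0.
Proof.
rewrite bop_mulE repE; case: asboolP => // -[ux xl]; rewrite rep_starE.
rewrite asboolT; last by split; [exact: shift_ultra|exact: shift_self].
by rewrite prepend_shift// subrK.
Qed.

Lemma bop_ext (S T : bop R Y) :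
  (forall xi x d, S xi (x, d) = T xi (x, d)) -> S = T.
Proof. by move=> ST; apply: bop_eq => xi; apply: ell2_eq => -[x d]; exact: ST. Qed.

Lemma rep_partial_isometry l : rep l ** star (rep l) ** rep l = rep l.
Proof.
apply: bop_ext => xi x d; rewrite -[LHS]/((rep l ** star (rep l)) (rep l xi) (x, d)).
by rewrite rep_rangeE; case: asboolP => // N; rewrite repE asboolF.
Qed.

Lemma rep_proj_idem v : rep (idp v) ** rep (idp v) = rep (idp v).
Proof.
apply: bop_ext => xi x d; rewrite bop_mulE rep_vertexE.
by case: asboolP => // N; rewrite rep_vertexE asboolF.
Qed.

Lemma rep_proj_star v : star (rep (idp v)) = rep (idp v).
Proof.
apply: bop_ext => xi x d; rewrite rep_starE rep_vertexE src_idp.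
by case: asboolP => // -[ux xv]; rewrite prepend_idp// degZ_idp addr0.
Qed.

Lemma rep_proj_orth v w : v != w -> rep (idp v) ** rep (idp w) = 0.
Proof.
move=> vw; apply: bop_ext => xi x d; rewrite bop_mulE !rep_vertexE.
case: asboolP => // -[ux xv]; case: asboolP => // -[_ xw].
by have := ultra_idp_rng ux xv xw; rewrite rng_idp => e; rewrite e eqxx in vw.
Qed.

Lemma rep_comp l m : src l = rng m -> rep l ** rep m = rep (pcomp l m).
Proof.
move=> lm; apply: bop_ext => xi x d; rewrite bop_mulE !repE.
case: asboolP => [[ux xl]|N]; last first.
  rewrite asboolF// => -[ux xlm]; apply: N; split=> //.
  by apply: (ultra_prefix ux) xlm; exact: prefix_pcomp.
have us := shift_ultra ux xl.
case: asboolP => [[_ [_ xlm]]|N].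
  by rewrite asboolT// shift_pcomp// degZ_pcomp// opprD addrA.
by rewrite asboolF// => -[_ xlm]; apply: N.
Qed.

Lemma rep_min l m : star (rep l) ** rep m =
  \sum_(p \in Lmin l m) (rep p.1 ** star (rep p.2)).
Proof.
rewrite fsbig_finite; last exact: fa.
apply: bop_ext => xi x d; rewrite bop_sumE ell2_sumE bop_mulE rep_starE.
have termE p : p \in fset_set (Lmin l m) ->
    (rep p.1 ** star (rep p.2)) xi (x, d) =
    if `[< ultra x /\ x p.1 >] then
      xi (prepend p.2 (shift p.1 x), d - degZ p.1 + degZ p.2) else 0.
  rewrite in_fset_set// inE; case: p => a b [la mb e _]; rewrite /= in la mb e.
  rewrite bop_mulE repE; case: asboolP => // -[ux xa].
  rewrite rep_starE asboolT//; split; first exact: shift_ultra.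
  have -> : src b = src a by have := congr1 (@src _ _) e; rewrite !src_comp.
  exact: shift_self.
case: asboolP => [[ux xl]|N]; last first.
  rewrite big_seq big1// => -[a b] pD; rewrite termE//=.
  move: pD; rewrite in_fset_set// inE => -[/= la _ _ _].
  rewrite asboolF// => -[ux xa]; apply: N; split=> //.
  by rewrite la; exact: (ultra_idp ux xa).
rewrite repE; case: asboolP => [[up [n xn [ln [a [ma e]]]]]|N]; last first.
  rewrite big_seq big1// => -[a b] pD; rewrite termE//=.
  move: pD; rewrite in_fset_set// inE => -[/= la mb e _].
  rewrite asboolF// => -[_ xa]; apply: N; split; first exact: prepend_ultra.
  by exists a => //; split=> //; rewrite e; exact: prefix_pcomp.
have [al [be [c [ab alc bec nE aE]]]] := Lmin_factor ln ma e.
have [/= lal mbe abE _] := ab.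
have xal : x al by apply: (ultra_prefix ux) xn; rewrite nE; exact: prefix_pcomp.
have abD : (al, be) \in fset_set (Lmin l m) by rewrite in_fset_set// inE.
have -> : \sum_(p <- fset_set (Lmin l m)) (rep p.1 ** star (rep p.2)) xi (x, d) =
    xi (prepend be (shift al x), d - degZ al + degZ be).
  rewrite (big_fsetD1 _ abD) big_seq big1; first by rewrite termE//= addr0 asboolT.
  move=> [a' b'] /fsetD1P[neq pD]; rewrite termE//=.
  move: pD; rewrite in_fset_set// inE => ab'.
  rewrite asboolF// => -[_ xa'].
  have aa : a' = al.
    apply: (ultra_deg_inj ux xa' xal); apply/ffunP => i.
    by have := Lmin_deg i ab; have := Lmin_deg i ab' => <- /addnI.
  rewrite aa in ab' neq; have bb := Lmin_fun ab' ab.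
  by rewrite bb eqxx in neq.
have us := shift_ultra ux xal.
have sab : src be = src al by have := congr1 (@src _ _) abE; rewrite !src_comp.
have sbe : shift al x (idp (src be)) by rewrite sab; exact: shift_self.
have -> : prepend l x = prepend m (prepend be (shift al x)).
  by rewrite prepend_pcomp// -abE -prepend_pcomp// prepend_shift.
rewrite shift_prepend; first last.
- by rewrite mbe; apply: (ultra_idp (prepend_ultra fa us sbe)); exact: prepend_self.
- exact: prepend_ultra.
congr (xi (_, _)).
have := congr1 degZ abE; rewrite !degZ_pcomp// => dE.
apply/eqP; rewrite -subr_eq0; apply/eqP/ffunP => i.
by have := congr1 (fun f : {ffun 'I_k -> int} => f i) dE; rewrite !ffunE; lia.
Qed.

Lemma rep_gapE v (E : seq L) xi x d :
  (\big[cmul/rep (idp v)]_(l <- E) (rep (idp v) - rep l ** star (rep l))) xi (x, d) =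
  if `[< [/\ ultra x, x (idp v) & forall l, l \in E -> ~ x l] >] then xi (x, d) else 0.
Proof.
elim: E => [|l E IH].
  rewrite big_nil rep_vertexE; congr (if _ then _ else _).
  by apply/asboolP/asboolP => [[ux xv]|[ux xv _]].
rewrite big_cons bop_mulE bop_addE ell2D rep_vertexE bop_oppE ell2N rep_rangeE IH.
have [[ux [xv xl]]|N] := pselect (ultra x /\ x (idp v) /\ x l).
  rewrite (asboolT (conj ux xv)) (asboolT (conj ux xl)) subrr.
  rewrite asboolF// => -[_ _ /(_ l)].
  by rewrite mem_head => /(_ isT); apply.
have [Q|Q] := pselect [/\ ultra x, x (idp v) & forall l, l \in E -> ~ x l].
  have [ux xv xE] := Q; have xl : ~ x l by move=> xl; apply: N.
  have -> : `[< ultra x /\ x l >] = false by apply: asboolF; case.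
  rewrite (asboolT Q) (asboolT (conj ux xv)) subr0 asboolT//; split=> // m.
  by rewrite inE => /orP[/eqP ->|/xE].
rewrite (asboolF Q) !if_same subrr asboolF// => -[ux xv xE]; apply: Q; split=> // m mE.
by apply: xE; rewrite inE mE orbT.
Qed.

Lemma rep_prod v (E : {fset L}) : exhaustive v [set` E] ->
  \big[cmul/rep (idp v)]_(l <- E) (rep (idp v) - rep l ** star (rep l)) = 0.
Proof.
move=> [Ev Eex]; apply: bop_ext => xi x d; rewrite rep_gapE asboolF// => -[ux xv xE].
have [w xw wE] : exists2 w, x w & forall l, l \in E -> ~ compat w l.
  apply: (ultra_finite ux) => [l m n mn mN nC|l lE]; first exact/mN/(compat_prefix mn).
  exact: (ultra_max ux) (xE _ lE).
have [l lE /compat_Lmin[n [ln wn]]] := Eex w (esym (ultra_idp_rng ux xv xw)).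
by apply: (wE l lE); exists n.
Qed.

Lemma rep_ck : ck_family rep.
Proof.
split.
- exact: rep_partial_isometry.
- exact: rep_proj_idem.
- exact: rep_proj_star.
- exact: rep_proj_orth.
- exact: rep_comp.
- exact: rep_min.
- exact: rep_prod.
Qed.

Lemma rep_vertex_neq0 v : rep (idp v) != 0.
Proof.
have [x [ux xv]] := ultra_exists v; apply/eqP => r0.
have := congr1 (fun T : bop R Y => T (delta R (x, 0)) (x, 0)) r0.
rewrite rep_vertexE asboolT// deltaE eqxx bop_zeroE => /eqP.
by rewrite -[X in _ == X]/(0 : R[i]) oner_eq0.
Qed.

End Representation.

Lemma rn_triangle4 (R : realType) (V : normedZmodType R[i]) (p q p' q' : V) :
  rn (p - q) <= rn (p - p') + rn (p' - q') + rn (q - q').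
Proof.
have := rn_triangle p p' q; have := rn_triangle p' q' q.
by rewrite (rnBC q'); lra.
Qed.

Lemma cmul_sub_split (R : realType) (A : cstarAlgType R) (a b a' b' : A) :
  a ** b - a' ** b' = a ** (b - b') + (a - a') ** b'.
Proof. by rewrite cmulBr cmulBl addrA subrK. Qed.

Section Conjugation.
Variables (R : realType) (A : cstarAlgType R) (u : A).
Hypotheses (uK : forall a, star u ** (u ** a) = a)
  (uK' : forall a, u ** (star u ** a) = a) (u1 : rn u <= 1).
Implicit Types a b : A.

Definition conj_by a : A := u ** a ** star u.

Lemma conj_byD a b : conj_by (a + b) = conj_by a + conj_by b.
Proof. by rewrite /conj_by cmulDr cmulDl. Qed.

Lemma conj_byZ c a : conj_by (c *: a) = c *: conj_by a.
Proof. by rewrite /conj_by cmulZr cmulZl. Qed.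

Lemma conj_byB a b : conj_by (a - b) = conj_by a - conj_by b.
Proof. by rewrite /conj_by cmulBr cmulBl. Qed.

Lemma conj_byM a b : conj_by (a ** b) = conj_by a ** conj_by b.
Proof. by rewrite /conj_by -!cmulA uK. Qed.

Lemma conj_by_star a : conj_by (star a) = star (conj_by a).
Proof. by rewrite /conj_by !starM starK cmulA. Qed.

Lemma mul_unitaryK a : a ** star u ** u = a.
Proof. by apply: (can_inj (@starK _ A)); rewrite !starM starK uK. Qed.

Lemma conj_byK a : star u ** conj_by a ** u = a.
Proof. by rewrite /conj_by !cmulA -[star u ** u ** a]cmulA uK mul_unitaryK. Qed.

Lemma rn_conj_by a : rn (conj_by a) <= rn a.
Proof.
apply: le_trans (rnM _ _) _; rewrite rn_star.
apply: (@le_trans _ _ (rn (u ** a))); first by rewrite ler_piMr ?rn_ge0.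
by apply: le_trans (rnM _ _) _; rewrite ler_piMl ?rn_ge0.
Qed.

Lemma conj_by_gen (G : set A) : (forall a, G a -> cstar_gen G (conj_by a)) ->
  forall a, cstar_gen G a -> cstar_gen G (conj_by a).
Proof.
move=> hG; have SS := cstar_gen_subalgebra G.
apply: (cstar_gen_sub (S := [set a | cstar_gen G (conj_by a)])) => //.
split=> /=.
- have -> : conj_by 0 = 0 by rewrite /conj_by cmul0r cmul0l.
  exact: (cstar_subalgebra0 SS).
- by move=> a b ha hb; rewrite conj_byD; exact: (cstar_subalgebraD SS).
- by move=> c a ha; rewrite conj_byZ; exact: (cstar_subalgebraZ SS).
- by move=> a b ha hb; rewrite conj_byM; exact: (cstar_subalgebraM SS).
- by move=> a ha; rewrite conj_by_star; exact: (cstar_subalgebra_star SS).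
- apply: rn_closed => a ha; apply: (closed_rn (cstar_subalgebra_closed SS)) =>
  e /ha[b hb ab].
  exists (conj_by b) => //; apply: le_trans ab.
  by rewrite -conj_byB rn_conj_by.
Qed.

End Conjugation.

Section GaugeAction.
Variables (k : nat) (R : realType).
Notation Z := 'rV[R[i]^o]_k.
Notation grading := {ffun 'I_k -> int}.
Implicit Types (z w : Z) (d : grading).

(* Coordinates off the unit circle are replaced by 1, so that [zpow z] is
   unimodular for every z. *)
Definition phase (c : R[i]) : R[i] := if rn c == 1 then c else 1.

Lemma rn1 : rn (1 : R[i]) = 1.
Proof. by rewrite (rn_real (1 : R)) normr1. Qed.

Lemma rn_phase c : rn (phase c) = 1.
Proof. by rewrite /phase; case: eqP => // _; exact: rn1. Qed.

Lemma rn1_neq0 (c : R[i]) : rn c = 1 -> c != 0.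
Proof. by move=> c1; apply: contra_eqN c1 => /eqP ->; rewrite rn0 eq_sym oner_eq0. Qed.

Lemma rn1_exprz (c : R[i]) (n : int) : rn c = 1 -> rn (c ^ n) = 1.
Proof.
move=> c1; case: n => n; first by rewrite -exprnP rnXc c1 expr1n.
have e1 : rn (c ^+ n.+1) = 1 by rewrite rnXc c1 expr1n.
rewrite NegzE -exprnN; apply: (mulfI (x := 1)) => //.
by rewrite -[X in X * rn _]e1 -rnMc mulfV ?rn1_neq0// rn1 mul1r.
Qed.

Definition zpow z d : R[i] := \prod_i phase (z 0 i) ^ d i.

Lemma rn_zpow z d : rn (zpow z d) = 1.
Proof.
rewrite /zpow; elim/big_rec: _ => [|i c _ c1]; first exact: rn1.
by rewrite rnMc c1 rn1_exprz ?rn_phase// mulr1.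
Qed.

Lemma zpowD z d d' : zpow z (d + d') = zpow z d * zpow z d'.
Proof.
rewrite /zpow -big_split/=; apply: eq_bigr => i _.
by rewrite ffunE expfzDr// rn1_neq0// rn_phase.
Qed.

Lemma zpow_conj z d : zpow z d * (zpow z d)^*%C = 1.
Proof. by rewrite conj_rn1// rn_zpow. Qed.

Lemma torus_rn z i : torus z -> rn (z 0 i) = 1.
Proof. by move=> /(_ i) z1; rewrite /rn z1. Qed.

Lemma torus_phase z i : torus z -> phase (z 0 i) = z 0 i.
Proof. by move=> tz; rewrite /phase (torus_rn i tz) eqxx. Qed.

Lemma zpow_torus_exp z d (m : {ffun 'I_k -> nat}) : torus z ->
  (forall i, d i = (m i)%:Z) -> zpow z d = torus_exp z m.
Proof.
by move=> tz dm; apply: eq_bigr => i _; rewrite torus_phase// dm -exprnP.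
Qed.

Lemma zpow_mul z w d : torus z -> torus w ->
  zpow (torus_mul z w) d = zpow z d * zpow w d.
Proof.
move=> tz tw; rewrite /zpow -big_split/=; apply: eq_bigr => i _.
rewrite !torus_phase//; first by rewrite mxE expfzMl.
by move=> j; rewrite mxE rnE rnMc !torus_rn// mulr1.
Qed.

Lemma zpow_one d : zpow (torus_one R k) d = 1.
Proof.
by apply: big1 => i _; rewrite mxE /phase rn1 eqxx exp1rz.
Qed.

Lemma rn_expr_sub (a b : R[i]) n : rn a = 1 -> rn b = 1 ->
  rn (a ^+ n - b ^+ n) <= n%:R * rn (a - b).
Proof.
move=> a1 b1; elim: n => [|n IH]; first by rewrite !expr0 subrr rn0 mul0r.
rewrite !exprS; have -> : a * a ^+ n - b * b ^+ n = a * (a ^+ n - b ^+ n) + (a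
  - b) * b ^+ n by ring.
apply: le_trans (rnD _ _) _; rewrite !rnMc rnXc a1 b1 expr1n mul1r mulr1.
by rewrite -natr1 mulrDl mul1r lerD2r.
Qed.

Lemma rn_torus_exp_sub z w (m : {ffun 'I_k -> nat}) (e : R) : torus z -> torus w ->
  (forall i, rn (z 0 i - w 0 i) <= e) ->
  rn (torus_exp z m - torus_exp w m) <= (\sum_i (m i)%:R) * e.
Proof.
move=> tz tw ze; rewrite /torus_exp mulr_suml.
suff gen (r : seq 'I_k) : rn (\prod_(i <- r) z 0 i ^+ m i - \prod_(i <- r) w 0 i ^+ m i)
    <= \sum_(i <- r) (m i)%:R * e /\ rn (\prod_(i <- r) z 0 i ^+ m i) = 1.
  by have [] := gen (index_enum 'I_k).
elim: r => [|i r [IH a1]]; first by rewrite !big_nil subrr rn0 rn1.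
rewrite !big_cons; set a := \prod_(j <- r) _; set b := \prod_(j <- r) _.
rewrite -/a -/b in IH a1.
have zi : rn (z 0 i ^+ m i) = 1 by rewrite rnXc torus_rn// expr1n.
have wi : rn (w 0 i ^+ m i) = 1 by rewrite rnXc torus_rn// expr1n.
split; last by rewrite rnMc zi a1 mulr1.
have -> : z 0 i ^+ m i * a - w 0 i ^+ m i * b =
  (z 0 i ^+ m i - w 0 i ^+ m i) * a + w 0 i ^+ m i * (a - b) by ring.
apply: le_trans (rnD _ _) _; rewrite !rnMc a1 wi mul1r mulr1 lerD//.
apply: le_trans (rn_expr_sub _ _ _) _; rewrite ?torus_rn//.
by rewrite ler_wpM2l.
Qed.

End GaugeAction.

Section RepresentationGauge.
Variables (k : nat) (L : kgraph k) (R : realType).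
Hypothesis fa : finitely_aligned L.

Notation Y := (set L * {ffun 'I_k -> int})%type.
Notation Z := 'rV[R[i]^o]_k.
Notation t := (@rep k L R fa).
Notation S := (cstar_gen (range t)).

Lemma some_inv (y z : Y) : Some y = Some z <-> Some z = Some y.
Proof. by split=> ->. Qed.

Lemma zpow_le1 (z : Z) (y : Y) : rn (zpow z y.2) <= 1.
Proof. by rewrite rn_zpow. Qed.

Definition gauge_unitary (z : Z) : bop R Y := wpop some_inv (zpow_le1 z).

Lemma gauge_unitaryE z xi x d : gauge_unitary z xi (x, d) = zpow z d * xi (x, d).
Proof. by rewrite wpopE. Qed.

Lemma gauge_unitary_starE z xi x d :
  star (gauge_unitary z) xi (x, d) = (zpow z d)^*%C * xi (x, d).
Proof. by rewrite wpop_starE. Qed.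

Lemma gauge_unitaryK z (a : bop R Y) : star (gauge_unitary z) ** (gauge_unitary
  z ** a) = a.
Proof.
apply: bop_ext => xi x d; rewrite !bop_mulE gauge_unitary_starE gauge_unitaryE.
by rewrite mulrA [_^*%C * _]mulrC zpow_conj mul1r.
Qed.

Lemma gauge_unitaryK' z (a : bop R Y) : gauge_unitary z ** (star (gauge_unitary
  z) ** a) = a.
Proof.
apply: bop_ext => xi x d; rewrite !bop_mulE gauge_unitaryE gauge_unitary_starE.
by rewrite mulrA zpow_conj mul1r.
Qed.

Lemma rn_gauge_unitary z : rn (gauge_unitary z) <= 1.
Proof. exact: rn_wpop_le1. Qed.

Definition gauge z : bop R Y -> bop R Y := conj_by (gauge_unitary z).

Lemma gauge_rep z l : gauge z (t l) = zpow z (degZ l) *: t l.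
Proof.
apply: bop_ext => xi x d; rewrite /gauge /conj_by !bop_mulE gauge_unitaryE.
rewrite bop_scaleE ell2Z !repE; case: asboolP => _; last by rewrite !mulr0.
rewrite gauge_unitary_starE mulrA; congr (_ * _).
by rewrite -{1}(subrK (degZ l) d) (zpowD _ _ (degZ l)) mulrAC zpow_conj mul1r.
Qed.

Lemma gauge_inv_rep z l :
  conj_by (star (gauge_unitary z)) (t l) = (zpow z (degZ l))^*%C *: t l.
Proof.
have := conj_byK (gauge_unitaryK z) (t l); rewrite -/(gauge z (t l)) gauge_rep.
rewrite cmulZr cmulZl => h; rewrite /conj_by starK -{2}h scalerA mulrC zpow_conj.
by rewrite scale1r.
Qed.

Lemma gen_rep l : S (t l). Proof. by apply: sub_cstar_gen; exists l. Qed.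

Lemma gauge_gen z a : S a -> S (gauge z a).
Proof.
apply: (conj_by_gen (gauge_unitaryK z) (rn_gauge_unitary z)) => _ [l _ <-].
rewrite -/(gauge z _) gauge_rep.
by apply: (cstar_subalgebraZ (cstar_gen_subalgebra _)); exact: gen_rep.
Qed.

Lemma gauge_inv_gen z a : S a -> S (conj_by (star (gauge_unitary z)) a).
Proof.
apply: conj_by_gen; rewrite ?starK.
- exact: gauge_unitaryK'.
- by rewrite rn_star rn_gauge_unitary.
- move=> _ [l _ <-]; rewrite gauge_inv_rep.
  by apply: (cstar_subalgebraZ (cstar_gen_subalgebra _)); exact: gen_rep.
Qed.

Lemma gauge_conjK z a : conj_by (star (gauge_unitary z)) (gauge z a) = a.
Proof. by rewrite {1}/conj_by starK; exact: (conj_byK (gauge_unitaryK z)). Qed.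

Lemma gauge_conjK' z a : gauge z (conj_by (star (gauge_unitary z)) a) = a.
Proof.
rewrite /gauge {1}/conj_by.
have := @conj_byK _ _ (star (gauge_unitary z)); rewrite starK; apply.
exact: gauge_unitaryK'.
Qed.

Lemma gauge_aut z : star_iso S S (gauge z).
Proof.
split.
- split.
  + by move=> a; exact: gauge_gen.
  + by move=> a b _ _ /(congr1 (conj_by (star (gauge_unitary z))));
    rewrite !gauge_conjK.
  + move=> b Sb; exists (conj_by (star (gauge_unitary z)) b);
    first exact: gauge_inv_gen.
    exact: gauge_conjK'.
- by move=> a b _ _; exact: conj_byD.
- by move=> c a _; exact: conj_byZ.
- by move=> a b _ _; exact: (conj_byM (gauge_unitaryK z)).
- by move=> a _; exact: conj_by_star.
Qed.

Lemma gauge_mul z w a : torus z -> torus w ->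
  gauge (torus_mul z w) a = gauge z (gauge w a).
Proof.
move=> tz tw.
have uE : gauge_unitary (torus_mul z w) = gauge_unitary z ** gauge_unitary w.
  by apply: bop_ext => xi x d; rewrite bop_mulE !gauge_unitaryE zpow_mul// mulrA.
by rewrite /gauge /conj_by uE starM !cmulA.
Qed.

Lemma gauge_one a : gauge (torus_one R k) a = a.
Proof.
apply: bop_ext => xi x d; rewrite /gauge /conj_by !bop_mulE gauge_unitaryE.
rewrite zpow_one mul1r; congr (a _ _); apply: ell2_eq => -[x' d'].
by rewrite gauge_unitary_starE zpow_one conjc1 mul1r.
Qed.

Definition gauge_equicontinuous (a : bop R Y) := forall e : R, 0 < e ->
  exists2 c : R, 0 < c & forall z w : Z, torus z -> torus w ->
    (forall i, rn (z 0 i - w 0 i) <= c) -> rn (gauge z a - gauge w a) <= e.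

Lemma rn_gauge z a : rn (gauge z a) <= rn a.
Proof. exact: rn_conj_by (rn_gauge_unitary z) a. Qed.

Lemma gauge_continuous f : S f -> gauge_equicontinuous f.
Proof.
apply: (cstar_gen_sub (S := gauge_equicontinuous)) => [|_ [l _ <-]]; last first.
  move=> e e0; pose M : R := \sum_i (deg l i)%:R.
  have M0 : 0 <= M by apply: sumr_ge0.
  exists (e / (M + 1)); first by rewrite divr_gt0//; lra.
  move=> z w tz tw zw; rewrite !gauge_rep -scalerBl rnZ.
  have dE i : degZ l i = (deg l i)%:Z by rewrite ffunE.
  rewrite !(zpow_torus_exp _ dE)//.
  have := rn_torus_exp_sub (deg l) tz tw zw; rewrite -/M => h1.
  have h2 : M * (e / (M + 1)) <= e by rewrite mulrA ler_pdivrMr; nra.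
  have h3 := rn_wpop_le1 (bwd_fwd fa l) (@rn1_le1 k L R).
  apply: le_trans (le_trans h1 h2); rewrite ler_piMr ?rn_ge0//.
split.
- move=> e e0; exists 1 => // z w _ _ _.
  have g0 v : gauge v 0 = 0 by rewrite /gauge /conj_by cmul0r cmul0l.
  by rewrite !g0 subrr rn0 ltW.
- move=> a b ha hb e e0; have e2 : 0 < e / 2 by rewrite divr_gt0.
  have [c c0 hc] := ha _ e2; have [d d0 hd] := hb _ e2.
  have mc : Num.min c d <= c by rewrite ge_min lexx.
  have md : Num.min c d <= d by rewrite ge_min lexx orbT.
  exists (Num.min c d); first by rewrite lt_min c0.
  move=> z w tz tw zw; rewrite /gauge !conj_byD -!/(gauge _ _) opprD addrACA.
  apply: le_trans (rnD _ _) _.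
  have := hc z w tz tw (fun i => le_trans (zw i) mc).
  have := hd z w tz tw (fun i => le_trans (zw i) md).
  lra.
- move=> r a ha e e0; have [d [d0 _ dc]] := small_scale e0 (rn_ge0 r).
  have [c c0 hc] := ha _ d0; exists c => // z w tz tw zw.
  rewrite /gauge !conj_byZ -!/(gauge _ _) -scalerBr rnZ.
  by have := hc z w tz tw zw; have := rn_ge0 r; nra.
- move=> a b ha hb e e0.
  have [|s [s0 _ sc]] := small_scale (M := rn a + rn b) e0.
    by rewrite addr_ge0 ?rn_ge0.
  have [c c0 hc] := ha _ s0; have [d d0 hd] := hb _ s0.
  have mc : Num.min c d <= c by rewrite ge_min lexx.
  have md : Num.min c d <= d by rewrite ge_min lexx orbT.
  exists (Num.min c d); first by rewrite lt_min c0.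
  move=> z w tz tw zw.
  rewrite /gauge (conj_byM (gauge_unitaryK z)) (conj_byM (gauge_unitaryK w))
    -!/(gauge _ _).
  rewrite cmul_sub_split.
  have h1 := hc z w tz tw (fun i => le_trans (zw i) mc).
  have h2 := hd z w tz tw (fun i => le_trans (zw i) md).
  apply: le_trans (rnD _ _) _; apply: le_trans (lerD (rnM _ _) (rnM _ _)) _.
  have g1 := rn_gauge z a; have g2 := rn_gauge w b.
  apply: le_trans sc; rewrite mulrDr [s * rn a]mulrC.
  by apply: lerD; apply: ler_pM; rewrite ?rn_ge0.
- move=> a ha e /ha[c c0 hc]; exists c => // z w tz tw zw.
  by rewrite /gauge !conj_by_star -starB rn_star; exact: hc.
- apply: rn_closed => a ha e e0; have e3 : 0 < e / 3 by rewrite divr_gt0.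
  have [b hb ab] := ha _ e3; have [c c0 hc] := hb _ e3; exists c => // z w tz tw zw.
  have h1 := hc z w tz tw zw.
  have h2 v : rn (gauge v a - gauge v b) <= e / 3.
    by rewrite /gauge -conj_byB; apply: le_trans ab; exact: rn_gauge.
  apply: le_trans (rn_triangle4 _ _ (gauge z b) (gauge w b)) _.
  by apply: le_trans (lerD (lerD (h2 z) h1) (h2 w)) _; lra.
Qed.

Lemma gauge_torus_action : torus_action S gauge.
Proof.
split.
- by move=> z _; exact: gauge_aut.
- by move=> a _; exact: gauge_one.
- by move=> z w a tz tw _; exact: gauge_mul.
- move=> a Sa; apply/subspace_continuousP => z tz.
  apply/cvgrPdist_le => e e0.
  have e1 : 0 < complex.Re e by rewrite -ltcR RRe_real// gtr0_real.
  have [c c0 hc] := gauge_continuous Sa e1.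
  rewrite near_withinE.
  have c0' : 0 < c%:C by rewrite ltcR.
  apply: filterS (nbhsx_ballx z c%:C c0') => w zw tw.
  rewrite rnE -[leRHS]RRe_real ?gtr0_real// lecR; apply: hc => // i.
  have [_ /(_ 0 i)] := zw.
  rewrite -ball_normE /ball_/= ltc_rn// => /ltW.
  exact: le_trans.
Qed.

Lemma rep_gauge_ck : gauge_ck_family t.
Proof.
split; [exact: rep_ck|exact: rep_vertex_neq0|].
exists gauge; first exact: gauge_torus_action.
move=> z l tz; rewrite gauge_rep; congr (_ *: _).
by apply: zpow_torus_exp => // i; rewrite ffunE.
Qed.

End RepresentationGauge.

Theorem corollary4p3 (R : realType) (k : nat) (L : kgraph k)
    (hL : finitely_aligned L) :
  (exists (A : cstarAlgType R) (t : kpath L -> A), gauge_ck_family t) /\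
  (forall (A B : cstarAlgType R) (t : kpath L -> A) (t' : kpath L -> B),
    gauge_ck_family t -> gauge_ck_family t' ->
    exists2 phi : A -> B,
      star_iso (cstar_gen (range t)) (cstar_gen (range t')) phi
    & forall l : kpath L, phi (t l) = t' l).
Proof.
split; first by exists (bop R (set L * {ffun 'I_k -> int})%type), (rep R hL); exact: rep_gauge_ck.
by move=> A B t t'; exact: gauge_uniqueness.
Qed.
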